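(* Let $K$ be a number field, $E/K$ an elliptic curve with Weierstrass equation $w_E(x,y)=0$, and $u$ a polynomial of degree $1$ in $x$ and $y$ with coefficients in $K$ such that $K[u,[-1]^*u]=K[x,y]$. Let $n$ be a positive integer and let $\chi_{u,n}\in K[T]$ be the characteristic polynomial of multiplication by $u$ on the finite-dimensional $K$-algebra $A=K[X,Y]/(\widetilde{\psi}_n,w_E)$. Then $K(\chi_{u,n})\simeq K(E[n])$ and $\mathrm{Gal}(\chi_{u,n})\simeq\rho_{E,n}(G_K)$.
   Context: $\overline{K}$ is an algebraic closure of $K$, $G_K=\mathrm{Gal}(\overline{K}/K)$, and $\rho_{E,n}:G_K\to\mathrm{Aut}(E[n])\simeq\mathrm{GL}_2(\mathbb{Z}/n\mathbb{Z})$ is the Galois representation on the $n$-torsion of $E$. For $f\in K[T]$, $K(f)\subset\overline{K}$ is the splitting field of $f$ over $K$ and $\mathrm{Gal}(f)=\mathrm{Gal}(K(f)/K)$. $K(E[n])$ is the extension of $K$ generated by the coordinates of the nonzero $n$-torsion points; the first isomorphism is one of extensions of $K$. $w_E(X,Y)=Y^2+a_1XY+a_3Y-X^3-a_2X^2-a_4X-a_6$ with $a_i\in K$; $K[x,y]=K[X,Y]/(w_E)$ is the affine coordinate ring. $[-1]^*u$ is the pull-back of $u$ by inversion on $E$ ($y$ is replaced by $-y-a_1x-a_3$). Let $(\psi_n)_{n\ge1}$ be the usual division polynomials of $E$ (with $\psi_1=1$, $\psi_2=2y+a_1x+a_3$, $\psi_n^2$ being a polynomial in $x$ with leading coefficient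 $n^2$ whose roots are the $x$-coordinates of the nonzero $n$-torsion points). The primitive division polynomials $\widetilde{\psi}_n$ are defined recursively by $\psi_n=\prod_{m\mid n}\widetilde{\psi}_m$; for $n\ne 2$, $\widetilde{\psi}_n\in K[X]$ is a polynomial in $x$ alone, while $\widetilde{\psi}_2=2Y+a_1X+a_3$, so that $A\simeq K[X]/(\psi_2^2(X))$ when $n=2$. *)

(* Defs.v *)
From HB Require Import structures.
From mathcomp Require Import all_boot all_order all_algebra all_field.
From mathcomp Require Import boolp classical_sets functions.
From mathcomp Require Import mpoly zify ring.

Set Implicit Arguments.
Unset Strict Implicit.
Unset Printing Implicit Defensive.

Import GRing.Theory.
Local Open Scope ring_scope.

(** * Quotients of commutative algebras by finitely generated ideals *)

Section IdealGen.
Variables (R : comNzRingType) (gs : seq R).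

Definition ideal_gen : {pred R} :=
  fun f => `[< exists c : 'I_(size gs) -> R, f = \sum_i c i * gs`_i >].

Lemma ideal_genP f :
  reflect (exists c : 'I_(size gs) -> R, f = \sum_i c i * gs`_i)
          (f \in ideal_gen).
Proof. exact: asboolP. Qed.

Lemma ideal_gen_zmod : zmod_closed ideal_gen.
Proof.
split; first by apply/ideal_genP; exists (fun=> 0); rewrite big1 // => i _; rewrite mul0r.
move=> x y /ideal_genP[c ->] /ideal_genP[d ->]; apply/ideal_genP.
exists (fun i => c i - d i); rewrite -sumrB; apply: eq_bigr => i _.
by rewrite mulrBl.
Qed.

HB.instance Definition _ := GRing.isZmodClosed.Build R ideal_gen ideal_gen_zmod.

Lemma ideal_genMl a x : x \in ideal_gen -> a * x \in ideal_gen.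
Proof.
move=> /ideal_genP[c ->]; apply/ideal_genP; exists (fun i => a * c i).
by rewrite mulr_sumr; apply: eq_bigr => i _; rewrite mulrA.
Qed.

Lemma ideal_gen_mem i : (i < size gs)%N -> gs`_i \in ideal_gen.
Proof.
move=> li; apply/ideal_genP; exists (fun j => (nat_of_ord j == i)%:R).
rewrite (bigD1 (Ordinal li)) //= eqxx mul1r big1 ?addr0 // => j ne.
by rewrite -[i]/(nat_of_ord (Ordinal li)) val_eqE (negbTE ne) mul0r.
Qed.

End IdealGen.

(* The library's {ideal_quot I} is restricted to proper ideals; the ideal may
   be the whole ring here, so we build the (possibly zero) quotient algebra on
   top of the library's quotient Z-module. *)
Section QuotAlg.
Variables (K : fieldType) (R : comAlgType K) (gs : seq R).

Definition quot_alg : Type := Quotient.quot (ideal_gen gs).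
HB.instance Definition _ := GRing.Zmodule.on quot_alg.

Definition qpi (x : R) : quot_alg := (\pi_(Quotient.quot (ideal_gen gs)) x)%qT.
Definition qrepr (a : quot_alg) : R := repr (a : Quotient.quot (ideal_gen gs)).

Lemma qreprK : cancel qrepr qpi. Proof. exact: reprK. Qed.

Lemma qpiE x y : (qpi x = qpi y) <-> (x - y \in ideal_gen gs).
Proof.
rewrite Quotient.idealrBE; split; first by move=> h; apply/eqP.
by move/eqP.
Qed.

Lemma qpi_zmod : zmod_morphism qpi.
Proof. exact: (@raddfB _ _ (\pi_(Quotient.quot (ideal_gen gs)))%qT). Qed.
HB.instance Definition _ := GRing.isZmodMorphism.Build R quot_alg qpi qpi_zmod.

Lemma qreprP x : exists2 z, z \in ideal_gen gs & qrepr (qpi x) = x + z.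
Proof.
exists (qrepr (qpi x) - x); last by rewrite addrC subrK.
by apply/qpiE; rewrite qreprK.
Qed.

Definition qmul (a b : quot_alg) := qpi (qrepr a * qrepr b).
Definition qscale (k : K) (a : quot_alg) := qpi (k *: qrepr a).

Lemma qmulE x y : qmul (qpi x) (qpi y) = qpi (x * y).
Proof.
have [z zI ez] := qreprP x; have [t tI et] := qreprP y.
apply/qpiE; rewrite ez et.
have -> : (x + z) * (y + t) - x * y = (x + z) * t + y * z by ring.
by rewrite rpredD // ideal_genMl.
Qed.

Lemma qscaleE k x : qscale k (qpi x) = qpi (k *: x).
Proof.
have [z zI ez] := qreprP x; apply/qpiE.
by rewrite ez scalerDr addrC addKr -mulr_algl ideal_genMl.
Qed.

Lemma qmulA : associative qmul.
Proof.
by move=> a b c; rewrite -[a]qreprK -[b]qreprK -[c]qreprK !qmulE mulrA.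
Qed.
Lemma qmulC : commutative qmul.
Proof. by move=> a b; rewrite /qmul mulrC. Qed.
Lemma qmul1 : left_id (qpi 1) qmul.
Proof. by move=> a; rewrite -[a]qreprK qmulE mul1r. Qed.
Lemma qmulDl : left_distributive qmul +%R.
Proof.
move=> a b c; rewrite -[a]qreprK -[b]qreprK -[c]qreprK.
by rewrite -raddfD !qmulE -raddfD mulrDl.
Qed.
HB.instance Definition _ :=
  GRing.Zmodule_isComPzRing.Build quot_alg qmulA qmulC qmul1 qmulDl.

Lemma qscaleA a b v : qscale a (qscale b v) = qscale (a * b) v.
Proof. by rewrite -[v]qreprK !qscaleE scalerA. Qed.
Lemma qscale1 : left_id 1 qscale.
Proof. by move=> v; rewrite -[v]qreprK qscaleE scale1r. Qed.
Lemma qscaleDr : right_distributive qscale +%R.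
Proof.
move=> a v w; rewrite -[v]qreprK -[w]qreprK.
by rewrite -raddfD !qscaleE -raddfD scalerDr.
Qed.
Lemma qscaleDl v : {morph qscale^~ v : a b / a + b}.
Proof. by move=> a b; rewrite -[v]qreprK !qscaleE -raddfD scalerDl. Qed.
HB.instance Definition _ := GRing.Zmodule_isLmodule.Build K quot_alg
  qscaleA qscale1 qscaleDr qscaleDl.

Lemma qscaleAl (k : K) (a b : quot_alg) : k *: (a * b) = (k *: a) * b.
Proof.
rewrite -[a]qreprK -[b]qreprK.
by rewrite [LHS](congr1 (qscale k) (qmulE _ _)) qscaleE
  [RHS](congr1 (qmul^~ _) (qscaleE _ _)) qmulE scalerAl.
Qed.

Lemma qpi_monoid : monoid_morphism qpi.
Proof. by split=> // x y; rewrite -qmulE. Qed.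
HB.instance Definition _ :=
  GRing.isMonoidMorphism.Build R quot_alg qpi qpi_monoid.

Lemma qpi_scalable : scalable qpi.
Proof. by move=> k x; rewrite -qscaleE. Qed.
HB.instance Definition _ :=
  GRing.isScalable.Build K R quot_alg *:%R qpi qpi_scalable.

End QuotAlg.

(** * Characteristic polynomials of endomorphisms of K-vector spaces *)

Section CharPoly.
Variables (K : fieldType) (V : lmodType K).

Definition is_basis d (e : 'I_d -> V) : Prop :=
  forall v : V, exists! c : 'rV[K]_d, v = \sum_i c 0 i *: e i.

Definition is_charpoly (f : V -> V) (chi : {poly K}) : Prop :=
  exists (d : nat) (e : 'I_d -> V) (M : 'M[K]_d),
    [/\ is_basis e, forall i, f (e i) = \sum_j M i j *: e j & chi = char_poly M].

(* [is_charpoly f] has at most one solution for linear f; the junk value 0 is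
   taken when V is not finite-dimensional. *)
Definition charpoly (f : V -> V) : {poly K} :=
  xget 0 [set chi | is_charpoly f chi]%classic.

End CharPoly.

(** * Field extensions and Galois groups *)

Section Adjoin.
Variables (K L : fieldType) (iota : {rmorphism K -> L}) (S : set L).

Definition adjoin : {pred L} := fun z => `[< forall P : {pred L},
  divring_closed P -> (forall a, iota a \in P) -> (forall x, S x -> x \in P) ->
  z \in P >].

Lemma adjoinP z : reflect (forall P : {pred L}, divring_closed P ->
  (forall a, iota a \in P) -> (forall x, S x -> x \in P) -> z \in P)
  (z \in adjoin).
Proof. exact: asboolP. Qed.

Lemma adjoin_divring : divring_closed adjoin.
Proof.
split=> [|x y /adjoinP xP /adjoinP yP|x y /adjoinP xP /adjoinP yP];
  apply/adjoinP => P dP bP sP; have [P1 PB PV] := dP => //.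
- by apply: PB; [apply: xP|apply: yP].
- by apply: PV; [apply: xP|apply: yP].
Qed.

HB.instance Definition _ := GRing.isDivringClosed.Build L adjoin adjoin_divring.

Lemma adjoin_base a : iota a \in adjoin.
Proof. by apply/adjoinP => P _ bP _. Qed.

Lemma adjoin_gen x : S x -> x \in adjoin.
Proof. by move=> Sx; apply/adjoinP => P _ _; apply. Qed.

Record adjoined := Adjoined { adjoined_val :> L; _ : adjoined_val \in adjoin }.

HB.instance Definition _ := [isSub for adjoined_val].
HB.instance Definition _ := [Choice of adjoined by <:].
HB.instance Definition _ := [SubChoice_isSubIntegralDomain of adjoined by <:].
HB.instance Definition _ := [SubIntegralDomain_isSubField of adjoined by <:].

Definition adjoined_in (a : K) : adjoined := Adjoined (adjoin_base a).

Lemma adjoined_in_zmod : zmod_morphism adjoined_in.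
Proof. by move=> a b; apply: val_inj; rewrite rmorphB /= rmorphB. Qed.
Lemma adjoined_in_monoid : monoid_morphism adjoined_in.
Proof.
by split=> [|a b]; apply: val_inj; rewrite ?rmorph1 ?rmorphM /= ?rmorph1 ?rmorphM.
Qed.
HB.instance Definition _ :=
  GRing.isZmodMorphism.Build K adjoined adjoined_in adjoined_in_zmod.
HB.instance Definition _ :=
  GRing.isMonoidMorphism.Build K adjoined adjoined_in adjoined_in_monoid.

End Adjoin.

Section Extensions.
Variable K : fieldType.

Definition ext_isom (F1 F2 : fieldType) (i1 : {rmorphism K -> F1})
    (i2 : {rmorphism K -> F2}) : Prop :=
  exists f : {rmorphism F1 -> F2}, bijective f /\ forall a, f (i1 a) = i2 a.

Definition gal_over (F : fieldType) (i : {rmorphism K -> F}) : set (F -> F) :=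
  [set s | [/\ zmod_morphism s, monoid_morphism s, bijective s
            & forall a, s (i a) = i a]]%classic.

Lemma gal_overP (F : fieldType) (i : {rmorphism K -> F}) s : gal_over i s ->
  [/\ zmod_morphism s, monoid_morphism s, bijective s
    & forall a, s (i a) = i a].
Proof. by []. Qed.

(* Roots in L; in an algebraically closed L they generate the splitting field. *)
Definition roots_of (L : fieldType) (iota : {rmorphism K -> L})
    (f : {poly K}) : set L :=
  [set z | root (map_poly iota f) z]%classic.

End Extensions.

(* Isomorphism between groups of permutations, the law being composition. *)
Definition perm_group_isom (T U : Type) (A : set (T -> T)) (B : set (U -> U)) :
    Prop :=
  exists Phi : (T -> T) -> (U -> U), set_bij A B Phi /\
    forall f g, A f -> A g -> Phi (f \o g) = Phi f \o Phi g.

(** * Weierstrass curves *)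

Record weierstrass (R : Type) := Weierstrass { a1 : R; a2 : R; a3 : R; a4 : R; a6 : R }.

Definition map_weierstrass (R S : Type) (f : R -> S) (W : weierstrass R) :=
  Weierstrass (f (a1 W)) (f (a2 W)) (f (a3 W)) (f (a4 W)) (f (a6 W)).

Section Invariants.
Variables (R : comNzRingType) (W : weierstrass R).

Definition b2 : R := a1 W ^+ 2 + 4 * a2 W.
Definition b4 : R := 2 * a4 W + a1 W * a3 W.
Definition b6 : R := a3 W ^+ 2 + 4 * a6 W.
Definition b8 : R := a1 W ^+ 2 * a6 W + 4 * a2 W * a6 W - a1 W * a3 W * a4 W
                     + a2 W * a3 W ^+ 2 - a4 W ^+ 2.
Definition disc : R :=
  - b2 ^+ 2 * b8 - 8 * b4 ^+ 3 - 27 * b6 ^+ 2 + 9 * b2 * b4 * b6.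

End Invariants.

Definition elliptic (F : fieldType) (W : weierstrass F) : Prop := disc W != 0.

(** ** Points and group law; [None] is the point at infinity *)

Section Points.
Variables (F : fieldType) (W : weierstrass F).
Local Notation point := (option (F * F)).

Definition on_curve (P : point) : bool :=
  if P is Some (x, y) then
    y ^+ 2 + a1 W * x * y + a3 W * y
      == x ^+ 3 + a2 W * x ^+ 2 + a4 W * x + a6 W
  else true.

Definition pt_neg (P : point) : point :=
  if P is Some (x, y) then Some (x, - y - a1 W * x - a3 W) else None.

(* [l] is the slope of the chord or tangent through P and Q. *)
Definition pt_add (P Q : point) : point :=
  match P, Q with
  | None, _ => Q
  | _, None => P
  | Some (x1, y1), Some (x2, y2) =>
      if Q == pt_neg P then None else
      let l := if x1 == x2
               then (3 * x1 ^+ 2 + 2 * a2 W * x1 + a4 W - a1 W * y1)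
                      / (2 * y1 + a1 W * x1 + a3 W)
               else (y2 - y1) / (x2 - x1) in
      let x3 := l ^+ 2 + a1 W * l - a2 W - x1 - x2 in
      pt_neg (Some (x3, y1 + l * (x3 - x1)))
  end.

Definition pt_mul (n : nat) (P : point) : point := iter n (pt_add P) None.

Definition torsion (n : nat) : {pred point} :=
  fun P => on_curve P && (pt_mul n P == None).

Definition torsion_pt (n : nat) : Type := {P : point | P \in torsion n}.

Definition torsion_coords (n : nat) : set F :=
  [set z | exists x y, Some (x, y) \in torsion n /\ (z = x \/ z = y)]%classic.

Definition torsion_aut (n : nat) : set (torsion_pt n -> torsion_pt n) :=
  [set t : torsion_pt n -> torsion_pt n |
     bijective t /\ forall P Q S : torsion_pt n,
     val S = pt_add (val P) (val Q) ->
     val (t S) = pt_add (val (t P)) (val (t Q))]%classic.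

End Points.

(** ** The Galois action on torsion points *)

Section Rho.
Variables (K L : fieldType) (iota : {rmorphism K -> L}) (W : weierstrass K).
Variable n : nat.
Local Notation WL := (map_weierstrass iota W).

Definition pt_map (s : L -> L) (P : option (L * L)) : option (L * L) :=
  if P is Some (x, y) then Some (s x, s y) else None.

(* rho(G_K) is the image of [gal_over iota], a set of automorphisms of E[n] by
   [rho_aut]. The default value of [insubd] is not reached when [s \in gal_over iota], see
   [rhoE]. *)
Definition rho (s : L -> L) : torsion_pt WL n -> torsion_pt WL n :=
  fun P => insubd P (pt_map s (val P)).

Definition rho_image : set (torsion_pt WL n -> torsion_pt WL n) :=
  (rho @` gal_over iota)%classic.

Section Action.
Variables (s : L -> L) (sG : gal_over iota s).

Let sB : {morph s : x y / x - y}. Proof. by case: (gal_overP sG). Qed.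
Let s1M : monoid_morphism s. Proof. by case: (gal_overP sG). Qed.
Let sbij : bijective s. Proof. by case: (gal_overP sG). Qed.
Let siota a : s (iota a) = iota a. Proof. by case: (gal_overP sG). Qed.

#[local] HB.instance Definition _ := GRing.isZmodMorphism.Build L L s sB.
#[local] HB.instance Definition _ := GRing.isMonoidMorphism.Build L L s s1M.

Let sD : {morph s : x y / x + y}. Proof. exact: rmorphD. Qed.
Let sN : {morph s : x / - x}. Proof. exact: rmorphN. Qed.
Let sM : {morph s : x y / x * y}. Proof. exact: rmorphM. Qed.
Let sX k : {morph s : x / x ^+ k}. Proof. exact: rmorphXn. Qed.
Let sV : {morph s : x / x^-1}. Proof. exact: fmorphV. Qed.
Let sn k : s k%:R = k%:R. Proof. exact: rmorph_nat. Qed.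
Let sE := (sD, sB, sN, sM, sX, sV, sn, siota).
Let sinj : injective s := bij_inj sbij.

Lemma pt_map_on P : on_curve WL (pt_map s P) = on_curve WL P.
Proof.
case: P => [[x y]|] //=.
by rewrite -[in RHS](inj_eq sinj) !sE.
Qed.

Lemma pt_map_neg P : pt_map s (pt_neg WL P) = pt_neg WL (pt_map s P).
Proof. by case: P => [[x y]|] //=; rewrite !sE. Qed.

Lemma pt_map_inj : injective (pt_map s).
Proof.
by move=> [[x y]|] [[x' y']|] //= [] /sinj-> /sinj->.
Qed.

Lemma pt_map_add P Q :
  pt_map s (pt_add WL P Q) = pt_add WL (pt_map s P) (pt_map s Q).
Proof.
case: P Q => [[x y]|] [[x' y']|] //; rewrite /pt_add.
rewrite -[LHS]/(pt_map s (if _ then _ else _)) -[RHS]/(if _ then _ else _).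
have -> : (pt_map s (Some (x', y')) == pt_neg WL (pt_map s (Some (x, y))))
          = (Some (x', y') == pt_neg WL (Some (x, y))).
  by rewrite -pt_map_neg (inj_eq pt_map_inj).
case: ifP => // _; rewrite pt_map_neg /= (inj_eq sinj).
by case: ifP => _; rewrite !sE.
Qed.

Lemma pt_map_torsion P : (pt_map s P \in torsion WL n) = (P \in torsion WL n).
Proof.
rewrite -!topredE /= /torsion pt_map_on; congr (_ && _).
have -> : pt_mul WL n (pt_map s P) = pt_map s (pt_mul WL n P).
  by elim: n => //= m IH; rewrite IH pt_map_add.
by case: pt_mul => [[]|].
Qed.

Lemma rhoE P : val (rho s P) = pt_map s (val P).
Proof. by rewrite /rho val_insubd pt_map_torsion (valP P). Qed.

Lemma rho_aut : torsion_aut (rho s).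
Proof.
split; last by move=> P Q S e; rewrite !rhoE e pt_map_add.
have [r sr rs] := sbij.
have pK : cancel (pt_map r) (pt_map s) by move=> [[x y]|] //=; rewrite !rs.
have rP P : P \in torsion WL n -> pt_map r P \in torsion WL n.
  by move=> PT; rewrite -pt_map_torsion pK.
exists (fun P : torsion_pt WL n => insubd P (pt_map r (val P))) => P.
  apply: val_inj; rewrite val_insubd rP ?rhoE ?pt_map_torsion ?(valP P) //.
  by apply: pt_map_inj; rewrite pK.
by apply: val_inj; rewrite rhoE val_insubd rP ?(valP P) ?pK.
Qed.

End Action.

Lemma rho_comp s t : gal_over iota s -> gal_over iota t -> rho (s \o t) = rho s \o rho t.
Proof.
move=> sG tG; apply/funext => P; apply: val_inj.
have stG : gal_over iota (s \o t).
  case: (gal_overP sG) => sB [s1 sM] sb sK; case: (gal_overP tG) => tB [t1 tM] tb tK.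
  split; first by move=> x y /=; rewrite tB sB.
  - by split=> [|x y] /=; rewrite ?t1 ?s1 ?tM ?sM.
  - exact: bij_comp.
  - by move=> a /=; rewrite tK sK.
by rewrite /= !rhoE //; case: (val P) => [[]|].
Qed.

End Rho.

Arguments rho {K L} iota W n s P.
Arguments rho_image {K L} iota W n.

(** ** Coordinate ring and division polynomials *)

Section DivisionPolynomials.
Variables (K : fieldType) (W : weierstrass K).
Local Notation KXY := {mpoly K[2]}.

Definition mX : KXY := 'X_ord0.
Definition mY : KXY := 'X_ord_max.

Definition w_poly : KXY :=
  mY ^+ 2 + (a1 W)%:MP * mX * mY + (a3 W)%:MP * mY
  - mX ^+ 3 - (a2 W)%:MP * mX ^+ 2 - (a4 W)%:MP * mX - (a6 W)%:MP.

Definition coord_ring : Type := quot_alg [:: w_poly].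

Definition inv_pullback (u : KXY) : KXY :=
  u \mPo [tuple mX; - mY - (a1 W)%:MP * mX - (a3 W)%:MP].

(* K[u, [-1]^* u] = K[x, y], the left-hand side being the set of values at
   (u, [-1]^* u) of polynomials over K. *)
Definition generates_coord_ring (u : KXY) : Prop :=
  forall f : coord_ring, exists P : KXY,
    f = qpi [:: w_poly] (P \mPo [tuple u; inv_pullback u]).

Definition psi2_sq : {poly K} :=
  4 *: 'X^3 + b2 W *: 'X^2 + (2 * b4 W) *: 'X + (b6 W)%:P.
Definition psi3 : {poly K} :=
  3 *: 'X^4 + b2 W *: 'X^3 + (3 * b4 W) *: 'X^2 + (3 * b6 W) *: 'X + (b8 W)%:P.
Definition psi4_red : {poly K} :=
  2 *: 'X^6 + b2 W *: 'X^5 + (5 * b4 W) *: 'X^4 + (10 * b6 W) *: 'X^3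
  + (10 * b8 W) *: 'X^2 + (b2 W * b8 W - b4 W * b6 W) *: 'X
  + (b4 W * b8 W - b6 W ^+ 2)%:P.

(* [divpolyX n] is psi_n for odd n and psi_n / psi_2 for even n, as a
   polynomial in x; [k] is a recursion bound. The usual recurrences are
   [divpoly_rec_odd] and [divpoly_rec_even] below. *)
Fixpoint divpolyX_rec (k n : nat) : {poly K} :=
  if k isn't k'.+1 then 0 else
  let f := divpolyX_rec k' in
  match n with
  | 0 => 0
  | 1 | 2 => 1
  | 3 => psi3
  | 4 => psi4_red
  | _ =>
      let m := n./2 in
      if odd n then
        (if odd m then 1 else psi2_sq ^+ 2) * f m.+2 * f m ^+ 3
        - (if odd m then psi2_sq ^+ 2 else 1) * f m.-1 * f m.+1 ^+ 3
      else f m * (f m.+2 * f m.-1 ^+ 2 - f m.-2 * f m.+1 ^+ 2)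
  end.

Definition divpolyX (n : nat) : {poly K} := divpolyX_rec n.+1 n.

Definition polyX_in (p : {poly K}) : KXY := (map_poly (@mpolyC 2 K) p).[mX].

Definition psi2 : KXY := 2 * mY + (a1 W)%:MP * mX + (a3 W)%:MP.

Definition divpoly (n : nat) : KXY :=
  polyX_in (divpolyX n) * (if odd n then 1 else psi2).

(* [psi_n] and [primdivpoly n] differ from [divpolyX n] and [primdivX n] by the
   factor psi_2 for even n and for n = 2 respectively, so that psi_n is the
   product of the [primdivpoly m], m %| n, when [divpolyX n] is the product of
   the [primdivX m]. The division is exact for elliptic curves over number
   fields; see [primdivXE] for the recursion without the bound [k]. *)
Fixpoint primdivX_rec (k n : nat) : {poly K} :=
  if k isn't k'.+1 then 1 else
  divpolyX n %/ \prod_(1 <= m < n | (m %| n)%N) primdivX_rec k' m.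

Definition primdivX (n : nat) : {poly K} := primdivX_rec n n.

Definition primdivpoly (n : nat) : KXY :=
  if n == 2%N then psi2 else polyX_in (primdivX n).

(* chi_{u,n}; the quotient algebra is zero, and chi_{u,n} = 1, for n = 1. *)
Definition chi_poly (u : KXY) (n : nat) : {poly K} :=
  charpoly (fun v : quot_alg [:: primdivpoly n; w_poly] => qpi _ u * v).

Lemma divpolyX_rec_step k n : (4 < n)%N ->
  let f := divpolyX_rec k in let m := n./2 in
  divpolyX_rec k.+1 n =
    if odd n then
      (if odd m then 1 else psi2_sq ^+ 2) * f m.+2 * f m ^+ 3
      - (if odd m then psi2_sq ^+ 2 else 1) * f m.-1 * f m.+1 ^+ 3
    else f m * (f m.+2 * f m.-1 ^+ 2 - f m.-2 * f m.+1 ^+ 2).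
Proof. by move: n => [|[|[|[|[|n]]]]]. Qed.

Lemma divpolyX_rec_stable k k' n : (n < k)%N -> (n < k')%N ->
  divpolyX_rec k n = divpolyX_rec k' n.
Proof.
elim/ltn_ind: n k k' => n IH [|k] [|k'] // nk nk'.
have [n5|n4] := ltnP 4 n; last by move: n n4 {IH nk nk'} => [|[|[|[|[|n]]]]].
have h1 : (n./2.+2 < n)%N by lia.
have lt i : (i <= n./2.+2)%N -> divpolyX_rec k i = divpolyX_rec k' i.
  by move=> li; apply: IH; lia.
by rewrite !divpolyX_rec_step // !lt //; lia.
Qed.

Lemma divpolyX_odd m : (1 < m)%N ->
  divpolyX m.*2.+1 =
    (if odd m then 1 else psi2_sq ^+ 2) * divpolyX m.+2 * divpolyX m ^+ 3
    - (if odd m then psi2_sq ^+ 2 else 1) * divpolyX m.-1 * divpolyX m.+1 ^+ 3.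
Proof.
move=> m1; rewrite {1}/divpolyX divpolyX_rec_step; last by lia.
have -> : (m.*2.+1)./2 = m by lia.
have -> : odd m.*2.+1 by lia.
have st i : (i <= m.+2)%N -> divpolyX_rec m.*2.+1 i = divpolyX i.
  by move=> li; apply: divpolyX_rec_stable => //; lia.
by rewrite !st //; lia.
Qed.

Lemma divpolyX_even m : (2 < m)%N ->
  divpolyX m.*2 = divpolyX m * (divpolyX m.+2 * divpolyX m.-1 ^+ 2
                                - divpolyX m.-2 * divpolyX m.+1 ^+ 2).
Proof.
move=> m2; rewrite {1}/divpolyX divpolyX_rec_step; last by lia.
rewrite odd_double doubleK.
have st i : (i <= m.+2)%N -> divpolyX_rec m.*2 i = divpolyX i.
  by move=> li; apply: divpolyX_rec_stable => //; lia.
by rewrite !st //; lia.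
Qed.

Lemma primdivX_rec_stable k k' n : (0 < n)%N -> (n <= k)%N -> (n <= k')%N ->
  primdivX_rec k n = primdivX_rec k' n.
Proof.
elim/ltn_ind: n k k' => n IH [|k] [|k'] n0 nk nk' //=; try by lia.
congr (_ %/ _); rewrite big_nat_cond [RHS]big_nat_cond.
by apply: eq_bigr => m mn; apply: IH; lia.
Qed.

Lemma primdivXE n : (0 < n)%N ->
  primdivX n = divpolyX n %/ \prod_(1 <= m < n | (m %| n)%N) primdivX m.
Proof.
case: n => // n _; rewrite {1}/primdivX /=; congr (_ %/ _).
rewrite big_nat_cond [RHS]big_nat_cond.
by apply: eq_bigr => m mn; apply: primdivX_rec_stable; lia.
Qed.

Local Notation pi := (qpi [:: w_poly]).

Lemma polyX_in_morph :
  [/\ {morph polyX_in : p q / p + q}, {morph polyX_in : p q / p - q},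
      {morph polyX_in : p q / p * q}, polyX_in 1 = 1
    & forall c, polyX_in c%:P = c%:MP].
Proof.
split=> [p q|p q|p q||c]; rewrite /polyX_in.
- by rewrite rmorphD hornerD.
- by rewrite rmorphB hornerD hornerN.
- by rewrite rmorphM hornerM.
- by rewrite rmorph1 hornerC.
by rewrite map_polyC hornerC.
Qed.

Lemma psi2_sqE : psi2 ^+ 2 = polyX_in psi2_sq + 4 * w_poly.
Proof.
have cX k c : polyX_in (c *: 'X^k) = c%:MP * mX ^+ k.
  by rewrite /polyX_in linearZ /= map_polyXn hornerZ hornerXn.
have [pD _ _ _ pC] := polyX_in_morph.
rewrite /psi2_sq !pD !cX pC -['X]expr1 cX /psi2 /w_poly /b2 /b4 /b6.
rewrite !(expr2 (_ W)) !(mpolyCD, mpolyCM, mpolyC_nat).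
ring.
Qed.

Lemma pi_psi2_sq : pi psi2 ^+ 2 = pi (polyX_in psi2_sq).
Proof.
rewrite -rmorphXn; apply/qpiE; rewrite psi2_sqE addrAC subrr add0r.
by apply: ideal_genMl; apply: (@ideal_gen_mem _ [:: w_poly] 0).
Qed.

Lemma divpoly_rec_odd m : (1 < m)%N ->
  pi (divpoly m.*2.+1) =
  pi (divpoly m.+2 * divpoly m ^+ 3 - divpoly m.-1 * divpoly m.+1 ^+ 3).
Proof.
move=> m1; have [_ pB pM p1 _] := polyX_in_morph.
have om : odd m.-1 = ~~ odd m by lia.
have pX p k : polyX_in (p ^+ k) = polyX_in p ^+ k.
  by elim: k => [|k IH]; rewrite ?expr0 // !exprS pM IH.
rewrite /divpoly divpolyX_odd //= om odd_double negbK /= mulr1.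
rewrite !(pB, pM, pX); case: (odd m) => /=; rewrite ?p1 !pX;
  rewrite !(rmorphB, rmorphM, rmorphXn, rmorph1) /= -pi_psi2_sq;
  set u := pi psi2; set f0 := pi (polyX_in (divpolyX m));
  set f1 := pi (polyX_in (divpolyX m.+1)); set f2 := pi (polyX_in (divpolyX m.+2));
  set f3 := pi (polyX_in (divpolyX m.-1)); ring.
Qed.

Lemma divpoly_rec_even m : (2 < m)%N ->
  pi (psi2 * divpoly m.*2) =
  pi (divpoly m * (divpoly m.+2 * divpoly m.-1 ^+ 2
                   - divpoly m.-2 * divpoly m.+1 ^+ 2)).
Proof.
move=> m2; have [_ pB pM p1 _] := polyX_in_morph.
have pX p k : polyX_in (p ^+ k) = polyX_in p ^+ k.
  by elim: k => [|k IH]; rewrite ?expr0 // !exprS pM IH.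
have om : odd m.-1 = ~~ odd m by lia.
have om2 : odd m.-2 = odd m by lia.
rewrite /divpoly divpolyX_even //= om om2 odd_double negbK /=; congr pi.
rewrite !(pB, pM, pX); case: (odd m) => /=; ring.
Qed.

End DivisionPolynomials.

(* Main.v *)
Require Import Defs.
From HB Require Import structures.
From mathcomp Require Import all_boot all_order all_algebra all_field.
From mathcomp Require Import boolp classical_sets functions.
From mathcomp Require Import mpoly zify ring.

(* With [-]^* u, the polynomial u generates the affine coordinate ring, so the
   coordinates of a point Q are polynomials in u(Q) and u(-Q). The roots of
   chi_{u,n} are the eigenvalues of u on A, that is, its values at the points of
   the zero locus of the n-th primitive division polynomial, which are the points
   of exact order n. These points generate E[n]: given P of exact order n and any
   Q in E[n], some Q + k P has exact order n. Hence K(chi_{u,n}) and K(E[n]) are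
   the same subfield of Kbar.

   The division polynomials are related to multiplication by n through the
   sequence g with g_{n+1} g_{n-1} = (x - x(nP)) g_n^2, whose elliptic divisibility
   relations follow from the symmetry in A, B, C of
   (x(A+B) - x(C)) (x(A-B) - x(C)) (x(A) - x(B))^2. An identity between polynomials
   in x may be checked at the points P with jP <> 0 for j <= N, all but finitely
   many. The quotient of psi_{km}^2 by psi_m^2 does not vanish at a point of exact
   order m, as k^2 <> 0; so the multiplicity of x(Q) as a root of psi_n does not
   depend on n, and dividing by the primitive division polynomials of the proper
   divisors of n leaves exactly the points of exact order n. *)

Set Implicit Arguments.
Unset Strict Implicit.
Unset Printing Implicit Defensive.

Import GRing.Theory.
Local Open Scope ring_scope.

(** * The group law *)

(** The addition formulas divide by differences of x-coordinates, so relations between the multiples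
    of P are first proved while jP <> 0 for all j up to a bound N. Turned into identities of
    polynomials in x, they hold everywhere and can be evaluated at torsion points, where a vanishing
    psi_m leaves a single term.

    A point of exact order n is found by a degree count: the squares of the proper divisors of n add
    up to less than n^2, so for n > 2 the primitive division polynomial is not constant.
    Multiplicities of its roots are compared but never computed, and only the set of roots of
    chi_{u,n} matters.

    For the groups, an automorphism of K(chi_{u,n}) is lifted to Kbar by Zorn's lemma. The lift is a
    choice, but rho sees only its action on the coordinates of E[n], which lie in K(chi_{u,n}). *)

Lemma disc_translate (R : comNzRingType) (W : weierstrass R) (r t : R) :
  disc (Weierstrass (a1 W) (a2 W + 3 * r) (a3 W + r * a1 W + 2 * t)
    (a4 W + 2 * r * a2 W - t * a1 W + 3 * r ^+ 2)
    (a6 W + r * a4 W + r ^+ 2 * a2 W + r ^+ 3 - t * a3 W - t ^+ 2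
     - r * t * a1 W)) = disc W.
Proof.
case: W => c1 c2 c3 c4 c6; rewrite /disc /b2 /b4 /b6 /b8 /=.
by ring.
Qed.

Section Line.
Variables (F : fieldType) (W : weierstrass F).

(* The coefficients of [w_E(x, l x + n) = - (x - x1) (x - x2) (x - x3)]. *)
Definition collinear (l n x1 x2 x3 : F) : Prop :=
  [/\ a2 W = l ^+ 2 + a1 W * l - (x1 + x2 + x3),
      a4 W = 2 * l * n + a1 W * n + a3 W * l + (x1 * x2 + x1 * x3 + x2 * x3)
    & a6 W = n ^+ 2 + a3 W * n - x1 * x2 * x3].

Lemma collinearC l n x1 x2 x3 :
  collinear l n x1 x2 x3 -> collinear l n x2 x1 x3.
Proof. by move=> col; case: (col) => e2 e4 e6; split; rewrite ?e2 ?e4 ?e6; ring. Qed.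

Lemma collinearCA l n x1 x2 x3 :
  collinear l n x1 x2 x3 -> collinear l n x1 x3 x2.
Proof. by move=> col; case: (col) => e2 e4 e6; split; rewrite ?e2 ?e4 ?e6; ring. Qed.

Definition negy (x y : F) := - y - a1 W * x - a3 W.

Lemma negyK x y : negy x (negy x y) = y.
Proof. by rewrite /negy; ring. Qed.

Lemma on_curveE x y : on_curve W (Some (x, y)) <->
  y ^+ 2 + a1 W * x * y + a3 W * y = x ^+ 3 + a2 W * x ^+ 2 + a4 W * x + a6 W.
Proof. by split => /eqP. Qed.

Lemma collinear_on l n x1 x2 x3 : collinear l n x1 x2 x3 ->
  on_curve W (Some (x1, l * x1 + n)).
Proof. by case=> e2 e4 e6; apply/on_curveE; rewrite e2 e4 e6; ring. Qed.

Lemma on_curve_neg P : on_curve W (pt_neg W P) = on_curve W P.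
Proof.
case: P => [[x y]|] //=; congr (_ == _); ring.
Qed.

Lemma pt_negK : involutive (pt_neg W).
Proof. by case=> [[x y]|] //=; congr (Some (_, _)); ring. Qed.

Lemma pt_neg_some x y : pt_neg W (Some (x, y)) = Some (x, negy x y).
Proof. by []. Qed.

Lemma same_x x y y' : on_curve W (Some (x, y)) -> on_curve W (Some (x, y')) ->
  y' = y \/ y' = negy x y.
Proof.
move=> /on_curveE h /on_curveE h'.
have /eqP : (y' - y) * (y' - negy x y) = 0.
  transitivity ((y' ^+ 2 + a1 W * x * y' + a3 W * y')
                - (y ^+ 2 + a1 W * x * y + a3 W * y)).
    by rewrite /negy; ring.
  by rewrite h h' subrr.
by rewrite mulf_eq0 !subr_eq0 => /orP[] /eqP; [left|right].
Qed.

(** The choice of x3 matches the coefficients of x^2. What is left of the difference of the two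
    cubics is, up to sign, the linear polynomial [al] x + [be], which vanishes at the distinct
    points x1 and x2. *)
Lemma collinear_chord x1 y1 x2 y2 l :
  on_curve W (Some (x1, y1)) -> on_curve W (Some (x2, y2)) ->
  x1 != x2 -> y2 = y1 + l * (x2 - x1) ->
  collinear l (y1 - l * x1) x1 x2 (l ^+ 2 + a1 W * l - a2 W - x1 - x2).
Proof.
move=> /on_curveE h1 /on_curveE h2 ne e2; subst y2.
have d0 : x1 - x2 != 0 by rewrite subr_eq0.
set x3 := l ^+ 2 + _ - _ - _ - _; set n := y1 - _.
pose al := 2 * l * n + a1 W * n + a3 W * l + (x1 * x2 + x1 * x3 + x2 * x3) - a4 W.
pose be := n ^+ 2 + a3 W * n - x1 * x2 * x3 - a6 W.
have al0 : al = 0.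
  apply: (mulfI d0); rewrite mulr0 /al /n /x3.
  move: h1 h2; set L1 := y1 ^+ 2 + _ + _; set R1 := _ + _ + _ + _.
  set L2 := (y1 + l * (x2 - x1)) ^+ 2 + _ + _; set R2 := x2 ^+ 3 + _ + _ + _ => h1 h2.
  transitivity ((L1 - R1) - (L2 - R2)); last by rewrite h1 h2 !subrr.
  by rewrite /L1 /R1 /L2 /R2; ring.
have be0 : be = 0.
  transitivity (be + al * x1); first by rewrite al0 mul0r addr0.
  rewrite /be /al /n /x3; move/eqP: h1; rewrite -subr_eq0 => /eqP <-; ring.
split; first by rewrite /x3; ring.
- by apply/esym/subr0_eq.
- by apply/esym/subr0_eq.
Qed.

(** The linear remainder is that of the chord. The slope equation says that w_E restricted to the
    line has derivative 0 at x, hence [al] = 0. *)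
Lemma collinear_tangent x y l : on_curve W (Some (x, y)) ->
  l * (2 * y + a1 W * x + a3 W) = 3 * x ^+ 2 + 2 * a2 W * x + a4 W - a1 W * y ->
  collinear l (y - l * x) x x (l ^+ 2 + a1 W * l - a2 W - x - x).
Proof.
move=> /on_curveE h1 h2.
set x3 := l ^+ 2 + _ - _ - _ - _; set n := y - _.
pose al := 2 * l * n + a1 W * n + a3 W * l + (x * x + x * x3 + x * x3) - a4 W.
pose be := n ^+ 2 + a3 W * n - x * x * x3 - a6 W.
have al0 : al = 0.
  by rewrite /al /n /x3; move/eqP: h2; rewrite -subr_eq0 => /eqP <-; ring.
have be0 : be = 0.
  transitivity (be + al * x); first by rewrite al0 mul0r addr0.
  rewrite /be /al /n /x3; move/eqP: h1; rewrite -subr_eq0 => /eqP <-; ring.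
split; first by rewrite /x3; ring.
- by apply/esym/subr0_eq.
- by apply/esym/subr0_eq.
Qed.

Definition ytwo (x y : F) := 2 * y + a1 W * x + a3 W.

Lemma ytwo_eq0 x y : (ytwo x y == 0) = (y == negy x y).
Proof. by rewrite -[RHS]subr_eq0; congr (_ == _); rewrite /ytwo /negy; ring. Qed.

(* If the two points coincide, the double root forces the line to be the tangent. *)
Lemma add_collinear l n x1 x2 x3 : collinear l n x1 x2 x3 ->
  Some (x2, l * x2 + n) != pt_neg W (Some (x1, l * x1 + n)) ->
  pt_add W (Some (x1, l * x1 + n)) (Some (x2, l * x2 + n))
  = Some (x3, negy x3 (l * x3 + n)).
Proof.
move=> col ne; rewrite /pt_add (negbTE ne).
set l' := (if _ then _ else _).
have -> : l' = l.
  rewrite /l'; case: eqP => [e|/eqP d].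
    subst x2; move: ne; rewrite pt_neg_some => ne.
    have nz : ytwo x1 (l * x1 + n) != 0.
      by rewrite ytwo_eq0; apply: contra ne => /eqP {1}->.
    apply: (canLR (mulfK nz)); case: col => -> -> _; rewrite /ytwo; ring.
  have d0 : x2 - x1 != 0 by rewrite subr_eq0 eq_sym.
  by apply: (canLR (mulfK d0)); ring.
case: col => -> _ _; rewrite -[x in x = _]/(Some (_, negy _ _)).
by congr (Some (_, negy _ _)); ring.
Qed.

Lemma line_through x1 y1 x2 y2 :
  on_curve W (Some (x1, y1)) -> on_curve W (Some (x2, y2)) ->
  Some (x2, y2) != pt_neg W (Some (x1, y1)) ->
  exists l n x3, [/\ collinear l n x1 x2 x3, y1 = l * x1 + n & y2 = l * x2 + n].
Proof.
move=> c1 c2 ne; case: (eqVneq x1 x2) => [e|d].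
  subst x2; case: (same_x c1 c2) => e; last first.
    by move: ne; rewrite e pt_neg_some eqxx.
  subst y2; have nz : ytwo x1 y1 != 0.
    by rewrite ytwo_eq0; apply: contra ne => /eqP {1}->.
  pose l := (3 * x1 ^+ 2 + 2 * a2 W * x1 + a4 W - a1 W * y1) / ytwo x1 y1.
  have := collinear_tangent (l := l) c1 _ => /(_ (divfK nz _)) col.
  by exists l, (y1 - l * x1); eexists; split; [exact: col| ring|ring].
have d0 : x2 - x1 != 0 by rewrite subr_eq0 eq_sym.
pose l := (y2 - y1) / (x2 - x1).
have e : y2 = y1 + l * (x2 - x1) by rewrite /l divfK // addrC subrK.
exists l, (y1 - l * x1), (l ^+ 2 + a1 W * l - a2 W - x1 - x2).
by split; [exact: (collinear_chord c1 c2)|ring|rewrite e; ring].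
Qed.

Lemma pt_add0 P : pt_add W P None = P.
Proof. by case: P => [[]|]. Qed.

Lemma pt_0add P : pt_add W None P = P.
Proof. by []. Qed.

Lemma pt_add_negr P : pt_add W P (pt_neg W P) = None.
Proof. by case: P => [[x y]|] //; rewrite /pt_add eqxx. Qed.

Lemma pt_neg_eq P Q : (Q == pt_neg W P) = (P == pt_neg W Q).
Proof. by rewrite -(inj_eq (inv_inj pt_negK)) pt_negK eq_sym. Qed.

(** A line with its three abscissas treats chord and tangent alike and is symmetric in the points,
    so the laws below reduce to permuting or reflecting [collinear]. *)
Inductive add_spec : option (F * F) -> option (F * F) -> option (F * F) -> Prop :=
| AddL P : add_spec None P P
| AddR P : add_spec P None P
| AddN P : add_spec P (pt_neg W P) None
| AddLine l n x1 x2 x3 of collinear l n x1 x2 x3 &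
    Some (x2, l * x2 + n) != pt_neg W (Some (x1, l * x1 + n)) :
    add_spec (Some (x1, l * x1 + n)) (Some (x2, l * x2 + n))
             (Some (x3, negy x3 (l * x3 + n))).

Lemma pt_addP P Q : on_curve W P -> on_curve W Q -> add_spec P Q (pt_add W P Q).
Proof.
case: P Q => [[x1 y1]|] [[x2 y2]|] cP cQ; rewrite ?pt_add0 ?pt_0add; try by constructor.
case: (eqVneq (Some (x2, y2)) (pt_neg W (Some (x1, y1)))) => [e|ne].
  by rewrite e pt_add_negr; constructor.
have [l [n [x3 [col e1 e2]]]] := line_through cP cQ ne; subst y1 y2.
by rewrite (add_collinear col) //; constructor.
Qed.

Lemma on_curve_add P Q : on_curve W P -> on_curve W Q -> on_curve W (pt_add W P Q).
Proof.
move=> cP cQ; move: (cP) (cQ); case: (pt_addP cP cQ) => {cP cQ} //= l n x1 x2 x3 col ne _ _.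
rewrite -[is_true _]/(is_true (on_curve W (pt_neg W (Some (x3, l * x3 + n))))).
by rewrite on_curve_neg; apply: collinear_on (collinearC (collinearCA col)).
Qed.

Lemma pt_addC P Q : on_curve W P -> on_curve W Q -> pt_add W P Q = pt_add W Q P.
Proof.
move=> cP cQ; case: (pt_addP cP cQ) => [||R|l n x1 x2 x3 col ne].
- by move=> R; rewrite pt_add0.
- by [].
- by rewrite -{2}[R]pt_negK pt_add_negr.
by rewrite (add_collinear (collinearC col)) // pt_neg_eq.
Qed.

Lemma collinear_neg l n x1 x2 x3 : collinear l n x1 x2 x3 ->
  collinear (- l - a1 W) (- n - a3 W) x1 x2 x3.
Proof. by move=> col; case: (col) => e2 e4 e6; split; rewrite ?e2 ?e4 ?e6; ring. Qed.

Lemma negy_line l n x : negy x (l * x + n) = (- l - a1 W) * x + (- n - a3 W).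
Proof. by rewrite /negy; ring. Qed.

Lemma pt_neg_add P Q : on_curve W P -> on_curve W Q ->
  pt_neg W (pt_add W P Q) = pt_add W (pt_neg W P) (pt_neg W Q).
Proof.
move=> cP cQ; case: (pt_addP cP cQ) => [|||l n x1 x2 x3 col ne].
- by move=> R; rewrite pt_0add.
- by move=> R; rewrite pt_add0.
- by move=> R; rewrite pt_add_negr.
rewrite !pt_neg_some negyK; rewrite !negy_line.
rewrite (add_collinear (collinear_neg col)) -!negy_line; first by rewrite negyK.
by rewrite -!pt_neg_some (inj_eq (inv_inj pt_negK)).
Qed.

Hypothesis ell : elliptic W.

(** If both partial derivatives of w_E vanished at the point, moving it to the origin would make a3,
    a4 and a6 zero, and the discriminant with them. *)
Lemma elliptic_smooth x y : on_curve W (Some (x, y)) -> ytwo x y = 0 ->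
  3 * x ^+ 2 + 2 * a2 W * x + a4 W - a1 W * y != 0.
Proof.
move=> /on_curveE cP e; apply/eqP => e'; move/eqP: ell; apply.
rewrite -(disc_translate W x y).
have -> : a3 W + x * a1 W + 2 * y = 0 by rewrite -[RHS]e /ytwo; ring.
have -> : a4 W + 2 * x * a2 W - y * a1 W + 3 * x ^+ 2 = 0 by rewrite -[RHS]e'; ring.
have -> : a6 W + x * a4 W + x ^+ 2 * a2 W + x ^+ 3 - y * a3 W - y ^+ 2
          - x * y * a1 W = 0.
  by move/eqP: cP; rewrite eq_sym -subr_eq0 => /eqP <-; ring.
by rewrite /disc /b2 /b4 /b6 /b8 /=; ring.
Qed.

Lemma pt_addKl P Q : on_curve W P -> on_curve W Q ->
  pt_add W (pt_neg W P) (pt_add W P Q) = Q.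
Proof.
move=> cP cQ; move: (cP); case: (pt_addP cP cQ) => {cP cQ} [//|||l n x1 x2 x3 col ne].
- by move=> R cR; rewrite pt_addC ?on_curve_neg // pt_add_negr.
- by move=> R cR; rewrite pt_add0.
move=> cP; have col' := collinear_neg (collinearCA col).
rewrite pt_neg_some !negy_line (add_collinear col') -!negy_line ?negyK //.
rewrite -!pt_neg_some (inj_eq (inv_inj pt_negK)) pt_neg_some.
(* In the excluded case the line meets the curve twice at P while psi_2(P) = 0, so P would be
   singular. *)
apply/eqP => -[e3]; subst x3 => e.
have t0 : ytwo x1 (l * x1 + n) = 0 by apply/eqP; rewrite ytwo_eq0 -e.
apply/negP: (elliptic_smooth cP t0); rewrite negbK; apply/eqP.
transitivity (l * ytwo x1 (l * x1 + n)); last by rewrite t0 mulr0.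
by case: col => -> -> _; rewrite /ytwo; ring.
Qed.

End Line.

(** * Associativity of the group law *)

Section Assoc.
Variables (F : closedFieldType) (W : weierstrass F).
Hypothesis ell : elliptic W.
Local Notation on := (on_curve W).
Local Notation "P <+> Q" := (pt_add W P Q) (at level 50, left associativity).
Local Notation "-- P" := (pt_neg W P) (at level 35).

Lemma add_chord x1 y1 x2 y2 m v : x1 != x2 -> y1 = m * x1 + v -> y2 = m * x2 + v ->
  let x3 := m ^+ 2 + a1 W * m - a2 W - x1 - x2 in
  Some (x1, y1) <+> Some (x2, y2) = Some (x3, negy W x3 (m * x3 + v)).
Proof.
move=> ne -> -> x3; rewrite /pt_add (negbTE ne) /=.
case: eqP => [[e _]|_]; first by rewrite e eqxx in ne.
have -> : (m * x2 + v - (m * x1 + v)) / (x2 - x1) = m.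
  have d0 : x2 - x1 != 0 by rewrite subr_eq0 eq_sym.
  by apply: (canLR (mulfK d0)); ring.
by congr (Some (_, _)); rewrite /x3 /negy; ring.
Qed.

Definition apart (T S : option (F * F)) := T != S /\ T != -- S.

Lemma apart_x x y x' y' : on (Some (x, y)) -> on (Some (x', y')) ->
  apart (Some (x, y)) (Some (x', y')) -> x != x'.
Proof.
move=> c c' [n1 n2]; apply/eqP => e; subst x'.
by case: (same_x c' c) => e; move: n1 n2; rewrite e ?eqxx.
Qed.

Lemma cancel_neq P Q R : on P -> on Q -> R = P <+> Q -> Q = -- P <+> R.
Proof. by move=> cP cQ ->; rewrite pt_addKl. Qed.

(* Both sides are obtained from the parabola through A, B and T with leading
   coefficient [g]: the line through A + B and T has slope 1 / g - l - a1. *)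
Lemma pt_add_assoc_apart A B T : on A -> on B -> on T ->
  T != None -> apart T A -> apart T B -> apart T (A <+> B) ->
  apart T (A <+> -- B) -> (A <+> B) <+> T = A <+> (B <+> T).
Proof.
move=> cA cB cT; case: T cT => [[xt yt]|//] cT _.
case: A cA => [[xA yA]|//] cA; case: B cB => [[xB yB]|] cB; last by rewrite pt_add0.
case: (eqVneq (Some (xB, yB)) (-- (Some (xA, yA)))) => [e|neAB] apA apB.
  rewrite e pt_add_negr pt_0add => _ _.
  by rewrite -[X in X <+> _](pt_negK W) pt_addKl ?on_curve_neg.
have [l [n [x' [col eA eB]]]] := line_through cA cB neAB.
have neBT : Some (xt, yt) != -- Some (xB, yB) by case: apB.
have [l2 [n2 [x'' [col2 eB2 eT]]]] := line_through cB cT neBT.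
have eAB : Some (xA, yA) <+> Some (xB, yB) = Some (x', negy W x' (l * x' + n)).
  by rewrite eA eB (add_collinear col) // -eA -eB.
have eBT : Some (xB, yB) <+> Some (xt, yt) = Some (x'', negy W x'' (l2 * x'' + n2)).
  by rewrite eB2 eT (add_collinear col2) // -eB2 -eT.
move=> apAB apAB'.
have cAB : on (Some (x', negy W x' (l * x' + n))) by rewrite -eAB on_curve_add.
have cBT : on (Some (x'', negy W x'' (l2 * x'' + n2))) by rewrite -eBT on_curve_add.
have xtA := apart_x cT cA apA.
have xtB := apart_x cT cB apB.
have xt' : xt != x' by apply: (apart_x cT cAB); rewrite -eAB.
have xA'' : xA != x''.
  apply: (apart_x cA cBT); rewrite -eBT; split; apply/eqP.
    move/(cancel_neq cB cT) => eT'; case: apAB' => [/eqP h _]; apply: h; rewrite eT'.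
    by rewrite pt_addC ?on_curve_neg.
  rewrite -{1}(pt_negK W (Some (xA, yA))) => /(inv_inj (@pt_negK _ _)).
  move/(cancel_neq cB cT) => eT'; case: apAB => [_ /eqP h]; apply: h; rewrite eT'.
  by rewrite pt_neg_add // pt_addC ?on_curve_neg.
rewrite eAB eBT.
have D0 : xA - xt != 0 by rewrite subr_eq0 eq_sym.
(* The second divided difference of A, B, T: the parabola is y = l x + n + g (x - xA) (x - xB). *)
pose g := (l - l2) / (xA - xt).
have el : l = l2 + g * (xA - xt) by rewrite /g divfK // addrC subrK.
have en : n = n2 - g * (xA - xt) * xB.
  by apply: (addrI (l * xB)); rewrite -eB eB2 el; ring.
case: (col) (col2) => e2 e4 e6 [e2' e4' e6'].
(* [al0] and [be0] compare coefficients of w_E restricted to the line AB and to the line BT. *)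
have al0 : g * (xA - xt) * (l + l2 + a1 W) = xA + x' - xt - x''.
  apply/eqP; rewrite -subr_eq0 -(subrr (a2 W)) {1}e2 e2'; apply/eqP; rewrite el; ring.
have be0 : g * (xA - xt) * (n + n2 + a3 W) = xt * x'' - xA * x'.
  apply/eqP; rewrite -subr_eq0; apply/eqP.
  transitivity (2 * l * n + a1 W * n + a3 W * l + (xA * xB + xA * x' + xB * x')
    - (2 * l2 * n2 + a1 W * n2 + a3 W * l2 + (xB * xt + xB * x'' + xt * x''))
    + xB * (g * (xA - xt) * (l + l2 + a1 W) - (xA + x' - xt - x''))).
    by rewrite el en; ring.
  by rewrite -e4 -e4' al0 !subrr mulr0 addr0.
(* T lies on the line y = (x - x') / g - (l x + n) - a1 x - a3, which at x = x' passes through A +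
   B; [hA] is the same for A and B + T. *)
have ht : g * (yt + (l * xt + n) + a1 W * xt + a3 W) = xt - x'.
  apply: (mulfI D0); transitivity (g * (xA - xt) * (l + l2 + a1 W) * xt
     + g * (xA - xt) * (n + n2 + a3 W)); first by rewrite eT; ring.
  by rewrite al0 be0; ring.
have hA : g * (yA + (l2 * xA + n2) + a1 W * xA + a3 W) = xA - x''.
  apply: (mulfI D0); transitivity (g * (xA - xt) * (l + l2 + a1 W) * xA
     + g * (xA - xt) * (n + n2 + a3 W)); first by rewrite eA; ring.
  by rewrite al0 be0; ring.
have g0 : g != 0.
  by apply: contraNneq xt' => g0; move: ht; rewrite g0 mul0r => /esym/subr0_eq ->.
pose m := g^-1 - l - a1 W; pose m2 := g^-1 - l2 - a1 W.
pose v := - x' / g - n - a3 W; pose v2 := - x'' / g - n2 - a3 W.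
rewrite (@add_chord _ _ _ _ m v); last 3 first.
- by rewrite eq_sym.
- by rewrite /negy /m /v; field.
- apply: (mulfI g0); transitivity (g * (yt + (l * xt + n) + a1 W * xt + a3 W)
     - g * (l * xt + n + a1 W * xt + a3 W)); first by ring.
  by rewrite ht /m /v; field.
rewrite (@add_chord _ _ _ _ m2 v2) //; last 2 first.
- apply: (mulfI g0); transitivity (g * (yA + (l2 * xA + n2) + a1 W * xA + a3 W)
     - g * (l2 * xA + n2 + a1 W * xA + a3 W)); first by ring.
  by rewrite hA /m2 /v2; field.
- by rewrite /negy /m2 /v2; field.
have ex'' : x'' = xA + x' - xt - g * (xA - xt) * (l + l2 + a1 W) by rewrite al0; ring.
set x3 := m ^+ 2 + _ - _ - _ - _; set x4 := m2 ^+ 2 + _ - _ - _ - _.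
have -> : x4 = x3.
  rewrite /x3 /x4 ex'' /m /m2 el; move: g0; clear; move: g => g g0; field; exact: g0.
congr (Some (_, negy W _ _)).
rewrite /x3 e2 /m /m2 /v /v2 ex'' en el.
move: g0; clear; move: g => g g0; field; exact: g0.
Qed.

Lemma closed_infinite (s : seq F) : exists x, x \notin s.
Proof.
pose p := \prod_(z <- s) ('X - z%:P) + 1 : {poly F}.
case: (posnP (size s)) => [/size0nil->|s0]; first by exists 0; rewrite in_nil.
have sp : size (\prod_(z <- s) ('X - z%:P)) = (size s).+1 by rewrite size_prod_XsubC.
have /closed_rootP [x] : size p != 1%N.
  by rewrite size_polyDl ?sp ?size_poly1 //; lia.
rewrite /root !hornerE => px; exists x; apply: contraL px.
by rewrite -root_prod_XsubC => /eqP ->; rewrite add0r oner_eq0.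
Qed.

Lemma exists_y x : exists y, on (Some (x, y)).
Proof.
pose c := x ^+ 3 + a2 W * x ^+ 2 + a4 W * x + a6 W.
have [y] := @solve_monicpoly F 2 (fun i => if i is 0 then c else - (a1 W * x + a3 W)) isT.
rewrite !big_ord_recl big_ord0 /= => e; exists y; apply/on_curveE.
by rewrite e -/c; ring.
Qed.

Definition xcoord (P : option (F * F)) := if P is Some (x, y) then x else 0.

Lemma exists_apart (s : seq (option (F * F))) :
  exists T, [/\ on T, T != None & forall S, S \in s -> apart T S].
Proof.
have [x xs] := closed_infinite (map xcoord s); have [y cy] := exists_y x.
exists (Some (x, y)); split=> // -[[x' y']|] Ss; split=> //=.
  by apply: contraNneq xs => -[-> _]; apply/mapP; exists (Some (x', y')).
by apply: contraNneq xs => -[-> _]; apply/mapP; exists (Some (x', y')).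
Qed.

(** An auxiliary T, apart from finitely many points, makes each reassociation generic: ((P + Q) + R)
    + T = (P + Q) + (R + T) = P + (Q + (R + T)) = P + ((Q + R) + T) = (P + (Q + R)) + T. Then T is
    cancelled. *)
Lemma pt_addA P Q R : on P -> on Q -> on R -> (P <+> Q) <+> R = P <+> (Q <+> R).
Proof.
move=> cP cQ cR.
pose four A B := [:: A; B; A <+> B; A <+> -- B].
(* Avoiding A - R and - A - R keeps R + T apart from A. *)
pose bad A := [:: A <+> -- R; (-- A) <+> -- R].
have [T [cT T0 /= ap]] := exists_apart
  ([:: R] ++ four (P <+> Q) R ++ four Q R ++ four P (Q <+> R)
   ++ bad P ++ bad Q ++ bad (P <+> Q) ++ bad (P <+> -- Q)).
have cPQ := on_curve_add cP cQ; have cQR := on_curve_add cQ cR.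
have cRT := on_curve_add cR cT.
have cQ' : on (-- Q) by rewrite on_curve_neg.
have cPQ' := on_curve_add cP cQ'.
have RT A : on A -> apart T (A <+> -- R) ->
    apart T ((-- A) <+> -- R) -> apart (R <+> T) A.
  move=> cA [n1 _] [n2 _]; split; apply/eqP => /esym/(cancel_neq cR cT) e.
    by move/eqP: n1; apply; rewrite e pt_addC ?on_curve_neg.
  by move/eqP: n2; apply; rewrite e pt_addC ?on_curve_neg.
have RTn : R <+> T != None.
  apply/eqP => /esym/(cancel_neq cR cT) e; have [|_] := ap R; first by rewrite !inE eqxx.
  by rewrite e pt_add0 eqxx.
have A1 : (P <+> Q <+> R) <+> T = (P <+> Q) <+> (R <+> T).
  by apply: pt_add_assoc_apart => //; apply: ap; rewrite !inE eqxx ?orbT.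
have A2 : (P <+> Q) <+> (R <+> T) = P <+> (Q <+> (R <+> T)).
  by apply: pt_add_assoc_apart => //; apply: RT => //;
    apply: ap; rewrite !inE eqxx ?orbT.
have A3 : (Q <+> R) <+> T = Q <+> (R <+> T).
  by apply: pt_add_assoc_apart => //; apply: ap; rewrite !inE eqxx ?orbT.
have A4 : (P <+> (Q <+> R)) <+> T = P <+> ((Q <+> R) <+> T).
  by apply: pt_add_assoc_apart => //; apply: ap; rewrite !inE eqxx ?orbT.
have cL := on_curve_add cPQ cR; have cM := on_curve_add cP cQR.
rewrite -[LHS](pt_addKl ell cT cL) -[RHS](pt_addKl ell cT cM).
by rewrite (pt_addC cT cL) (pt_addC cT cM) A1 A2 A4 A3.
Qed.

End Assoc.

Definition hevalE := (hornerD, hornerN, hornerZ, hornerXn, hornerX, hornerC,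
  hornerM, horner_exp).

(** * The group of points and its formulas in the x-coordinate *)

Section CurveGroup.
Variables (F : closedFieldType) (W : weierstrass F).

Record curve_pt (ell : elliptic W) :=
  CurvePt { pt_val :> option (F * F); _ : on_curve W pt_val }.

Variable ell : elliptic W.
Local Notation pt := (curve_pt ell).

HB.instance Definition _ := [isSub for @pt_val ell].
HB.instance Definition _ := [Choice of pt by <:].

Lemma pt_on (P : pt) : on_curve W (val P). Proof. exact: valP. Qed.

Definition cp_zero : pt := @CurvePt ell None isT.
Definition cp_opp (P : pt) : pt :=
  CurvePt ell (etrans (on_curve_neg W (val P)) (pt_on P)).
Definition cp_add (P Q : pt) : pt :=
  CurvePt ell (on_curve_add (pt_on P) (pt_on Q)).

Lemma cp_addA : associative cp_add.
Proof. by move=> P Q R; apply/val_inj/esym/pt_addA => //; apply: pt_on. Qed.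
Lemma cp_addC : commutative cp_add.
Proof. by move=> P Q; apply/val_inj/pt_addC => //; apply: pt_on. Qed.
Lemma cp_add0 : left_id cp_zero cp_add.
Proof. by move=> P; apply: val_inj. Qed.
Lemma cp_addN : left_inverse cp_zero cp_opp cp_add.
Proof.
move=> P; apply: val_inj; rewrite cp_addC /=; exact: pt_add_negr.
Qed.
HB.instance Definition _ :=
  GRing.isZmodule.Build pt cp_addA cp_addC cp_add0 cp_addN.

Lemma val_cpD (P Q : pt) : val (P + Q) = pt_add W (val P) (val Q).
Proof. by []. Qed.

Lemma val_cpN (P : pt) : val (- P) = pt_neg W (val P).
Proof. by []. Qed.

Lemma val_cpMn (P : pt) n : val (P *+ n) = pt_mul W n (val P).
Proof. by elim: n => // n IH; rewrite mulrS val_cpD IH. Qed.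

Lemma torsionP (P : pt) n : (val P \in torsion W n) = (P *+ n == 0).
Proof.
by rewrite -topredE /= /torsion (pt_on P) -val_cpMn.
Qed.

Definition xc (P : pt) := xcoord (val P).
Definition yc (P : pt) := if val P is Some (x, y) then y else 0.

Lemma valE (P : pt) : P != 0 -> val P = Some (xc P, yc P).
Proof. by rewrite -val_eqE /xc /yc /=; case: (pt_val P) => [[]|]. Qed.

Lemma curve_eq (P : pt) : P != 0 ->
  yc P ^+ 2 + a1 W * xc P * yc P + a3 W * yc P
  = xc P ^+ 3 + a2 W * xc P ^+ 2 + a4 W * xc P + a6 W.
Proof. by move=> /valE e; have := pt_on P; rewrite e => /on_curveE. Qed.

Lemma xcN (P : pt) : xc (- P) = xc P.
Proof. by rewrite /xc /=; case: (pt_val P) => [[]|]. Qed.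

Lemma ycN (P : pt) : P != 0 -> yc (- P) = negy W (xc P) (yc P).
Proof. by rewrite -val_eqE /xc /yc /=; case: (pt_val P) => [[]|]. Qed.

Lemma eq_xc (P Q : pt) : P != 0 -> Q != 0 ->
  (xc P == xc Q) = (P == Q) || (P == - Q).
Proof.
move=> P0 Q0; apply/idP/orP => [/eqP e|[] /eqP ->]; rewrite ?xcN //.
have cP := pt_on P; have cQ := pt_on Q; rewrite (valE P0) e in cP.
rewrite (valE Q0) in cQ; case: (same_x cQ cP) => ey; [left|right]; apply/eqP/val_inj.
  by rewrite (valE P0) (valE Q0) e ey.
by rewrite val_cpN (valE P0) (valE Q0) e ey.
Qed.

Definition yt (P : pt) := ytwo W (xc P) (yc P).

Lemma yt_eq0 (P : pt) : P != 0 -> (yt P == 0) = (P *+ 2 == 0).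
Proof.
move=> P0; rewrite ytwo_eq0 mulr2n addr_eq0 -val_eqE val_cpN (valE P0) pt_neg_some.
by apply/eqP/eqP => [<-|[]].
Qed.

Lemma ytN (P : pt) : P != 0 -> yt (- P) = - yt P.
Proof. by move=> P0; rewrite /yt xcN ycN // /ytwo /negy; ring. Qed.

Lemma yt_sq (P : pt) : P != 0 -> yt P ^+ 2 = (psi2_sq W).[xc P].
Proof.
move=> /curve_eq e; rewrite /psi2_sq !hevalE /yt /ytwo /b2 /b4 /b6.
move/eqP: e; rewrite -subr_eq0 => /eqP e; apply/subr0_eq.
transitivity (4 * (yc P ^+ 2 + a1 W * xc P * yc P + a3 W * yc P -
  (xc P ^+ 3 + a2 W * xc P ^+ 2 + a4 W * xc P + a6 W))); last by rewrite e mulr0.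
by ring.
Qed.

Definition slope (A B : pt) := (yc B - yc A) / (xc B - xc A).

Lemma xc_chord (A B : pt) : A != 0 -> B != 0 -> xc A != xc B ->
  let m := slope A B in
  xc (A + B) = m ^+ 2 + a1 W * m - a2 W - xc A - xc B.
Proof.
move=> A0 B0 ne m; rewrite /xc val_cpD (valE A0) (valE B0).
have d0 : xc B - xc A != 0 by rewrite subr_eq0 eq_sym.
rewrite (@add_chord _ _ _ _ _ _ m (yc A - m * xc A)) //=; first by ring.
by rewrite -[LHS](subrK (yc A)) -[X in X + _](divfK d0) -/(slope A B) -/m; ring.
Qed.

(** The third summation polynomial: for x(A) = r and x(B) = s distinct, it is (r - s)^2 times the
    monic quadratic in t with roots x(A + B) and x(A - B). *)
Definition biquad (r s t : F) := r ^+ 2 * s ^+ 2 - b4 W * r * s - b6 W * (r + s)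
  - b8 W - t * (2 * r * s * (r + s) + b2 W * r * s + b4 W * (r + s) + b6 W)
  + t ^+ 2 * (r - s) ^+ 2.

Lemma biquadC r s t : biquad r s t = biquad s r t.
Proof. by rewrite /biquad; ring. Qed.
Lemma biquadCA r s t : biquad r s t = biquad r t s.
Proof. by rewrite /biquad; ring. Qed.

Lemma xc_add_sub (A B : pt) r : A != 0 -> B != 0 -> xc A != xc B ->
  (xc (A + B) - r) * (xc (A - B) - r) * (xc A - xc B) ^+ 2
  = biquad (xc A) (xc B) r.
Proof.
move=> A0 B0 ne; rewrite !xc_chord ?oppr_eq0 ?xcN // /slope xcN ycN //.
have := curve_eq A0; have := curve_eq B0.
have d0 : xc A - xc B != 0 by rewrite subr_eq0.
rewrite /biquad /b2 /b4 /b6 /b8 /negy; move: (xc A) (yc A) (xc B) (yc B) d0.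
case: W => c1 c2 c3 c4 c6 /= x y x' y' d0 e' e.
(* The two curve equations are solved for a6 and a4, which leaves an identity of rational functions
   in free variables. *)
have e6 : c6 = y ^+ 2 + c1 * x * y + c3 * y - x ^+ 3 - c2 * x ^+ 2 - c4 * x.
  by rewrite e; ring.
have d0' : x' - x != 0 by rewrite -opprB oppr_eq0.
have e4 : c4 = ((y ^+ 2 + c1 * x * y + c3 * y - x ^+ 3 - c2 * x ^+ 2) -
  (y' ^+ 2 + c1 * x' * y' + c3 * y' - x' ^+ 3 - c2 * x' ^+ 2)) / (x - x').
  by rewrite e e'; apply: (canRL (mulfK d0)); ring.
move: e6; rewrite e4 => ->; clear -d0 d0'; field; by rewrite d0.
Qed.

Lemma xc_sub_add (A B : pt) : A != 0 -> B != 0 -> xc A != xc B ->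
  (xc (A - B) - xc (A + B)) * (xc A - xc B) ^+ 2 = yt A * yt B.
Proof.
move=> A0 B0 ne; rewrite !xc_chord ?oppr_eq0 ?xcN // /slope xcN ycN //.
have d0 : xc B - xc A != 0 by rewrite subr_eq0 eq_sym.
by rewrite /yt /ytwo /negy; field.
Qed.

Definition tslope (A : pt) :=
  (3 * xc A ^+ 2 + 2 * a2 W * xc A + a4 W - a1 W * yc A) / yt A.

Lemma val_dbl (A : pt) : A != 0 -> A *+ 2 != 0 -> let m := tslope A in
  let x := m ^+ 2 + a1 W * m - a2 W - xc A - xc A in
  val (A *+ 2) = Some (x, negy W x (yc A + m * (x - xc A))).
Proof.
move=> A0 AA0; have t0 : yt A != 0 by rewrite yt_eq0.
move: AA0; rewrite mulr2n addr_eq0 -val_eqE val_cpN val_cpD (valE A0) => ne.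
by rewrite /pt_add (negbTE ne) eqxx.
Qed.

(** The confluent case of [xc_add_sub]: as B tends to A, (x(A - B) - r) (x(A) - x(B))^2 tends to
    psi_2(A)^2, by [xc_sub_add]. *)
Lemma xc_dbl (A : pt) r : A != 0 -> A *+ 2 != 0 ->
  yt A ^+ 2 * (xc (A *+ 2) - r) = biquad (xc A) (xc A) r.
Proof.
move=> A0 AA0; rewrite /xc (val_dbl A0 AA0) /= -/(xc A).
have := curve_eq A0; have : yt A != 0 by rewrite yt_eq0.
rewrite /tslope /biquad /b2 /b4 /b6 /b8 /yt /ytwo; move: (xc A) (yc A).
case: W => c1 c2 c3 c4 c6 /= x y d0 e.
have -> : c6 = y ^+ 2 + c1 * x * y + c3 * y - x ^+ 3 - c2 * x ^+ 2 - c4 * x.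
  by rewrite e; ring.
by clear -d0; field.
Qed.

Lemma psi3_dbl (A : pt) : A != 0 -> A *+ 2 != 0 ->
  (psi3 W).[xc A] = yt A ^+ 2 * (xc A - xc (A *+ 2)).
Proof.
move=> A0 AA0; rewrite -opprB mulrN xc_dbl // /psi3 !hevalE /biquad.
by ring.
Qed.

Lemma psi4_dbl (A : pt) : A != 0 -> A *+ 2 != 0 ->
  (psi4_red W).[xc A] = yt (A *+ 2) * yt A ^+ 3.
Proof.
move=> A0 AA0; rewrite [yt (A *+ 2)]/yt [xc (A *+ 2)]/xc [yc (A *+ 2)]/yc (val_dbl A0 AA0) /=.
have := curve_eq A0; have : yt A != 0 by rewrite yt_eq0.
rewrite /psi4_red !hevalE.
rewrite /tslope /b2 /b4 /b6 /b8 /yt /ytwo /negy; move: (xc A) (yc A).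
case: W => c1 c2 c3 c4 c6 /= x y d0 e.
have -> : c6 = y ^+ 2 + c1 * x * y + c3 * y - x ^+ 3 - c2 * x ^+ 2 - c4 * x.
  by rewrite e; ring.
by clear -d0; field.
Qed.

End CurveGroup.

(** * Elliptic divisibility sequences and division polynomials *)

Section EDS.
Variables (F : closedFieldType) (W : weierstrass F) (ell : elliptic W).
Variable P : curve_pt ell.
Hypothesis P0 : P != 0.
Local Notation x := (xc P).
Local Notation xm n := (xc (P *+ n)).

Definition psi_at n : F := (divpolyX W n).[x] * (if odd n then 1 else yt P).

Lemma psi_at_odd m : (1 < m)%N -> psi_at m.*2.+1 =
  psi_at m.+2 * psi_at m ^+ 3 - psi_at m.-1 * psi_at m.+1 ^+ 3.
Proof.
move=> m1; have om : odd m.-1 = ~~ odd m by lia.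
rewrite /psi_at divpolyX_odd //= om odd_double negbK /=.
move: (psi2_sq W) (yt_sq P0) => f ef.
by case: (odd m) => /=; rewrite !hevalE -?ef; ring.
Qed.

Lemma psi_at_even m : (2 < m)%N -> yt P * psi_at m.*2 =
  psi_at m * (psi_at m.+2 * psi_at m.-1 ^+ 2 - psi_at m.-2 * psi_at m.+1 ^+ 2).
Proof.
move=> m2; have om : odd m.-1 = ~~ odd m by lia.
have om2 : odd m.-2 = odd m by lia.
rewrite /psi_at divpolyX_even //= om om2 odd_double negbK /=.
by case: (odd m) => /=; rewrite !hevalE; ring.
Qed.

(** Field elements attached to one P, with a division that is meaningful only while the earlier
    terms are nonzero; [eds_neq0] ensures this below the order of P. *)
Fixpoint eds n : F := match n with
  | 0 => 0
  | 1 => 1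
  | (n'.+1 as m).+1 => if n' is 0 then yt P else (x - xm m) * eds m ^+ 2 / eds n'
  end.

Lemma edsS n : eds n.+3 = (x - xm n.+2) * eds n.+2 ^+ 2 / eds n.+1.
Proof. by []. Qed.

(** A finite bound lets the relations serve a point of finite order too, with N one less than its
    order. *)
Variable N : nat.
Hypothesis nt : forall j, (0 < j <= N)%N -> P *+ j != 0.

Lemma xm_neq a b : (0 < b < a)%N -> (a + b <= N)%N -> xm a != xm b.
Proof.
move=> ba aN; rewrite eq_xc ?nt; try lia; rewrite negb_or; apply/andP; split.
  by rewrite -subr_eq0 -mulrnBr ?nt //; lia.
by rewrite -addr_eq0 -mulrnDr nt //; lia.
Qed.

Lemma eds_neq0 j : (0 < j <= N)%N -> eds j != 0.
Proof.
elim/ltn_ind: j => -[|[|[|j]]] IH // jN; first exact: oner_neq0.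
  by rewrite /= yt_eq0 // nt.
rewrite edsS !mulf_neq0 ?invr_neq0 ?expf_neq0 ?IH //; try lia.
by rewrite subr_eq0 eq_sym -[X in _ != xc X]mulr1n xm_neq //; lia.
Qed.

Lemma eds_step n : (0 < n <= N)%N -> eds n.+1 * eds n.-1 = (x - xm n) * eds n ^+ 2.
Proof.
case: n => [|[|n]] // nN; first by rewrite mulr1n subrr mul0r mulr0.
by rewrite edsS divfK // eds_neq0 //; lia.
Qed.

Lemma biquad_mul m n : (0 < n < m)%N -> (m + n <= N)%N -> forall r,
  (xm (m + n) - r) * (xm (m - n) - r) * (xm m - xm n) ^+ 2
  = biquad W (xm m) (xm n) r.
Proof.
move=> nm mN r; rewrite mulrnDr mulrnBr; last lia.
by apply: xc_add_sub; rewrite ?nt ?xm_neq //; lia.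
Qed.

(** Induction on n. Write F(n) for the left-hand side. The recurrence at m + n and m - n gives F(n +
    1) F(n - 1) = (x - x((m + n)P)) (x - x((m - n)P)) F(n)^2. By [biquad_mul] the two factors are,
    up to (x(mP) - x(nP))^2, the form [biquad] in x(mP), x(nP), x(P). Read by symmetry as the form
    of nP and P at x(mP), it becomes the product of the factors for n + 1 and n - 1. At n = 2 this
    reading is a duplication, hence [xc_dbl]. *)
Lemma eds_add_sub m n : (0 < n < m)%N -> (m + n <= N.+1)%N ->
  eds (m + n) * eds (m - n) = (xm n - xm m) * eds m ^+ 2 * eds n ^+ 2.
Proof.
elim/ltn_ind: n => -[|[|[|n]]] // IH nm mN.
- by rewrite addn1 subn1 eds_step ?mulr1n ?expr1n ?mulr1 //; lia.
- have m0 : eds m != 0 by rewrite eds_neq0 //; lia.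
  have s0 := @eds_step m _; have s1 := @eds_step m.+1 _.
  have s2 := @eds_step m.-1 _.
  rewrite !prednK in s2; try lia.
  apply: (mulfI (expf_neq0 2 m0)).
  transitivity ((eds m.+2 * eds m) * (eds m * eds m.-2)).
    by rewrite addn2 subn2; ring.
  rewrite s1 ?s2; try lia.
  transitivity ((x - xm m.+1) * (x - xm m.-1) * (eds m.+1 * eds m.-1) ^+ 2); first by ring.
  rewrite s0; last lia.
  have b := @biquad_mul m 1 _ _ x.
  rewrite mulr1n addn1 subn1 -{2}[x]mulr1n in b.
  transitivity ((xm m.+1 - x) * (xm m.-1 - x) * (xm m - x) ^+ 2 * eds m ^+ 4).
    by ring.
  rewrite b ?mulr1n; try lia.
  rewrite biquadC biquadCA -xc_dbl ?nt //; last lia.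
  by rewrite /=; ring.
set k := n.+2 in IH *.
have [k1 k2] : (1 < k /\ k.-1 = n.+1)%N by rewrite /k; lia.
have e1 := IH n.+1 _ _ _; have e2 : k.-1 = n.+1 by [].
have E1 : eds (m + k.-1) * eds (m - k.-1)
   = (xm k.-1 - xm m) * eds m ^+ 2 * eds k.-1 ^+ 2 by apply: IH; lia.
have nz : eds (m + k.-1) * eds (m - k.-1) != 0.
  by rewrite mulf_neq0 ?eds_neq0 //; lia.
apply: (mulIf nz).
have sp := @eds_step (m + k) _; have sm := @eds_step (m - k) _.
have sk := @eds_step k _.
have -> : (m + k.-1 = (m + k).-1)%N by lia.
have -> : (m + k.+1 = (m + k).+1)%N by lia.
have -> : (m - k.-1 = (m - k).+1)%N by lia.
have -> : (m - k.+1 = (m - k).-1)%N by lia.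
transitivity ((eds (m + k).+1 * eds (m + k).-1) * (eds (m - k).+1 * eds (m - k).-1)).
  by ring.
rewrite sp ?sm; try lia.
transitivity ((x - xm (m + k)) * (x - xm (m - k)) * (eds (m + k) * eds (m - k)) ^+ 2).
  by ring.
rewrite IH; try lia.
have B1 := @biquad_mul m k _ _ x; have B2 := @biquad_mul k 1 _ _ (xm m).
rewrite addn1 subn1 mulr1n in B2.
transitivity ((xm (m + k) - x) * (xm (m - k) - x) * (xm m - xm k) ^+ 2
   * eds m ^+ 4 * eds k ^+ 4); first by ring.
rewrite B1; try lia.
rewrite biquadC biquadCA.
rewrite -B2; try lia.
have -> : (m + k).-1 = (m + k.-1)%N by lia.
have -> : (m - k).+1 = (m - k.-1)%N by lia.
rewrite E1.
transitivity ((xm k.+1 - xm m) * (xm k.-1 - xm m)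
   * ((x - xm k) * eds k ^+ 2) ^+ 2 * eds m ^+ 4).
  by ring.
by rewrite -sk; [ring|lia].
Qed.

Lemma eds_dbl m : (1 < m)%N -> (m.*2 <= N.+1)%N ->
  eds m.*2 = yt (P *+ m) * eds m ^+ 4.
Proof.
move=> m1 mN; have t0 : yt P != 0 by rewrite yt_eq0 ?nt //; lia.
apply: (mulIf t0); have e := @eds_add_sub m.+1 m.-1 _ _.
have e1 : (m.+1 + m.-1 = m.*2)%N by lia.
have e2 : (m.+1 - m.-1 = 2)%N by lia.
rewrite e1 e2 -[eds 2]/(yt P) in e; rewrite e; try lia.
transitivity ((xm m.-1 - xm m.+1) * (eds m.+1 * eds m.-1) ^+ 2); first by ring.
rewrite eds_step; last lia.
have := @xc_sub_add _ _ _ (P *+ m) P _ P0 _.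
have -> : P *+ m - P = P *+ m.-1 by rewrite -[X in _ - X]mulr1n -mulrnBr ?subn1 //; lia.
have -> : P *+ m + P = P *+ m.+1 by rewrite mulrSr.
move=> h; transitivity ((xm m.-1 - xm m.+1) * (xm m - x) ^+ 2 * eds m ^+ 4); first by ring.
rewrite h ?nt //; try lia; first by ring.
by rewrite -[X in _ != xc X]mulr1n xm_neq //; lia.
Qed.

(** [eds_add_sub] at (m + 1, m) and at (m + 1, m - 1) yields for [eds] the odd and even recurrences
    of the division polynomials. *)
Lemma psi_at_eds n : (n <= N.+1)%N -> psi_at n = eds n.
Proof.
elim/ltn_ind: n => -[|[|[|[|[|n]]]]] IH nN.
- by rewrite /psi_at /= /divpolyX /= horner0 mul0r.
- by rewrite /psi_at /= /divpolyX /= hornerC mul1r.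
- by rewrite /psi_at /= /divpolyX /= hornerC mul1r.
- rewrite edsS /psi_at mulr1 [LHS]psi3_dbl //; last by apply: nt; lia.
  by rewrite /= divr1 mulrC.
- rewrite (_ : eds 4 = eds 2.*2) // eds_dbl // /psi_at.
  by rewrite [X in X * _]psi4_dbl //=; [ring|apply: nt; lia].
set k := n.+1.+4 in IH nN *; have k5 : (4 < k)%N by [].
clearbody k; have := odd_double_half k; set m := k./2; case: (boolP (odd k)) => ok e.
  have m1 : (1 < m)%N by lia.
  rewrite -e add1n psi_at_odd // !IH; try lia.
  have ea := @eds_add_sub m.+1 m _ _.
  have e1 : (m.+1 + m = m.*2.+1)%N by lia.
  have e2 : (m.+1 - m = 1)%N by lia.
  rewrite e1 e2 -[eds 1]/(1 : F) mulr1 in ea; rewrite ea; try lia.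
  transitivity (eds m.+2 * eds m * eds m ^+ 2 - eds m.+1 * eds m.-1 * eds m.+1 ^+ 2).
    by ring.
  by rewrite (@eds_step m) ?(@eds_step m.+1); try lia; ring.
have m1 : (2 < m)%N by lia.
have t0 : yt P != 0 by rewrite yt_eq0 ?nt //; lia.
apply: (mulfI t0); rewrite -e add0n psi_at_even // !IH; try lia.
have ea := @eds_add_sub m.+1 m.-1 _ _.
have e1 : (m.+1 + m.-1 = m.*2)%N by lia.
have e2 : (m.+1 - m.-1 = 2)%N by lia.
rewrite e1 e2 -[eds 2]/(yt P) in ea; rewrite mulrC [RHS]mulrC ea; try lia.
have s1 := @eds_step m.+1 _; have s2 := @eds_step m.-1 _.
rewrite !prednK in s2; try lia.
transitivity (eds m.+2 * eds m * eds m.-1 ^+ 2 - eds m * eds m.-2 * eds m.+1 ^+ 2).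
  by ring.
by rewrite s1 ?s2; try lia; ring.
Qed.

Lemma psi_at_neq0 n : (0 < n <= N)%N -> psi_at n != 0.
Proof. by move=> nN; rewrite psi_at_eds ?eds_neq0 //; lia. Qed.

(** By [eds_step], psi_{N+1} vanishes at P exactly when x(NP) = x(P), that is NP = P or NP = - P;
    the first is excluded by (N - 1)P <> 0. *)
Lemma psi_at_succ : (0 < N)%N -> (psi_at N.+1 == 0) = (P *+ N.+1 == 0).
Proof.
move=> N0; rewrite psi_at_eds //; case: (leqP N 1) => N1.
  have -> : N = 1%N by lia.
  by rewrite /= yt_eq0.
have n1 : eds N.-1 != 0 by rewrite eds_neq0 //; lia.
rewrite -(inj_eq (mulIf n1)) mul0r eds_step ?N0 ?leqnn //.
rewrite mulf_eq0 expf_eq0 /= (negbTE (@eds_neq0 N _)) ?N0 ?leqnn // orbF.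
rewrite subr_eq0 eq_xc //; last by apply: nt; lia.
have -> : (P == P *+ N) = false.
  apply/negbTE; rewrite eq_sym -subr_eq0 -[X in _ - X]mulr1n -mulrnBr //; apply: nt; lia.
by rewrite /= -addr_eq0 -mulrS.
Qed.

End EDS.

(** * Degrees and leading coefficients of division polynomials *)

Section TopCoef.
Variable R : comNzRingType.

(** A bound on the degree with a coefficient that may be 0: unlike the exact degree, this is stable
    under difference, whatever cancels. *)
Definition top_coef (p : {poly R}) d c := (size p <= d.+1)%N /\ p`_d = c.

Lemma top_coefM p q d e c c' :
  top_coef p d c -> top_coef q e c' -> top_coef (p * q) (d + e) (c * c').
Proof.
move=> [sp cp] [sq cq]; split.
  by apply: leq_trans (size_polyMleq _ _) _; lia.
have ld : (d < (d + e).+1)%N by lia.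
rewrite coefM (bigD1 (Ordinal ld)) //= addKn cp cq big1 ?addr0 // => i ne.
have {}ne : (nat_of_ord i != d) by apply: contraNneq ne => h; apply/eqP/val_inj.
case: (ltnP i d) => ltid; last first.
  by have h : (size p <= i)%N; [lia|rewrite [p`_i]nth_default ?mul0r].
by have h : (size q <= d + e - i)%N; [lia|rewrite [q`_ _]nth_default ?mulr0].
Qed.

Lemma top_coefX p d c k : top_coef p d c -> top_coef (p ^+ k) (d * k) (c ^+ k).
Proof.
move=> h; elim: k => [|k IH]; last by rewrite !exprS mulnS; apply: top_coefM.
by rewrite !expr0 muln0 /top_coef size_poly1 coef1.
Qed.

Lemma top_coefB p q d c c' :
  top_coef p d c -> top_coef q d c' -> top_coef (p - q) d (c - c').
Proof.
move=> [sp cp] [sq cq]; split; last by rewrite coefB cp cq.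
by apply: leq_trans (size_polyD _ _) _; rewrite size_polyN geq_max sp sq.
Qed.

Lemma top_coef1 : top_coef 1 0 1.
Proof. by rewrite /top_coef size_poly1 coef1. Qed.

Lemma top_coef_sub p q d c dp cp dq cq : top_coef p dp cp -> top_coef q dq cq ->
  d = dp -> d = dq -> c = cp - cq -> top_coef (p - q) d c.
Proof. by move=> hp hq ep eq ->; apply: top_coefB; rewrite ?ep // -ep eq. Qed.

End TopCoef.

Section DivPolyDegree.
Variables (K : fieldType) (W : weierstrass K).

Lemma top_coef_psi2_sq : top_coef (psi2_sq W) 3 4.
Proof.
rewrite /psi2_sq; split.
  apply/leq_sizeP => j j4; rewrite !coefE.
  by do 4![case: j j4 => // j j4]; rewrite /= !mulr0 !addr0.
by rewrite !coefE /= !mulr0 !addr0 mulr1.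
Qed.

Lemma top_coef_psi3 : top_coef (psi3 W) 4 3.
Proof.
rewrite /psi3; split.
  apply/leq_sizeP => j j4; rewrite !coefE.
  by do 5![case: j j4 => // j j4]; rewrite /= !mulr0 !addr0.
by rewrite !coefE /= !mulr0 !addr0 mulr1.
Qed.

Lemma top_coef_psi4_red : top_coef (psi4_red W) 6 2.
Proof.
rewrite /psi4_red; split.
  apply/leq_sizeP => j j4; rewrite !coefE.
  by do 7![case: j j4 => // j j4]; rewrite /= !mulr0 !addr0.
by rewrite !coefE /= !mulr0 !addr0 mulr1.
Qed.

(** psi_n^2 has degree n^2 - 1 and leading coefficient n^2; for even n, the factor psi_2^2 takes
    away the degree 3 and the coefficient 4. *)
Definition divX_deg n := if odd n then ((n ^ 2).-1)./2 else (n ^ 2 - 4)./2.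
Definition divX_lead n : K := if odd n then n%:R else (n./2)%:R.

Lemma divX_deg_odd k : divX_deg k.*2.+1 = (2 * k ^ 2 + 2 * k)%N.
Proof.
rewrite /divX_deg oddS odd_double.
by have -> : ((k.*2.+1 ^ 2).-1 = (2 * k ^ 2 + 2 * k).*2)%N; [nia|rewrite doubleK].
Qed.

Lemma divX_deg_even k : divX_deg k.*2 = (2 * k ^ 2 - 2)%N.
Proof.
rewrite /divX_deg odd_double.
by have -> : (k.*2 ^ 2 - 4 = (2 * k ^ 2 - 2).*2)%N; [nia|rewrite doubleK].
Qed.

Lemma divX_lead_odd k : divX_lead k.*2.+1 = 2 * k%:R + 1.
Proof. by rewrite /divX_lead /= odd_double /= -natr1 -muln2 natrM mulrC. Qed.

Lemma divX_lead_even k : divX_lead k.*2 = k%:R.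
Proof. by rewrite /divX_lead odd_double doubleK. Qed.

Lemma natr_double k : (k.*2)%:R = 2 * k%:R :> K.
Proof. by rewrite -muln2 natrM mulrC. Qed.

Lemma natr_doubleS k : (k.*2.+1)%:R = 2 * k%:R + 1 :> K.
Proof. by rewrite -natr1 natr_double. Qed.

(** Both terms of a recurrence have the expected degree, so the top coefficients subtract. Splitting
    on the parities of n and m writes every index as 2k or 2k + 1, which turns halving and truncated
    subtraction into polynomial identities. *)
Lemma top_coef_divX n : (0 < n)%N -> top_coef (divpolyX W n) (divX_deg n) (divX_lead n).
Proof.
elim/ltn_ind: n => -[|[|[|[|[|n]]]]] // IH _.
- exact: top_coef1.
- exact: top_coef1.
- exact: top_coef_psi3.
- exact: top_coef_psi4_red.
have T2 := top_coefX 2 top_coef_psi2_sq.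
have T1 := top_coef1 K.
set k := n.+1.+4 in IH *; have k5 : (4 < k)%N by [].
clearbody k; have := odd_double_half k; set m := k./2.
case: (boolP (odd k)) => ok e.
  have m1 : (1 < m)%N by lia.
  rewrite -e add1n divpolyX_odd //.
  have I1 := IH m.+2; have I2 := IH m; have I3 := IH m.-1; have I4 := IH m.+1.
  have := odd_double_half m; set j := m./2.
  case: (boolP (odd m)) => om em.
    have em1 : (m = j.*2.+1)%N by lia.
    have em2 : (m.+2 = j.+1.*2.+1)%N by lia.
    have em3 : (m.-1 = j.*2)%N by lia.
    have em4 : (m.+1 = j.+1.*2)%N by lia.
    have j0 : (0 < j)%N by lia.
    rewrite em2 in I1 *; rewrite em3 in I3 *; rewrite em4 in I4 *.
    rewrite em1 in I2 *.
    rewrite !(divX_deg_odd, divX_deg_even, divX_lead_odd, divX_lead_even) in I1 I2 I3 I4 *.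
    apply: top_coef_sub (top_coefM (top_coefM T1 (I1 _ _)) (top_coefX 3 (I2 _ _)))
       (top_coefM (top_coefM T2 (I3 _ _)) (top_coefX 3 (I4 _ _))) _ _ _; try lia; try nia.
    by rewrite !(natr_doubleS, natr_double) -?natr1; ring.
  have [i ei] : exists i, j = i.+1 by exists j.-1; lia.
  have em1 : (m = i.+1.*2)%N by lia.
  have em2 : (m.+2 = i.+2.*2)%N by lia.
  have em3 : (m.-1 = i.*2.+1)%N by lia.
  have em4 : (m.+1 = i.+1.*2.+1)%N by lia.
  rewrite em2 in I1 *; rewrite em3 in I3 *; rewrite em4 in I4 *.
  rewrite em1 in I2 *.
  rewrite !(divX_deg_odd, divX_deg_even, divX_lead_odd, divX_lead_even) in I1 I2 I3 I4 *.
  apply: top_coef_sub (top_coefM (top_coefM T2 (I1 _ _)) (top_coefX 3 (I2 _ _)))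
     (top_coefM (top_coefM T1 (I3 _ _)) (top_coefX 3 (I4 _ _))) _ _ _; try lia; try nia.
  by rewrite !(natr_doubleS, natr_double) -?natr1; ring.
have m1 : (2 < m)%N by lia.
rewrite -e add0n divpolyX_even //.
have I1 := IH m.+2; have I2 := IH m; have I3 := IH m.-1; have I4 := IH m.+1.
have I5 := IH m.-2.
have := odd_double_half m; set j := m./2.
have [i ei] : exists i, j = i.+1 by exists j.-1; lia.
have b (p q r : {poly K}) dp cp d c d' c' : top_coef p dp cp ->
    top_coef (q - r) d c -> d' = (dp + d)%N -> c' = cp * c ->
    top_coef (p * (q - r)) d' c'.
  by move=> hp hq -> ->; apply: top_coefM.
case: (boolP (odd m)) => om em.
  have em1 : (m = i.+1.*2.+1)%N by lia.
  have em2 : (m.+2 = i.+2.*2.+1)%N by lia.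
  have em3 : (m.-1 = i.+1.*2)%N by lia.
  have em4 : (m.+1 = i.+2.*2)%N by lia.
  have em5 : (m.-2 = i.*2.+1)%N by lia.
  rewrite em2 in I1 *; rewrite em3 in I3 *; rewrite em4 in I4 *.
  rewrite em5 in I5 *; rewrite em1 in I2 *.
  rewrite !(divX_deg_odd, divX_deg_even, divX_lead_odd, divX_lead_even) in I1 I2 I3 I4 I5 *.
  apply: b (I2 _ _) (top_coef_sub (top_coefM (I1 _ _) (top_coefX 2 (I3 _ _)))
     (top_coefM (I5 _ _) (top_coefX 2 (I4 _ _))) (erefl _) _ (erefl _)) _ _; try lia; try nia.
  by rewrite !(natr_doubleS, natr_double) -?natr1; ring.
have [i' ei'] : exists i', i = i'.+1 by exists i.-1; lia.
have em1 : (m = i'.+2.*2)%N by lia.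
have em2 : (m.+2 = i'.+3.*2)%N by lia.
have em3 : (m.-1 = i'.+1.*2.+1)%N by lia.
have em4 : (m.+1 = i'.+2.*2.+1)%N by lia.
have em5 : (m.-2 = i'.+1.*2)%N by lia.
rewrite em2 in I1 *; rewrite em3 in I3 *; rewrite em4 in I4 *.
rewrite em5 in I5 *; rewrite em1 in I2 *.
rewrite !(divX_deg_odd, divX_deg_even, divX_lead_odd, divX_lead_even) in I1 I2 I3 I4 I5 *.
apply: b (I2 _ _) (top_coef_sub (top_coefM (I1 _ _) (top_coefX 2 (I3 _ _)))
   (top_coefM (I5 _ _) (top_coefX 2 (I4 _ _))) (erefl _) _ (erefl _)) _ _; try lia; try nia.
by rewrite !(natr_doubleS, natr_double) -?natr1; ring.
Qed.

Hypothesis char0 : forall n, n.+1%:R != 0 :> K.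

Lemma divX_lead_neq0 n : (0 < n)%N -> divX_lead n != 0.
Proof.
rewrite /divX_lead; case: n => // n _; case: ifP => // on.
by have -> : (n.+1./2 = n.+1./2.-1.+1)%N by lia.
Qed.

Lemma size_divX n : (0 < n)%N -> size (divpolyX W n) = (divX_deg n).+1.
Proof.
move=> n0; have [sp cp] := top_coef_divX n0; apply/eqP; rewrite eqn_leq sp /=.
by apply: contraR (divX_lead_neq0 n0) => h; rewrite -cp nth_default // leqNgt.
Qed.

Lemma divX_neq0 n : (0 < n)%N -> divpolyX W n != 0.
Proof. by move=> n0; rewrite -size_poly_eq0 size_divX. Qed.

End DivPolyDegree.

Lemma poly_eq0_cofinite (F : closedFieldType) (B p : {poly F}) : B != 0 ->
  (forall x, B.[x] != 0 -> p.[x] = 0) -> p = 0.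
Proof.
move=> B0 h; apply/eqP; apply: contraT => p0.
have pB0 : p * B != 0 by rewrite mulf_neq0.
have [r er] := closed_field_poly_normal (p * B).
have [x xr] := closed_infinite r.
have : (p * B).[x] != 0.
  rewrite er hornerZ mulf_neq0 ?lead_coef_eq0 //.
  by rewrite -[_ == 0]/(root _ x) root_prod_XsubC.
rewrite hornerM; case: (eqVneq B.[x] 0) => [->|/h ->].
  by rewrite mulr0 eqxx.
by rewrite mul0r eqxx.
Qed.

(** * Polynomial identities between division polynomials *)

Section PsiPolynomials.
Variables (F : closedFieldType) (W : weierstrass F) (ell : elliptic W).
Hypothesis char0 : forall n, n.+1%:R != 0 :> F.
Local Notation pt := (curve_pt ell).

(* [psi_a psi_b] as a polynomial in x, for a and b of the same parity. *)
Definition psi_prod a b : {poly F} :=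
  divpolyX W a * divpolyX W b * (if odd a then 1 else psi2_sq W).

Definition psi_sq n := psi_prod n n.

(** The numerator of x - x(nP) over the denominator [psi_sq n]. *)
Definition psi_nbr n := psi_prod n.+1 n.-1.

Lemma psi_prodE (P : pt) a b : P != 0 -> odd a = odd b ->
  (psi_prod a b).[xc P] = psi_at P a * psi_at P b.
Proof.
move=> P0; rewrite /psi_prod /psi_at => <-; rewrite 2!hornerM.
by case: ifP => _; rewrite -?yt_sq ?hornerC //; ring.
Qed.

Lemma psi_sqE (P : pt) n : P != 0 -> (psi_sq n).[xc P] = psi_at P n ^+ 2.
Proof. by move=> P0; rewrite psi_prodE. Qed.

Lemma psi_nbrE (P : pt) n : P != 0 -> (0 < n)%N ->
  (psi_nbr n).[xc P] = psi_at P n.+1 * psi_at P n.-1.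
Proof. by move=> P0 n0; rewrite psi_prodE //; lia. Qed.

Lemma top_coef_psi_sq n : (0 < n)%N ->
  top_coef (psi_sq n) (n ^ 2).-1 (n ^ 2)%:R.
Proof.
move=> n0; have t := top_coef_divX W n0; have t2 := top_coefM t t.
rewrite /psi_sq /psi_prod; have := odd_double_half n; set k := n./2.
case: (boolP (odd n)) => on e.
  have := top_coefM t2 (top_coef1 F); rewrite -e add1n divX_deg_odd divX_lead_odd.
  have -> : (2 * k ^ 2 + 2 * k + (2 * k ^ 2 + 2 * k) + 0)%N = (k.*2.+1 ^ 2).-1 by nia.
  suff -> : (2 * k%:R + 1) * (2 * k%:R + 1) * 1 = (k.*2.+1 ^ 2)%:R :> F by [].
  by rewrite natrX natr_doubleS; ring.
have := top_coefM t2 (top_coef_psi2_sq W); rewrite -e add0n divX_deg_even divX_lead_even.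
have -> : (2 * k ^ 2 - 2 + (2 * k ^ 2 - 2) + 3)%N = (k.*2 ^ 2).-1.
  by have : (0 < k)%N; [lia|nia].
suff -> : k%:R * k%:R * 4 = (k.*2 ^ 2)%:R :> F by [].
by rewrite natrX natr_double; ring.
Qed.

Lemma nat_neq0 n : (0 < n)%N -> n%:R != 0 :> F.
Proof. by case: n. Qed.

Lemma psi_sq_neq0 n : (0 < n)%N -> psi_sq n != 0.
Proof.
move=> n0; have [_ h] := top_coef_psi_sq n0; apply/eqP => e; move: h.
by rewrite e coef0 => /esym/eqP; apply/negP/nat_neq0; rewrite expn_gt0 n0.
Qed.

Lemma size_psi_sq n : (0 < n)%N -> (size (psi_sq n) <= n ^ 2)%N.
Proof.
move=> n0; have [h _] := top_coef_psi_sq n0; apply: leq_trans h _.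
by rewrite prednK // expn_gt0 n0.
Qed.

Definition psi_sqs N := \prod_(1 <= j < N.+1) psi_sq j.

Lemma psi_sqs_neq0 N : psi_sqs N != 0.
Proof.
rewrite /psi_sqs; elim: N => [|N IH]; first by rewrite big_geq // oner_neq0.
by rewrite big_nat_recr //= mulf_neq0 ?IH // psi_sq_neq0.
Qed.

Lemma psi_sqs_nontorsion (P : pt) N : P != 0 -> (psi_sqs N).[xc P] != 0 ->
  forall j, (0 < j <= N)%N -> P *+ j != 0.
Proof.
move=> P0; elim: N => [|N IH]; first by move=> _ j; lia.
rewrite /psi_sqs big_nat_recr //= hornerM mulf_eq0 negb_or -/(psi_sqs N).
case/andP=> /IH {}IH; rewrite psi_sqE // expf_eq0 /= => h j /andP[j0].
rewrite leq_eqVlt => /predU1P[->|jN]; last by apply: IH; lia.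
by case: N IH h => [|N] IH h; [rewrite mulr1n|rewrite -psi_at_succ].
Qed.

Lemma exists_pt x : exists2 P : pt, P != 0 & xc P = x.
Proof.
have [y c] := exists_y W x; exists (CurvePt ell c) => //.
Qed.

Lemma psi_poly_eq (N : nat) (p q : {poly F}) :
  (forall P : pt, P != 0 -> (forall j, (0 < j <= N)%N -> P *+ j != 0) ->
     p.[xc P] = q.[xc P]) -> p = q.
Proof.
move=> h; apply/subr0_eq; apply: (poly_eq0_cofinite (psi_sqs_neq0 N)) => x.
have [P P0 <-] := exists_pt x => nz.
by rewrite hornerD hornerN h ?subrr //; apply: psi_sqs_nontorsion.
Qed.

(** Ward's relation, the form of [eds_add_sub] without denominators; as an identity of polynomials
    it also applies at torsion points. *)
Lemma psi_ward m k : (0 < k < m)%N ->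
  psi_prod (m + k) (m - k) = psi_nbr m * psi_sq k - psi_nbr k * psi_sq m.
Proof.
move=> km; apply: (@psi_poly_eq (m + k)) => P P0 nt.
rewrite hornerD hornerN !(hornerM (psi_nbr _)) psi_prodE //; last lia.
rewrite !psi_nbrE ?psi_sqE //; try lia.
rewrite !(psi_at_eds P0 nt); try lia.
rewrite (eds_add_sub P0 nt) ?(eds_step P0 nt); try lia.
by ring.
Qed.

(** Induction on k: [eds_add_sub] for P at ((k + 2) m, m) is compared with the recurrence for mP.
    The exponents agree because (k + 3)^2 + (k + 1)^2 = 2 (k + 2)^2 + 2. *)
Lemma eds_mul (P : pt) N k m : P != 0 ->
  (forall j, (0 < j <= N)%N -> P *+ j != 0) -> (0 < m)%N -> (k * m <= N)%N ->
  eds P (k * m) = eds (P *+ m) k * eds P m ^+ (k ^ 2).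
Proof.
move=> P0 nt m0; elim/ltn_ind: k => -[|[|[|k]]] IH kN.
- by rewrite mul0n mul0r.
- by rewrite mul1n mul1r expr1.
- rewrite mul2n; case: (leqP m 1) => m1; last by rewrite (eds_dbl P0 nt) //; lia.
  have -> : m = 1%N by lia.
  by rewrite expr1n mulr1 mulr1n.
have mk := leq_pmul2r m0.
have b1 : (k.+3 * m = k.+2 * m + m)%N by rewrite mulSn addnC.
have b2 : (k.+2 * m = k.+1 * m + m)%N by rewrite mulSn addnC.
have ntm j : (0 < j <= k.+3)%N -> P *+ m *+ j != 0.
  move=> jk; rewrite -mulrnA nt // muln_gt0 m0 (leq_trans _ kN) //; first by lia.
  by rewrite mulnC leq_pmul2r //; lia.
have Pm0 : P *+ m != 0 by rewrite -[_ *+ m]mulr1n ntm.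
have z1 : eds P (k.+1 * m) != 0.
  by rewrite (eds_neq0 P0 nt) // muln_gt0 m0 /=; lia.
have e1 := @eds_add_sub _ _ _ P P0 N nt (k.+2 * m) m _ _.
have b3 : (k.+2 * m - m = k.+1 * m)%N by lia.
apply: (mulIf z1); rewrite b1 -b3 e1; last 2 first.
- by rewrite m0 b2 /= -[X in (X < _)%N]add0n ltn_add2r muln_gt0.
- by lia.
rewrite b3 !IH; try lia.
transitivity ((xc (P *+ m) - xc (P *+ m *+ k.+2)) * eds (P *+ m) k.+2 ^+ 2
   * (eds P m ^+ (k.+2 ^ 2)) ^+ 2 * eds P m ^+ 2).
  by rewrite -mulrnA [(m * _)%N]mulnC; ring.
rewrite -(eds_step Pm0 ntm); last lia.
have ee : (eds P m ^+ (k.+2 ^ 2)) ^+ 2 * eds P m ^+ 2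
    = eds P m ^+ (k.+3 ^ 2) * eds P m ^+ (k.+1 ^ 2).
  by rewrite -exprM -!exprD; congr (_ ^+ _); nia.
by rewrite -[LHS]mulrA ee; ring.
Qed.

Definition psi_num n := 'X * psi_sq n - psi_nbr n.

(** By [eds_mul], psi_{km}^2 is psi_k^2 at x(mP) times psi_m^{2 k^2}. This homogenizes psi_k^2 in
    degree k^2, one more than its degree, so a factor [psi_sq m] is left over. *)
Lemma psi_sq_mul k m : (0 < k)%N -> (0 < m)%N ->
  psi_sq (k * m) =
  \sum_(i < k ^ 2) (psi_sq k)`_i *: (psi_num m ^+ i * psi_sq m ^+ (k ^ 2 - i)).
Proof.
move=> k0 m0; apply: (@psi_poly_eq (k * m)) => P P0 nt.
have mkm : (m <= k * m)%N by rewrite leq_pmull.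
have Pm0 : P *+ m != 0 by rewrite nt // m0.
have ntm j : (0 < j <= k)%N -> P *+ m *+ j != 0.
  move=> jk; rewrite -mulrnA nt // muln_gt0 m0 mulnC leq_pmul2r //; lia.
rewrite psi_sqE // (psi_at_eds P0 nt) ?(eds_mul P0 nt) //.
have en : (psi_num m).[xc P] = xc (P *+ m) * eds P m ^+ 2.
  rewrite /psi_num hornerD hornerN (hornerM 'X) hornerX psi_sqE // psi_nbrE //.
  rewrite !(psi_at_eds P0 nt); try lia.
  by rewrite (eds_step P0 nt); [ring|lia].
rewrite horner_sum.
transitivity ((psi_sq k).[xc (P *+ m)] * eds P m ^+ (2 * k ^ 2)).
  rewrite psi_sqE // (psi_at_eds Pm0 ntm) ; last lia.
  by rewrite exprMn -exprM mulnC.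
rewrite (horner_coef_wide _ (size_psi_sq k0)) mulr_suml; apply: eq_bigr => i _.
rewrite hornerZ hornerM !horner_exp en psi_sqE // (psi_at_eds P0 nt); last lia.
rewrite -[in RHS]exprM exprMn -exprM -!mulrA -exprD.
by congr (_ * (_ * _ ^+ _)); have := ltn_ord i; lia.
Qed.

(* Here k^2 is the leading coefficient of psi_k^2, and x(mP) is [psi_num m / psi_sq m]. *)
Lemma psi_sq_mul_factor k m : (0 < k)%N -> (0 < m)%N -> exists r,
  psi_sq (k * m) = psi_sq m * ((k ^ 2)%:R *: psi_num m ^+ (k ^ 2).-1 + psi_sq m * r).
Proof.
move=> k0 m0; have [_ ck] := top_coef_psi_sq k0.
have k2 : (0 < k ^ 2)%N by rewrite expn_gt0 k0.
have e : (k ^ 2 = (k ^ 2).-1.+1)%N by rewrite prednK.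
rewrite psi_sq_mul // [in X in exists r, X = _]e big_ord_recr /= ck -e.
have -> : (k ^ 2 - (k ^ 2).-1 = 1)%N by lia.
exists (\sum_(i < (k ^ 2).-1) (psi_sq k)`_i *:
   (psi_num m ^+ i * psi_sq m ^+ (k ^ 2 - i - 2))).
rewrite expr1 mulrDr addrC; congr (_ + _); first by rewrite -scalerAr mulrC.
rewrite mulrA mulr_sumr; apply: eq_bigr => i _.
rewrite -scalerAr; congr (_ *: _).
rewrite mulrCA -expr2 -exprD; congr (_ * _ ^+ _); have := ltn_ord i; lia.
Qed.

End PsiPolynomials.

(** * Points of exact order n *)

Section ExactOrder.
Variable V : zmodType.

Definition exact_order n (Q : V) : bool :=
  [&& (0 < n)%N, Q *+ n == 0 & [forall j : 'I_n, (0 < j)%N ==> (Q *+ j != 0)]].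

Lemma exact_orderP n Q : reflect [/\ (0 < n)%N, Q *+ n = 0 &
    forall j, (0 < j < n)%N -> Q *+ j != 0] (exact_order n Q).
Proof.
apply: (iffP and3P) => [[n0 /eqP q0 /forallP h]|[n0 q0 h]].
  by split=> // j /andP[j0 jn]; have := h (Ordinal jn); rewrite /= j0.
split=> //; first exact/eqP.
by apply/forallP => j; apply/implyP => j0; apply: h; rewrite j0 ltn_ord.
Qed.

Lemma exact_order_dvd m n Q : exact_order m Q -> (Q *+ n == 0) = (m %| n)%N.
Proof.
move=> /exact_orderP[m0 qm h]; rewrite {1}(divn_eq n m) mulrnDr mulnC mulrnA qm.
rewrite mul0rn add0r; have := ltn_pmod n m0; rewrite /dvdn.
by case: (n %% m)%N => [|j] jm; rewrite ?mulr0n ?eqxx //; apply/negbTE/h.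
Qed.

Lemma exact_order_uniq m n Q : exact_order m Q -> exact_order n Q -> m = n.
Proof.
move=> em en; apply/eqP; rewrite eqn_dvd -(exact_order_dvd _ em).
by rewrite -(exact_order_dvd _ en); case/and3P: em => _ -> _; case/and3P: en => _ ->.
Qed.

Lemma exact_order_exists n Q : (0 < n)%N -> Q *+ n = 0 -> exists m, exact_order m Q.
Proof.
move=> n0 qn; have ex : exists m, (0 < m)%N && (Q *+ m == 0).
  by exists n; rewrite n0 qn eqxx.
case: (ex_minnP ex) => m /andP[m0 /eqP qm] h; exists m.
apply/exact_orderP; split=> // j /andP[j0 jm].
by apply/eqP => qj; have := h j; rewrite j0 qj eqxx => /(_ isT); lia.
Qed.

End ExactOrder.

Lemma dvdp_mup (F : closedFieldType) (p q : {poly F}) : p != 0 -> q != 0 ->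
  (forall x, (mup x q <= mup x p)%N) -> q %| p.
Proof.
move=> p0 q0; have [r er] := closed_field_poly_normal q.
have l0 : lead_coef q != 0 by rewrite lead_coef_eq0.
have mq x : mup x q = count_mem x r.
  rewrite er -mul_polyC mupMr ?mu_prod_XsubC //.
  by rewrite /root hornerC.
move=> h; have {}h x : (count_mem x r <= mup x p)%N by rewrite -mq.
rewrite er dvdpZl // => {er mq l0 q0 q}; elim: r p p0 h => [|z r IH] p p0 h.
  by rewrite big_nil dvd1p.
have : ('X - z%:P %| p).
  by rewrite XsubC_dvd //; apply: leq_trans (h z); rewrite /= eqxx.
case/dvdpP => p' ep; subst p; have p'0 : p' != 0.
  by apply: contraNneq p0 => ->; rewrite mul0r.
rewrite big_cons mulrC dvdp_mul //; apply: IH => // x.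
have := h x; rewrite mupM // ?polyXsubC_eq0 //.
have := mup_XsubCX 1 x z; rewrite expr1 => ->.
by rewrite /=; case: eqP => /=; lia.
Qed.

Lemma mup_prod (F : fieldType) I (s : seq I) (P : pred I) (f : I -> {poly F}) x :
  (forall i, P i -> f i != 0) ->
  mup x (\prod_(i <- s | P i) f i) = (\sum_(i <- s | P i) mup x (f i))%N.
Proof.
move=> h; elim: s => [|i s IH]; first by rewrite !big_nil mupNroot // root1.
rewrite !big_cons; case: ifP => // Pi.
have nz : \prod_(j <- s | P j) f j != 0.
  by elim/big_ind: _ => [|p q p0 q0|j /h //]; rewrite ?oner_neq0 ?mulf_neq0.
by rewrite mupM ?IH ?h.
Qed.

(** * Roots of division polynomials and their multiplicities *)

Section DivPolyRoots.
Variables (F : closedFieldType) (W : weierstrass F) (ell : elliptic W).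
Hypothesis char0 : forall n, n.+1%:R != 0 :> F.
Local Notation pt := (curve_pt ell).

Section ExactOrderPoint.
Variables (Q : pt) (m : nat).
Hypotheses (Q0 : Q != 0) (oQ : exact_order m Q).
Local Notation x := (xc Q).

Lemma order_gt1 : (1 < m)%N.
Proof.
case/exact_orderP: oQ => m0 qm _; case: m m0 qm => [|[|k]] // _ /eqP.
by rewrite mulr1n (negbTE Q0).
Qed.

Lemma order_nt j : (0 < j <= m.-1)%N -> Q *+ j != 0.
Proof. by case/exact_orderP: oQ => m0 _ h jm; apply: h; lia. Qed.

Lemma psi_at_lt j : (0 < j < m)%N -> psi_at Q j != 0.
Proof. by move=> jm; rewrite (psi_at_neq0 Q0 order_nt) //; lia. Qed.

Lemma psi_at_order : psi_at Q m = 0.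
Proof.
have m1 := order_gt1; have e : m = m.-1.+1 by lia.
apply/eqP; rewrite e (psi_at_succ Q0 order_nt) -?e; last lia.
by case/exact_orderP: oQ => _ -> _.
Qed.

(** Ward's relation at (m - 1, 2) reads psi_{m+1} psi_{m-3} = psi_m psi_{m-2} psi_2^2 - psi_3
    psi_{m-1}^2, and at Q only the last term survives. The orders 2 and 3 are settled by the
    explicit psi_3 and psi_4. *)
Lemma psi_at_order_succ : psi_at Q m.+1 != 0.
Proof.
have m1 := order_gt1; have [_ qm h] := exact_orderP _ _ oQ.
case: (ltnP 3 m) => m3.
  have w : (psi_prod W m.+1 (m - 3)).[x] = - (psi_at Q 3 * psi_at Q m.-1 ^+ 2).
    have := congr1 (horner^~ x) (psi_ward ell char0 (m := m.-1) (k := 2) _).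
    have -> : (m.-1 + 2 = m.+1)%N by lia.
    have -> : (m.-1 - 2 = m - 3)%N by lia.
    move=> -> //; last by lia.
    rewrite hornerD hornerN !(hornerM (psi_nbr _ _)).
    rewrite !psi_nbrE ?psi_sqE //; try lia.
    rewrite prednK; last lia.
    by rewrite psi_at_order [psi_at Q 1]/psi_at /= hornerC; ring.
  have nz : (psi_prod W m.+1 (m - 3)).[x] != 0.
    by rewrite w oppr_eq0 mulf_neq0 // ?expf_neq0 // psi_at_lt //; lia.
  by apply: contraNneq nz => e; rewrite psi_prodE ?e ?mul0r //; lia.
have [e|e] : (m = 2 \/ m = 3)%N by lia.
  have t0 : yt Q = 0 by apply/eqP; rewrite yt_eq0 // -qm e.
  have cQ := pt_on Q; rewrite (valE Q0) in cQ.
  (* At a point of order 2, psi_3 is minus the square of the partial derivative of w_E in x, nonzero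
     by smoothness. *)
  have := elliptic_smooth ell cQ t0; apply: contraNneq => {cQ}.
  have := curve_eq Q0; move: t0; rewrite e /psi_at mulr1 /yt /ytwo.
  rewrite [divpolyX W 3]/(psi3 W) /psi3 !hevalE /b2 /b4 /b6 /b8.
  move: (xc Q) (yc Q); case: W => c1 c2 c3 c4 c6 /= a b t0 c p3.
  rewrite -sqrf_eq0; apply/eqP.
  have e6 : c6 = b ^+ 2 + c1 * a * b + c3 * b - a ^+ 3 - c2 * a ^+ 2 - c4 * a.
    by rewrite c; ring.
  rewrite e6 in p3; have e3 : c3 = - (2 * b + c1 * a) by apply/eqP; rewrite -addr_eq0 addrC t0.
  by apply/eqP; rewrite -oppr_eq0 -p3 e3; apply/eqP; ring.
have q2 : Q *+ 2 != 0 by apply: h; lia.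
have q20 : Q *+ 2 = - Q by apply/eqP; rewrite -addr_eq0 -mulrSr -e qm.
have t0 : yt Q != 0 by rewrite yt_eq0.
rewrite e /psi_at [divpolyX W 4]/(psi4_red W) psi4_dbl // q20 ytN //.
by rewrite !mulf_neq0 ?oppr_eq0 ?expf_neq0.
Qed.

Lemma psi_nbr_order : (psi_nbr W m).[x] != 0.
Proof.
have m1 := order_gt1; rewrite psi_nbrE //; last lia.
by rewrite mulf_neq0 ?psi_at_order_succ ?psi_at_lt //; lia.
Qed.

Lemma psi_sq_order0 : (psi_sq W m).[x] = 0.
Proof. by rewrite psi_sqE // psi_at_order expr0n. Qed.

Lemma mup_psi_sq_mul k : (0 < k)%N -> mup x (psi_sq W (k * m)) = mup x (psi_sq W m).
Proof.
move=> k0; have m1 := order_gt1.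
have [|r ->] := psi_sq_mul_factor ell char0 k0 (m := m); first lia.
rewrite mupMl // /root hornerD hornerZ (hornerM (psi_sq _ _)) psi_sq_order0 mul0r addr0.
rewrite mulf_neq0 ?nat_neq0 ?expn_gt0 ?k0 //.
rewrite horner_exp expf_neq0 // /psi_num hornerD hornerN (hornerM 'X).
by rewrite psi_sq_order0 mulr0 add0r oppr_eq0 psi_nbr_order.
Qed.

(** For m not dividing n, the vanishing of [psi_sq m] at x(Q) reduces Ward's relation to one term:
    at (m, n - m) if n < 2m, and at (n - m, m) if n > 2m, where psi_{n-m} is nonzero by
    induction. *)
Lemma psi_sq_root n : (0 < n)%N -> ((psi_sq W n).[x] == 0) = (m %| n)%N.
Proof.
have m1 := order_gt1.
elim/ltn_ind: n => n IH n0; case: (boolP (m %| n)%N) => [/dvdnP[k e]|ndv].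
  have k0 : (0 < k)%N by case: k e => //; lia.
  have [|r er] := psi_sq_mul_factor ell char0 k0 (m := m); first lia.
  by rewrite e er (hornerM (psi_sq _ _)) psi_sq_order0 mul0r eqxx.
have sq0 j : (psi_sq W j).[x] != 0 -> psi_at Q j != 0.
  by rewrite psi_sqE // expf_eq0.
case: (ltngtP n m) => nm; last by rewrite nm dvdnn in ndv.
  by apply/negbTE; rewrite psi_sqE // expf_neq0 // psi_at_lt // n0.
apply/negbTE; rewrite psi_sqE // expf_neq0 //.
have n2m : n != (m + m)%N by apply: contraNneq ndv => ->; rewrite addnn -muln2 dvdn_mulr.
case: (ltnP n (m + m)) => nmm.
  have /= := congr1 (horner^~ x) (psi_ward ell char0 (m := m) (k := n - m) _).
  have -> : (m + (n - m) = n)%N by lia.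
  rewrite hornerD hornerN !(hornerM (psi_nbr _ _)) psi_sq_order0 mulr0 subr0.
  move=> w; have nz : (psi_prod W n (m - (n - m))).[x] != 0.
    rewrite w; last lia.
    by rewrite mulf_neq0 ?psi_nbr_order // psi_sqE // expf_neq0 // psi_at_lt //; lia.
  by apply: contraNneq nz => e; rewrite psi_prodE ?e ?mul0r //; lia.
have /= := congr1 (horner^~ x) (psi_ward ell char0 (m := n - m) (k := m) _).
have -> : (n - m + m = n)%N by lia.
rewrite hornerD hornerN !(hornerM (psi_nbr _ _)) psi_sq_order0 mulr0 sub0r.
move=> w; have nz : (psi_prod W n (n - m - m)).[x] != 0.
  rewrite w; last lia.
  rewrite oppr_eq0 mulf_neq0 ?psi_nbr_order // IH; try lia.
  by rewrite -(dvdn_addl _ (dvdnn m)) subnK //; lia.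
by apply: contraNneq nz => e; rewrite psi_prodE ?e ?mul0r //; lia.
Qed.

End ExactOrderPoint.

Lemma psi2_sq_neq0 : psi2_sq W != 0.
Proof.
have [_ h] := top_coef_psi2_sq W; apply/eqP => e; move: h; rewrite e coef0.
by move/esym; apply/eqP/(char0 3%N).
Qed.

Lemma mup_psi_sq n x : (0 < n)%N -> mup x (psi_sq W n) =
  ((mup x (divpolyX W n)).*2 + if odd n then 0 else mup x (psi2_sq W))%N.
Proof.
move=> n0; have d0 := divX_neq0 W char0 n0.
rewrite /psi_sq /psi_prod mupM ?mulf_neq0 // ?mupM // ?addnn; last first.
  by case: ifP; rewrite ?oner_neq0 ?psi2_sq_neq0.
by case: ifP => _; rewrite ?(mupNroot (root1 _)).
Qed.

(** The multiplicities in [psi_sq] are compared by [mup_psi_sq_mul]. At a point of order 2 they come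
    entirely from the factor [psi2_sq], which [divpolyX] leaves out, hence the exception. *)
Lemma mup_divX (Q : pt) m n : Q != 0 -> exact_order m Q -> (0 < n)%N ->
  mup (xc Q) (divpolyX W n) =
    if (m %| n)%N && (m != 2)%N then mup (xc Q) (divpolyX W m) else 0%N.
Proof.
move=> Q0 oQ n0; have m1 := order_gt1 Q0 oQ; have d0 := divX_neq0 W char0 n0.
case: (boolP (m %| n)%N) => /= [/dvdnP[k e]|ndv]; last first.
  apply: mupNroot; apply: contra ndv => r.
  rewrite -(psi_sq_root Q0 oQ n0) /psi_sq /psi_prod 2!hornerM.
  by rewrite (eqP r) !mul0r.
have k0 : (0 < k)%N by case: k e => //; lia.
have h := mup_psi_sq_mul Q0 oQ k0; rewrite -e in h.
have [m2|m2] /= := eqVneq m 2%N.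
  move: h; rewrite m2 mup_psi_sq // [in RHS]mup_psi_sq //= e m2 oddM andbF.
  by rewrite [divpolyX W 2]/(1 : {poly F}) (mupNroot (root1 _)) /=; lia.
have z : mup (xc Q) (psi2_sq W) = 0%N.
  apply: mupNroot; rewrite /root -yt_sq // expf_eq0 /= yt_eq0 //.
  by rewrite (exact_order_dvd _ oQ); apply: contra m2 => /dvdn_leq; lia.
by move: h; rewrite !mup_psi_sq ?z; try lia; case: ifP; case: ifP; lia.
Qed.

Lemma mup_divX_gt0 (Q : pt) m : Q != 0 -> exact_order m Q -> (m != 2)%N ->
  (0 < mup (xc Q) (divpolyX W m))%N.
Proof.
move=> Q0 oQ m2; have m1 := order_gt1 Q0 oQ.
have : (0 < mup (xc Q) (psi_sq W m))%N.
  by rewrite -XsubC_dvd ?psi_sq_neq0 // ?dvdp_XsubCl /root ?(psi_sq_order0 Q0 oQ) //; lia.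
rewrite mup_psi_sq; last lia.
have z : mup (xc Q) (psi2_sq W) = 0%N.
  apply: mupNroot; rewrite /root -yt_sq // expf_eq0 /= yt_eq0 //.
  by rewrite (exact_order_dvd _ oQ); apply: contra m2 => /dvdn_leq; lia.
by rewrite z; case: ifP; lia.
Qed.

Lemma mup_divX_nontorsion (Q : pt) n : Q != 0 -> (0 < n)%N ->
  (forall m, ~~ exact_order m Q) -> mup (xc Q) (divpolyX W n) = 0%N.
Proof.
move=> Q0 n0 h; apply: mupNroot.
have nt j : (0 < j <= n)%N -> Q *+ j != 0.
  move=> /andP[j0 _]; apply/eqP => qj; have [m om] := exact_order_exists j0 qj.
  by move: (h m); rewrite om.
have : psi_at Q n != 0 by apply: (psi_at_neq0 Q0 nt); lia.
by apply: contra => /eqP e; rewrite /psi_at e mul0r.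
Qed.

Definition proper_prod n : {poly F} :=
  \prod_(1 <= m < n | (m %| n)%N) primdivX W m.

(** Among the proper divisors d of n, only d equal to the order of Q contributes at x(Q), and it
    contributes the full multiplicity in [divpolyX n]. So the product divides, and the quotient
    keeps only the points whose order is n itself. *)
Lemma mup_primdivX n : (0 < n)%N -> [/\ primdivX W n != 0,
  divpolyX W n = primdivX W n * proper_prod n &
  forall Q : pt, Q != 0 -> mup (xc Q) (primdivX W n) =
    if exact_order n Q && (n != 2)%N then mup (xc Q) (divpolyX W n) else 0%N].
Proof.
elim/ltn_ind: n => n IH n0; have d0 := divX_neq0 W char0 n0.
pose r := [seq d <- index_iota 1 n | (d %| n)%N].
have er : proper_prod n = \prod_(d <- r) primdivX W d by rewrite /r big_filter.
have rP d : d \in r = (0 < d < n)%N && (d %| n)%N.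
  by rewrite mem_filter mem_index_iota andbC.
have p0 : proper_prod n != 0.
  rewrite er prodf_seq_neq0; apply/allP => d; rewrite rP => /andP[dn _] /=.
  by case: (IH d) => //; lia.
have mr x : mup x (proper_prod n) = (\sum_(d <- r) mup x (primdivX W d))%N.
  rewrite er big_seq [RHS]big_seq; apply: mup_prod => d; rewrite rP => /andP[dn _].
  by case: (IH d) => //; lia.
have mp (Q : pt) : Q != 0 -> (mup (xc Q) (proper_prod n) +
    (if exact_order n Q && (n != 2)%N then mup (xc Q) (divpolyX W n) else 0)
    = mup (xc Q) (divpolyX W n))%N.
  move=> Q0; rewrite mr.
  have -> : (\sum_(d <- r) mup (xc Q) (primdivX W d) = \sum_(d <- r)
      if exact_order d Q && (d != 2)%N then mup (xc Q) (divpolyX W d) else 0)%N.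
    rewrite big_seq [RHS]big_seq; apply: eq_bigr => d; rewrite rP => /andP[dn _].
    by case: (IH d) => [||_ _ ->] //; lia.
  have [[m om]|no] := pselect (exists m, exact_order m Q); last first.
    have no' m : ~~ exact_order m Q by apply/negP => om; apply: no; exists m.
    rewrite (mup_divX_nontorsion Q0 n0 no') (negbTE (no' n)) big1 // => d _.
    by rewrite (negbTE (no' d)).
  have eo d : exact_order d Q = (d == m).
    by apply/idP/eqP => [od|->//]; apply: exact_order_uniq od om.
  have m1 := order_gt1 Q0 om.
  rewrite (mup_divX Q0 om n0) eo; case: (boolP (m \in r)) => mr'.
    have u : uniq r by rewrite filter_uniq ?iota_uniq.
    rewrite (bigD1_seq m) //= eo eqxx /= big1 => [|d /negbTE dm]; last first.
      by rewrite eo dm.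
    move: mr'; rewrite rP => /andP[/andP[_ mn] ->] /=.
    by rewrite [n == m]gtn_eqF //= !addn0.
  rewrite big1_seq => [|d /andP[_ dr]]; last first.
    by rewrite eo; case: eqP => // dm; rewrite dm (negbTE mr') in dr.
  rewrite add0n; have [->|nm] := eqVneq n m; first by rewrite dvdnn /=; case: (m != 2)%N.
  case: (boolP (m %| n)%N) => // mn; move: mr'; rewrite rP mn andbT => /negP[].
  by have := dvdn_leq n0 mn; rewrite (ltnW m1) ltn_neqAle eq_sym nm.
have dv : proper_prod n %| divpolyX W n.
  apply: dvdp_mup => // x; have [Q Q0 <-] := exists_pt ell x.
  by rewrite -(mp Q Q0) leq_addr.
have e : divpolyX W n = primdivX W n * proper_prod n.
  by rewrite (primdivXE W n0) divpK.
have q0 : primdivX W n != 0 by apply: contraNneq d0 => z; rewrite e z mul0r.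
split=> // Q Q0; have := mp Q Q0; rewrite [in X in _ = X]e mupM // addnC.
by move/addIn => ->.
Qed.

Lemma root_primdivX n (Q : pt) : (0 < n)%N -> (n != 2)%N -> Q != 0 ->
  root (primdivX W n) (xc Q) = exact_order n Q.
Proof.
move=> n0 n2 Q0; have [p0 _ h] := mup_primdivX n0.
rewrite root_factor_theorem /= XsubC_dvd // h // n2 andbT.
by case: ifP => // oQ; rewrite mup_divX_gt0.
Qed.

End DivPolyRoots.

(** * Existence of points of exact order n *)

(** This is the telescoping bound of the sum of 1 / k^2 for 2 <= k <= K by 1 - 1 / K, multiplied by
    K n^2. *)
Lemma sum_sq_codivisors n K : (0 < K)%N ->
  (K * (\sum_(2 <= k < K.+1 | (k %| n)%N) (n %/ k) ^ 2) <= K.-1 * n ^ 2)%N.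
Proof.
elim: K => // -[|K] IH _; first by rewrite big_geq.
have {IH} := IH isT; rewrite [in X in _ -> X]big_mkcond big_nat_recr //= -big_mkcond /=.
set S := \sum_(_ <= _ < _ | _) _; set t := (if _ then _ else _).
have h : (K.+2 ^ 2 * t <= n ^ 2)%N.
  rewrite /t; case: ifP => [d|_]; last by rewrite muln0.
  by rewrite -expnMn leq_exp2r // mulnC leq_divM.
move=> H; rewrite -(leq_pmul2l (ltn0Sn K)).
have h2 : (K.+1 * K.+2 * t <= n ^ 2)%N by nia.
have h3 : (K.+2 * (K.+1 * S) <= K.+2 * (K * n ^ 2))%N by rewrite leq_mul2l H orbT.
nia.
Qed.

(** Proper divisors are d = n / k with 2 <= k <= n, so the bound with K = n applies. *)
Lemma sum_sq_proper_divisors n : (0 < n)%N ->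
  (\sum_(1 <= d < n | (d %| n)%N) d ^ 2 < n ^ 2)%N.
Proof.
move=> n0; have := sum_sq_codivisors n n0.
have -> : (\sum_(2 <= k < n.+1 | (k %| n)%N) (n %/ k) ^ 2 =
          \sum_(1 <= d < n | (d %| n)%N) d ^ 2)%N.
  rewrite -[LHS]big_filter -[RHS]big_filter.
  rewrite -(big_map (fun k => n %/ k)%N xpredT (fun d => d ^ 2)%N).
  apply: perm_big; apply: uniq_perm.
  - rewrite map_inj_in_uniq ?filter_uniq ?iota_uniq // => k k'.
    rewrite !mem_filter => /andP[kn _] /andP[k'n _] e.
    have nk : (0 < n %/ k)%N by rewrite divn_gt0 ?(dvdn_gt0 n0 kn) // dvdn_leq.
    by apply/eqP; rewrite -(eqn_pmul2l nk) divnK // e divnK.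
  - by rewrite filter_uniq ?iota_uniq.
  move=> d; rewrite mem_filter mem_index_iota; apply/mapP/andP => [[k]|[dn /andP[d1 d2]]].
    rewrite mem_filter mem_index_iota => /andP[kn /andP[k2 k3]] ->.
    split; first by rewrite -{2}(divnK kn) dvdn_mulr.
    have k0 : (0 < k)%N by lia.
    by rewrite divn_gt0 // (dvdn_leq n0 kn) ltn_Pdiv.
  exists (n %/ d)%N; last by rewrite divnA ?mulKn ?dvdn_mull //; apply/esym; rewrite mulKn.
  rewrite mem_filter mem_index_iota ltnS leq_div andbT.
  rewrite -{2}(divnK dn) dvdn_mulr //=.
  by rewrite ltn_divRL // mul1n.
set S := \sum_(_ <= _ < _ | _) _ => h; rewrite -(ltn_pmul2l n0).
by apply: leq_ltn_trans h _; rewrite ltn_pmul2r ?expn_gt0 ?n0 //; lia.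
Qed.

Lemma size_prod_pred (R : idomainType) I (s : seq I) (P : pred I) (f : I -> {poly R}) :
  (forall i, P i -> f i != 0) ->
  (size (\prod_(i <- s | P i) f i)).-1 = (\sum_(i <- s | P i) (size (f i)).-1)%N.
Proof.
move=> h; elim: s => [|i s IH]; first by rewrite !big_nil size_poly1.
rewrite !big_cons; case: ifP => // Pi.
have nz : \prod_(j <- s | P j) f j != 0.
  by elim/big_ind: _ => [|p q p0 q0|j /h //]; rewrite ?oner_neq0 ?mulf_neq0.
rewrite size_mul ?h // -IH; move: (h i Pi) nz; rewrite -!size_poly_gt0; lia.
Qed.

Section ExistsExactOrder.
Variables (F : closedFieldType) (W : weierstrass F) (ell : elliptic W).
Hypothesis char0 : forall n, n.+1%:R != 0 :> F.
Local Notation pt := (curve_pt ell).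

Lemma divX_deg_bound d : (0 < d)%N ->
  (2 * divX_deg d + (if odd d then 1 else 4) = d ^ 2)%N.
Proof.
move=> d0; have := odd_double_half d; set k := d./2.
case: (odd d) => e; move: d0; rewrite -e ?add1n ?add0n => d0.
  by rewrite divX_deg_odd; nia.
by rewrite divX_deg_even; nia.
Qed.

(** If [primdivX n] were constant, the degree of [divpolyX n] would be at most the sum of the
    [divX_deg d] over proper divisors d. Doubled, this contradicts the bound on the sum of the
    d^2. *)
Lemma size_primdivX n : (2 < n)%N -> (1 < size (primdivX W n))%N.
Proof.
move=> n2; have n0 : (0 < n)%N by lia.
have [p0 e _] := mup_primdivX ell char0 n0.
rewrite ltnNge; apply/negP => sp.
have sz d : (0 < d)%N -> ((size (primdivX W d)).-1 <= divX_deg d)%N.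
  move=> d0; have [q0 e' _] := mup_primdivX ell char0 d0.
  have := size_divX W char0 d0; have := divX_neq0 W char0 d0.
  rewrite e' => nz.
  have pd0 : proper_prod W d != 0 by apply: contraNneq nz => ->; rewrite mulr0.
  rewrite size_mul //; move: pd0; rewrite -size_poly_gt0.
  by move: (size (primdivX W d)) (size (proper_prod W d)) => a b; lia.
have pp0 : proper_prod W n != 0.
  by apply: contraNneq (divX_neq0 W char0 n0) => z; rewrite e z mulr0.
have := size_divX W char0 n0; rewrite e size_mul // => eq1.
have : (divX_deg n <= (size (proper_prod W n)).-1)%N.
  by move: sp eq1; move: (size (primdivX W n)) (size (proper_prod W n)) => a b; lia.
rewrite /proper_prod big_nat_cond size_prod_pred; last first.
  by move=> i /andP[/andP[i0 _] _]; case: (mup_primdivX ell char0 i0).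
rewrite -big_nat_cond.
(* [T] collects the corrections 1 and 4 between d^2 and twice the degree. For odd n, T >= 1
   suffices; for even n the correction 4 of n itself is outweighed by the divisors 1 and 2, which
   give T >= 5. *)
pose T := (\sum_(1 <= d < n | (d %| n)%N) (if odd d then 1 else 4))%N.
have hT : (2 * (\sum_(1 <= d < n | (d %| n)%N) (size (primdivX W d)).-1) + T
   <= \sum_(1 <= d < n | (d %| n)%N) d ^ 2)%N.
  rewrite big_distrr -big_split /= big_nat_cond [X in (_ <= X)%N]big_nat_cond.
  apply: leq_sum => d /andP[/andP[d0 _] _].
  by rewrite -(divX_deg_bound d0) leq_add2r leq_mul2l sz.
have := sum_sq_proper_divisors n0; have := divX_deg_bound n0.
have n1 : (1 < n)%N by lia.
have t1 : (1 <= T)%N by rewrite /T big_ltn_cond // dvd1n leq_addr.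
have t5 : ~~ odd n -> (5 <= T)%N.
  move=> /negbTE on.
  by rewrite /T big_ltn_cond // dvd1n big_ltn_cond // dvdn2 on /= addnA leq_addr.
move: hT t1 t5; move: (\sum_(_ <= _ < _ | _) (size _).-1)%N (\sum_(_ <= _ < _ | _) _ ^ 2)%N.
move: T (divX_deg n) (n ^ 2)%N => T d N a b; case: (odd n) => /= h1 t1 t5; first by lia.
by have := t5 isT; lia.
Qed.

Lemma exists_exact_order n : (0 < n)%N -> exists Q : pt, exact_order n Q.
Proof.
case: (ltngtP n 2) => [n2 n0|n2 n0|->].
- have -> : n = 1%N by lia.
  by exists 0; apply/exact_orderP; split=> // j; lia.
- have /closed_rootP[x rx] : size (primdivX W n) != 1%N.
    by have := size_primdivX n2; lia.
  have [Q Q0 ex] := exists_pt ell x; exists Q; rewrite -(root_primdivX char0) ?ex //.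
  by lia.
move=> _; have /closed_rootP[x rx] : size (psi2_sq W) != 1%N.
  have [_ h] := top_coef_psi2_sq W; apply/eqP => s1; move: h.
  by rewrite nth_default ?s1 // => z; have := char0 3; rewrite -[3.+1%:R]/(4 : F) -z eqxx.
have [Q Q0 ex] := exists_pt ell x; exists Q; apply/exact_orderP; split=> //.
  by apply/eqP; rewrite -yt_eq0 // -sqrf_eq0 yt_sq // ex.
by move=> [|[|j]] //; rewrite mulr1n.
Qed.

End ExistsExactOrder.

(** * Translation of a torsion point to one of exact order n *)

Section Translate.
Variable V : zmodType.

Lemma mulrn_coprime_eq0 (x : V) a b : coprime a b -> x *+ a = 0 -> x *+ b = 0 -> x = 0.
Proof.
move=> cab xa xb; case: (posnP a) => [a0|a0].
  by move: cab; rewrite a0 /coprime gcd0n => /eqP eb; rewrite -[x]mulr1n -eb.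
case: (egcdnP b a0) => km kn e _; move: e; rewrite (eqP cab) => e.
have := congr1 (fun k => x *+ k) e.
by rewrite mulrnDr mulnC [(kn * b)%N]mulnC !mulrnA xa xb !mul0rn add0r.
Qed.

Lemma exact_order_primes n (x : V) : (0 < n)%N -> x *+ n = 0 ->
  (forall p, prime p -> (p %| n)%N -> x *+ (n %/ p) != 0) -> exact_order n x.
Proof.
move=> n0 xn h; have [m om] := exact_order_exists n0 xn.
have mn : (m %| n)%N by rewrite -(exact_order_dvd _ om) xn.
have [<-//|ne] := eqVneq m n.
have q1 : (1 < n %/ m)%N.
  have m0 : (0 < m)%N by case/and3P: om.
  by rewrite ltn_divRL // mul1n ltn_neqAle ne dvdn_leq.
have pn : (pdiv (n %/ m) %| n)%N.
  by apply: dvdn_trans (pdiv_dvd _) _; rewrite -{2}(divnK mn) dvdn_mulr.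
case/negP: (h _ (pdiv_prime q1) pn).
rewrite (exact_order_dvd _ om) dvdn_divRL //.
by rewrite -{2}(divnK mn) mulnC dvdn_pmul2r ?pdiv_dvd //; case/and3P: om.
Qed.

(* Multiplying by the primes p for which (n / p) Q <> 0 makes the translation
   by P invisible at these primes and effective at the other ones. *)
Lemma exact_order_translate n (P Q : V) : exact_order n P -> Q *+ n = 0 ->
  exists k, exact_order n (Q + P *+ k).
Proof.
move=> oP qn; have [n0 pn hP] := exact_orderP _ _ oP.
pose k := (\prod_(p <- primes n | Q *+ (n %/ p) != 0%R) p)%N.
exists k; apply: exact_order_primes => //.
  by rewrite mulrnDl qn add0r mulrnAC pn mul0rn.
move=> p pp pdn; have pn' : p \in primes n by rewrite mem_primes pp n0.
have np : P *+ (n %/ p) != 0.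
  by rewrite hP // divn_gt0 ?prime_gt0 // dvdn_leq //= ltn_Pdiv // prime_gt1.
rewrite mulrnDl; case: (eqVneq (Q *+ (n %/ p)) 0) => [q0|q0].
  rewrite q0 add0r mulrnAC; apply: contra np => /eqP e; apply/eqP.
  apply: (@mulrn_coprime_eq0 _ k p) => //; last by rewrite -mulrnA divnK.
  rewrite /k coprime_sym big_seq_cond; elim/big_ind: _ => [|a b|r /andP[]].
  - exact: coprimen1.
  - by rewrite coprimeMr => -> ->.
  rewrite mem_primes => /andP[pr _] nr; rewrite prime_coprime // dvdn_prime2 //.
  by apply: contraNneq nr => <-; rewrite q0.
have -> : P *+ k *+ (n %/ p) = 0; last by rewrite addr0.
have pk : (p %| k)%N.
  by rewrite /k (big_rem p) //= q0 dvdn_mulr.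
by rewrite -mulrnA -(divnK pk) -mulnA [(p * _)%N]mulnC divnK // mulnC mulrnA pn mul0rn.
Qed.

End Translate.

(** * Characteristic polynomials on quotient algebras *)

Section Eigen.
Variable L : closedFieldType.

Lemma eigenvalue_exists n (A : 'M[L]_n) : (0 < n)%N -> exists a, eigenvalue A a.
Proof.
move=> n0; have /closed_rootP[a ra] : size (char_poly A) != 1%N.
  by rewrite size_char_poly eqSS -lt0n.
by exists a; rewrite eigenvalue_root_char.
Qed.

Lemma stable_eigenvector n m (V : 'M[L]_(m, n)) (A : 'M[L]_n) :
  V != 0 -> (V *m A <= V)%MS ->
  exists a (v : 'rV_n), [/\ v != 0, (v <= V)%MS & v *m A = a *: v].
Proof.
move=> V0 sV; set B := row_base V.
have sB : (B *m A <= B)%MS by rewrite (eqmxMr A (eq_row_base V)) eq_row_base.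
have r0 : (0 < \rank V)%N by rewrite lt0n mxrank_eq0.
(* [B *m A *m pinvmx B] is the matrix of A restricted to the row space of V. *)
have [a /eigenvalueP[w ew w0]] := eigenvalue_exists (B *m A *m pinvmx B) r0.
exists a, (w *m B); split.
- apply: contra_neq w0 => e; apply: (row_free_inj (row_base_free V)).
  by rewrite e mul0mx.
- by rewrite -(eq_row_base V) submxMl.
by rewrite -mulmxA -{1}(mulmxKpV sB) mulmxA ew scalemxAl.
Qed.

Lemma common_eigenvector3 n (A B C : 'M[L]_n) z : eigenvalue C z ->
  comm_mx C A -> comm_mx C B -> comm_mx A B ->
  exists a b (v : 'rV_n), [/\ v != 0, v *m A = a *: v, v *m B = b *: v
    & v *m C = z *: v].
Proof.
move=> ez cCA cCB cAB; have V0 : eigenspace C z != 0 by [].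
have [a [v [v0 vV va]]] := stable_eigenvector V0 (comm_mx_stable_eigenspace z cCA).
have vva : (v <= eigenspace A a)%MS by apply/eigenspaceP.
set U := (eigenspace C z :&: eigenspace A a)%MS.
have U0 : U != 0.
  have vU : (v <= U)%MS by rewrite sub_capmx vV.
  by apply: contraNneq v0 => e; rewrite e submx0 in vU.
have sU : (U *m B <= U)%MS.
  rewrite sub_capmx; apply/andP; split.
    exact: submx_trans (submxMr _ (capmxSl _ _)) (comm_mx_stable_eigenspace z cCB).
  exact: submx_trans (submxMr _ (capmxSr _ _)) (comm_mx_stable_eigenspace a cAB).
have [b [w [w0 wU wb]]] := stable_eigenvector U0 sU.
exists a, b, w; split => //; apply/eigenspaceP.
  exact: submx_trans wU (capmxSr _ _).
exact: submx_trans wU (capmxSl _ _).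
Qed.

End Eigen.

Section FiniteBasis.
Variables (K : fieldType) (V : lmodType K).

Lemma basis_of_spanning d (e : 'I_d -> V) :
  (forall v, exists c : 'I_d -> K, v = \sum_i c i *: e i) ->
  exists d' (e' : 'I_d' -> V), is_basis e'.
Proof.
elim: d e => [|d IH] e sp.
  exists 0%N, e => v; exists 0; split; last by move=> c _; apply/rowP => -[].
  by have [c ->] := sp v; rewrite !big_ord0.
have [[c [e0 [i ci]]]|ind] := pselect (exists c : 'I_d.+1 -> K,
    \sum_j c j *: e j = 0 /\ exists i, c i != 0); last first.
  exists d.+1, e => v; have [c ec] := sp v.
  exists (\row_j c j); split.
    by rewrite ec; apply: eq_bigr => j _; rewrite mxE.
  move=> c' ec'; apply/rowP => j; rewrite mxE; apply/eqP; apply: contraT => ne.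
  case: ind; exists (fun j => c j - c' 0 j); split; last by exists j; rewrite subr_eq0.
  rewrite (eq_bigr (fun j => c j *: e j - c' 0 j *: e j)); last first.
    by move=> k _; rewrite scalerBl.
  by rewrite sumrB -ec -ec' subrr.
apply: (IH (fun j => e (lift i j))) => v; have [b eb] := sp v.
exists (fun j => b (lift i j) - b i / c i * c (lift i j)); rewrite eb.
have ei : e i = - \sum_j ((c i)^-1 * c (lift i j)) *: e (lift i j).
  apply: (scalerI ci); rewrite scalerN scaler_sumr.
  move: e0; rewrite (bigD1_ord i) //= => /eqP; rewrite addr_eq0 => /eqP ->.
  congr (- _); apply: eq_bigr => j _; by rewrite scalerA mulVKf.
rewrite (bigD1_ord i) //= {1}ei scalerN scaler_sumr -sumrN -big_split /=.
apply: eq_bigr => j _; rewrite scalerA -scaleNr -scalerDl mulrA addrC.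
by rewrite -mulrA.
Qed.

Lemma basis_of_spanning_fin (I : finType) (e : I -> V) :
  (forall v, exists c : I -> K, v = \sum_i c i *: e i) ->
  exists d' (e' : 'I_d' -> V), is_basis e'.
Proof.
move=> sp; apply: (@basis_of_spanning #|I| (fun k => e (enum_val k))) => v.
have [c ->] := sp v; exists (fun k => c (enum_val k)).
by rewrite (reindex (@enum_val I xpredT)) //; apply/onW_bij/enum_val_bij.
Qed.

Lemma basis_matrix d (e : 'I_d -> V) (f : V -> V) : is_basis e ->
  exists M : 'M[K]_d, forall i, f (e i) = \sum_j M i j *: e j.
Proof.
move=> be; have ex i : exists c : 'rV_d, f (e i) = \sum_j c 0 j *: e j.
  by have [c [ec _]] := be (f (e i)); exists c.
have [c cP] := fin_all_exists ex.
exists (\matrix_(i, j) c i 0 j) => i; rewrite cP.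
by apply: eq_bigr => j _; rewrite mxE.
Qed.

Lemma charpolyP (f : V -> V) : (exists d (e : 'I_d -> V), is_basis e) ->
  is_charpoly f (charpoly f).
Proof.
move=> [d [e be]]; have [M eM] := basis_matrix f be.
by apply: (xgetPex 0); exists (char_poly M), d, e, M.
Qed.

Lemma basis_inj d (e : 'I_d -> V) (c c' : 'rV[K]_d) : is_basis e ->
  \sum_i c 0 i *: e i = \sum_i c' 0 i *: e i -> c = c'.
Proof.
move=> be h; have [b [_ u]] := be (\sum_i c 0 i *: e i).
by rewrite -(u c (erefl _)) -(u c' h).
Qed.

End FiniteBasis.

Lemma mpoly_closed_ind n (R : comNzRingType) (P : {mpoly R[n]} -> Prop) :
  (forall c, P c%:MP) -> (forall i, P 'X_i) ->
  (forall p q, P p -> P q -> P (p + q)) ->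
  (forall p q, P p -> P q -> P (p * q)) -> forall p, P p.
Proof.
move=> hC hX hD hM p.
have h1 : P 1 by rewrite -mpolyC1.
have hXn p0 k : P p0 -> P (p0 ^+ k).
  by move=> hp; elim: k => [|k IH]; rewrite ?expr0 // exprS; apply: hM.
rewrite (mpolyE p); apply: big_ind => [||m _]; first by rewrite -(mpolyC0 n R).
  by move=> a b; apply: hD.
rewrite -mul_mpolyC; apply: (hM) => //; rewrite mpolyXE_id.
by apply: big_ind => [//|a b|i _]; [apply: hM|apply: hXn].
Qed.

Section QuotientMatrices.
Variables (K : fieldType) (gs : seq {mpoly K[2]}).
Local Notation A := (quot_alg gs).
Local Notation pi := (qpi gs).
Variables (d : nat) (e : 'I_d -> A).
Hypothesis be : is_basis e.

(** Row convention, as in [is_charpoly]: row i holds the coordinates of the image of e i, so a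
    product of polynomials reverses the matrices. *)
Definition mul_matrix (f : {mpoly K[2]}) (M : 'M[K]_d) : Prop :=
  forall i, pi f * e i = \sum_j M i j *: e j.

Lemma mul_matrix_uniq f g M N : pi f = pi g -> mul_matrix f M -> mul_matrix g N -> M = N.
Proof.
move=> efg hM hN; apply/row_matrixP => i; apply: (basis_inj be).
transitivity (pi f * e i); first by rewrite hM; apply: eq_bigr => j _; rewrite mxE.
by rewrite efg hN; apply: eq_bigr => j _; rewrite mxE.
Qed.

Lemma mul_matrixM f g M N : mul_matrix f M -> mul_matrix g N ->
  mul_matrix (f * g) (N *m M).
Proof.
move=> hM hN i; rewrite rmorphM -mulrA hN mulr_sumr.
transitivity (\sum_j N i j *: (pi f * e j)).
  by apply: eq_bigr => j _; rewrite mulrC -qscaleAl mulrC.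
transitivity (\sum_j \sum_k (N i j * M j k) *: e k).
  by apply: eq_bigr => j _; rewrite hM scaler_sumr; apply: eq_bigr => k _; rewrite scalerA.
rewrite exchange_big /=; apply: eq_bigr => k _.
by rewrite mxE scaler_suml.
Qed.

Lemma mul_matrixD f g M N : mul_matrix f M -> mul_matrix g N ->
  mul_matrix (f + g) (M + N).
Proof.
move=> hM hN i; rewrite rmorphD mulrDl hM hN -big_split /=.
by apply: eq_bigr => j _; rewrite mxE scalerDl.
Qed.

Lemma mul_matrixC c : mul_matrix c%:MP c%:M.
Proof.
move=> i; rewrite (bigD1 i) //= big1 => [|j ne]; last first.
  by rewrite mxE eq_sym (negbTE ne) scale0r.
rewrite mxE eqxx addr0.
have -> : pi c%:MP = c *: pi 1 by rewrite -[c%:MP]mulr1 mul_mpolyC linearZ.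
by rewrite -qscaleAl rmorph1 mul1r.
Qed.

Lemma mul_matrix_comm f g M N : mul_matrix f M -> mul_matrix g N -> comm_mx M N.
Proof.
move=> hM hN; apply: (@mul_matrix_uniq (g * f) (f * g)).
- by rewrite mulrC.
- exact: mul_matrixM.
- exact: mul_matrixM.
Qed.

Lemma mul_matrix_exists f : exists M, mul_matrix f M.
Proof. exact: basis_matrix. Qed.

Variables (L : closedFieldType) (iota : {rmorphism K -> L}).

Definition peval (x y : L) (f : {mpoly K[2]}) : L :=
  mmap iota (fun i => if i == ord0 then x else y) f.

Lemma pevalC x y c : peval x y c%:MP = iota c.
Proof. exact: mmapC. Qed.
Lemma pevalD x y : {morph peval x y : f g / f + g}.
Proof. by move=> f g; rewrite /peval raddfD. Qed.
Lemma pevalB x y : {morph peval x y : f g / f - g}.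
Proof. by move=> f g; rewrite /peval raddfB. Qed.
Lemma pevalN x y : {morph peval x y : f / - f}.
Proof. by move=> f; rewrite /peval raddfN. Qed.
Lemma pevalM x y : {morph peval x y : f g / f * g}.
Proof. by move=> f g; rewrite /peval rmorphM. Qed.
Lemma pevalXU x y i : peval x y 'X_i = if i == ord0 then x else y.
Proof. by rewrite /peval mmapX mmap1U. Qed.
Lemma pevalX x y : peval x y (Defs.mX K) = x.
Proof. by rewrite /Defs.mX pevalXU. Qed.
Lemma pevalY x y : peval x y (Defs.mY K) = y.
Proof. by rewrite /Defs.mY pevalXU. Qed.
Lemma peval1 x y : peval x y 1 = 1.
Proof. by rewrite -mpolyC1 pevalC rmorph1. Qed.
Lemma peval0 x y : peval x y 0 = 0.
Proof. by rewrite -(mpolyC0 2 K) pevalC rmorph0. Qed.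
Lemma pevalXn x y f k : peval x y (f ^+ k) = peval x y f ^+ k.
Proof. by elim: k => [|k IH]; rewrite ?expr0 ?peval1 // !exprS pevalM IH. Qed.

Lemma peval_ideal x y f : (forall g, g \in gs -> peval x y g = 0) ->
  f \in ideal_gen gs -> peval x y f = 0.
Proof.
move=> h /ideal_genP[c ->].
elim/big_ind: _ => [|a b ha hb|i _]; first exact: peval0.
  by rewrite pevalD ha hb addr0.
by rewrite pevalM [X in _ * X]h ?mulr0 //; apply: mem_nth.
Qed.

Lemma peval_eigen x y (Mx My : 'M[K]_d) (v : 'rV[L]_d) :
  mul_matrix (Defs.mX K) Mx -> mul_matrix (Defs.mY K) My ->
  v *m map_mx iota Mx = x *: v -> v *m map_mx iota My = y *: v ->
  forall f M, mul_matrix f M -> v *m map_mx iota M = peval x y f *: v.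
Proof.
move=> hx hy vx vy f.
suff [M hM eM] : exists2 M, mul_matrix f M & v *m map_mx iota M = peval x y f *: v.
  by move=> N hN; rewrite (mul_matrix_uniq (erefl _) hN hM).
elim/mpoly_closed_ind: f => [c|i|f g [M hM eM] [N hN eN]|f g [M hM eM] [N hN eN]].
- exists c%:M; first exact: mul_matrixC.
  by rewrite map_scalar_mx mul_mx_scalar pevalC.
- case: (eqVneq i ord0) => [->|ni].
    by exists Mx => //; rewrite vx pevalX.
  have -> : i = ord_max by case: i ni => -[|[|[]]] // ? ?; apply: val_inj.
  by exists My => //; rewrite vy pevalY.
- by exists (M + N); [exact: mul_matrixD|rewrite map_mxD mulmxDr eM eN pevalD scalerDl].
exists (N *m M); first exact: mul_matrixM.
by rewrite map_mxM mulmxA eN -scalemxAl eM scalerA pevalM mulrC.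
Qed.

(** The matrices of X, Y and u commute, so an eigenvalue of u has an eigenvector common to the
    three; its eigenvalues x, y for X, Y give a zero, as the generators [gs] act by 0. Conversely,
    evaluation at a zero factors through the quotient; its values on the basis form a column
    eigenvector for u(x, y), nonzero since 1 is sent to 1. *)
Lemma root_charpoly_zero u M z : mul_matrix u M ->
  root (map_poly iota (char_poly M)) z <->
  exists x y, (forall g, g \in gs -> peval x y g = 0) /\ z = peval x y u.
Proof.
move=> hM; rewrite map_char_poly; split.
  rewrite -eigenvalue_root_char => ez.
  have [Mx hx] := mul_matrix_exists (Defs.mX K); have [My hy] := mul_matrix_exists (Defs.mY K).
  have cm f g N P : mul_matrix f N -> mul_matrix g P ->
      comm_mx (map_mx iota N) (map_mx iota P).
    by move=> hN hP; rewrite /comm_mx -!map_mxM (mul_matrix_comm hN hP).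
  have [x [y [v [v0 vx vy vz]]]] :=
    common_eigenvector3 ez (cm _ _ _ _ hM hx) (cm _ _ _ _ hM hy) (cm _ _ _ _ hx hy).
  have ev := peval_eigen hx hy vx vy.
  exists x, y; split => [g gg|].
    have [N hN] := mul_matrix_exists g.
    have N0 : N = 0.
      apply: (@mul_matrix_uniq g 0) => //; last first.
        by move=> i; rewrite rmorph0 mul0r big1 // => j _; rewrite mxE scale0r.
      apply/qpiE; rewrite subr0 -(nth_index 0 gg); apply: ideal_gen_mem.
      by rewrite index_mem.
    have := ev g N hN; rewrite N0 map_mx0 mulmx0 => /esym/eqP.
    by rewrite scaler_eq0 (negbTE v0) orbF => /eqP.
  have /eqP := ev u M hM; rewrite vz -subr_eq0 -scalerBl scaler_eq0 (negbTE v0) orbF.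
  by rewrite subr_eq0 => /eqP.
case=> x [y [h ez]].
pose v : 'cV[L]_d := \col_i peval x y (qrepr (e i)).
have pe f g : pi f = pi g -> peval x y f = peval x y g.
  by move/qpiE/(peval_ideal h)/eqP; rewrite pevalB subr_eq0 => /eqP.
have ps (c : 'I_d -> K) :
    peval x y (\sum_j c j *: qrepr (e j)) = \sum_j iota (c j) * v j 0.
  rewrite (big_morph _ (pevalD x y) (peval0 x y)); apply: eq_bigr => j _.
  by rewrite -mul_mpolyC pevalM pevalC mxE.
have pis (c : 'I_d -> K) : pi (\sum_j c j *: qrepr (e j)) = \sum_j c j *: e j.
  rewrite rmorph_sum; apply: eq_bigr => j _.
  by transitivity (qscale (c j) (pi (qrepr (e j)))); rewrite ?qscaleE ?qreprK.
have Mv : map_mx iota M *m v = z *: v.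
  apply/colP => i; rewrite !mxE ez -pevalM.
  rewrite (pe (u * qrepr (e i)) (\sum_j M i j *: qrepr (e j))); last first.
    by rewrite pis rmorphM /= qreprK hM.
  by rewrite ps; apply: eq_bigr => j _; rewrite !mxE.
have v0 : v != 0.
  have [c [c1 _]] := be 1; apply/eqP => v0; move/eqP: (oner_neq0 L); apply.
  rewrite -(peval1 x y) (pe 1 (\sum_j c 0 j *: qrepr (e j))).
    by rewrite ps v0 big1 // => j _; rewrite mxE mulr0.
  by rewrite pis -c1 rmorph1.
have -> : char_poly (map_mx iota M) = char_poly (map_mx iota M)^T.
  rewrite /char_poly -det_tr; congr (\det _).
  by apply/matrixP => i j; rewrite !mxE eq_sym.
rewrite -eigenvalue_root_char; apply/eigenvalueP; exists v^T.
  by rewrite -trmx_mul Mv linearZ.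
by rewrite -(inj_eq trmx_inj) trmxK trmx0.
Qed.

End QuotientMatrices.

(** * Base change of the curve and its division polynomials *)

Section BaseChange.
Variables (K L : fieldType) (iota : {rmorphism K -> L}) (W : weierstrass K).
Local Notation WL := (map_weierstrass iota W).
Local Notation "p ^i" := (map_poly iota p) (at level 2, format "p ^i").

Lemma map_b2 : b2 WL = iota (b2 W).
Proof. by rewrite /b2 /= rmorphD !rmorphM rmorph_nat. Qed.
Lemma map_b4 : b4 WL = iota (b4 W).
Proof. by rewrite /b4 /= rmorphD !rmorphM rmorph_nat. Qed.
Lemma map_b6 : b6 WL = iota (b6 W).
Proof. by rewrite /b6 /= rmorphD !rmorphM rmorph_nat. Qed.
Lemma map_b8 : b8 WL = iota (b8 W).
Proof. by rewrite /b8 /= !(rmorph_nat, rmorphXn, rmorphD, rmorphN, rmorphM). Qed.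

Lemma map_disc : disc WL = iota (disc W).
Proof.
rewrite /disc map_b2 map_b4 map_b6 map_b8.
by rewrite !(rmorph_nat, rmorphXn, rmorphD, rmorphN, rmorphM).
Qed.

Lemma elliptic_map : elliptic W -> elliptic WL.
Proof. by rewrite /elliptic map_disc fmorph_eq0. Qed.

Let map_mono c k : (c *: 'X^k)^i = iota c *: 'X^k.
Proof. by rewrite map_polyZ map_polyXn. Qed.

Lemma map_psi2_sq : (psi2_sq W)^i = psi2_sq WL.
Proof.
rewrite /psi2_sq !(map_b2, map_b4, map_b6, map_b8).
move: (b2 W) (b4 W) (b6 W) (b8 W) => B2 B4 B6 B8.
rewrite -['X]expr1 !rmorphD /= !map_mono map_polyC /=.
by rewrite !(rmorph_nat iota, rmorphM iota).
Qed.

Lemma map_psi3 : (psi3 W)^i = psi3 WL.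
Proof.
rewrite /psi3 !(map_b2, map_b4, map_b6, map_b8).
move: (b2 W) (b4 W) (b6 W) (b8 W) => B2 B4 B6 B8.
rewrite -['X]expr1 !rmorphD /= !map_mono map_polyC /=.
by rewrite !(rmorph_nat iota, rmorphM iota).
Qed.

Lemma map_psi4_red : (psi4_red W)^i = psi4_red WL.
Proof.
rewrite /psi4_red !(map_b2, map_b4, map_b6, map_b8).
move: (b2 W) (b4 W) (b6 W) (b8 W) => B2 B4 B6 B8.
rewrite -['X]expr1 !rmorphD /= !map_mono map_polyC /=.
rewrite !(rmorph_nat iota, rmorphXn iota, rmorphB iota, rmorphM iota).
by rewrite map_polyC /= (rmorphN iota) (rmorphXn iota).
Qed.

Lemma map_divpolyX n : (divpolyX W n)^i = divpolyX WL n.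
Proof.
elim/ltn_ind: n => -[|[|[|[|[|n]]]]] IH.
- by rewrite rmorph0.
- by rewrite rmorph1.
- by rewrite rmorph1.
- exact: map_psi3.
- exact: map_psi4_red.
set k := n.+1.+4 in IH *; have k5 : (4 < k)%N by [].
clearbody k; have := odd_double_half k; set m := k./2.
case: (boolP (odd k)) => ok e; rewrite -e ?add1n ?add0n.
  rewrite !divpolyX_odd; try lia.
  rewrite rmorphB !(rmorphM, rmorphXn) /= !IH; try lia.
  by case: (odd m); rewrite /= ?rmorphXn /= ?rmorph1 ?map_psi2_sq.
rewrite !divpolyX_even; try lia.
by rewrite rmorphM rmorphB !(rmorphM, rmorphXn) /= !IH; try lia.
Qed.

Lemma map_primdivX n : (0 < n)%N -> (primdivX W n)^i = primdivX WL n.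
Proof.
elim/ltn_ind: n => n IH n0; rewrite !primdivXE // map_divp map_divpolyX rmorph_prod.
congr (_ %/ _); rewrite big_nat_cond [RHS]big_nat_cond; apply: eq_bigr => d dn.
by case/andP: dn => /andP[d0 dn] _; rewrite /= IH.
Qed.

End BaseChange.

Section PolyXIn.
Variables (K : fieldType).

Lemma polyX_inX : polyX_in 'X = Defs.mX K.
Proof. by rewrite /polyX_in map_polyX hornerX. Qed.

Lemma polyX_in0 : polyX_in (0 : {poly K}) = 0.
Proof. by rewrite /polyX_in rmorph0 horner0. Qed.

End PolyXIn.

(** * The roots of chi_{u,n} as values of u at the points of exact order n *)

Section RootsChi.
Variables (K : fieldType) (L : closedFieldType) (iota : {rmorphism K -> L}).
Variables (W : weierstrass K) (ellW : elliptic W).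
Hypothesis char0 : forall n, n.+1%:R != 0 :> L.
Local Notation WL := (map_weierstrass iota W).
Local Notation ell := (elliptic_map iota ellW).
Local Notation ev := (peval iota).

Lemma peval_polyX_in x y p : ev x y (polyX_in p) = (map_poly iota p).[x].
Proof.
have [pD _ pM _ pC] := polyX_in_morph K.
elim/poly_ind: p => [|p c IH]; first by rewrite polyX_in0 peval0 rmorph0 horner0.
rewrite pD pM pC polyX_inX pevalD pevalM IH pevalX pevalC.
by rewrite rmorphD rmorphM /= map_polyX map_polyC hornerD hornerM hornerX hornerC.
Qed.

Lemma peval_nat x y n : ev x y n%:R = n%:R.
Proof. by rewrite -mpolyC_nat pevalC rmorph_nat. Qed.

Lemma peval_psi2 x y : ev x y (psi2 W) = ytwo WL x y.
Proof.
by rewrite /psi2 !(pevalD, pevalM, pevalC, peval_nat, pevalX, pevalY).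
Qed.

Lemma peval_w x y : (ev x y (w_poly W) == 0) = on_curve WL (Some (x, y)).
Proof.
rewrite /w_poly !(pevalD, pevalB, pevalN, pevalM, pevalXn, pevalC, pevalX, pevalY) /=.
by rewrite -[RHS]subr_eq0; congr (_ == _); ring.
Qed.

Lemma zero_locus n x y : (0 < n)%N ->
  (forall g, g \in [:: primdivpoly W n; w_poly W] -> ev x y g = 0) <->
  exists Q : curve_pt ell, [/\ Q != 0, exact_order n Q & (x, y) = (xc Q, yc Q)].
Proof.
move=> n0.
have prim (Q : curve_pt ell) : Q != 0 ->
    (ev (xc Q) (yc Q) (primdivpoly W n) == 0) = exact_order n Q.
  move=> Q0; rewrite /primdivpoly; case: (eqVneq n 2%N) => [->|n2].
    rewrite peval_psi2 -/(yt Q) yt_eq0 //; apply/idP/exact_orderP => [/eqP e|[_ -> _]//].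
    by split=> // -[|[|j]]; rewrite ?mulr1n.
  by rewrite peval_polyX_in map_primdivX // -(root_primdivX char0).
split=> [h|[Q [Q0 oQ [-> ->]]] g].
  have hw : on_curve WL (Some (x, y)) by rewrite -peval_w h // !inE eqxx orbT.
  pose Q := CurvePt ell hw; have Q0 : Q != 0 by [].
  by exists Q; split=> //; rewrite -prim // h // !inE eqxx.
rewrite !inE => /orP[] /eqP ->; apply/eqP; first by rewrite prim.
by rewrite peval_w -valE // pt_on.
Qed.

Section Spanning.
Variables (n : nat) (n0 : (0 < n)%N).
Local Notation gs := [:: primdivpoly W n; w_poly W].
Local Notation pi := (qpi gs).

Lemma primdivX_neq0 : primdivX W n != 0.
Proof.
have [h _ _] := mup_primdivX ell char0 n0; move: h.
by rewrite -map_primdivX // map_poly_eq0.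
Qed.

Lemma psi2_sq_neq0_base : psi2_sq W != 0.
Proof.
have := psi2_sq_neq0 WL char0.
by rewrite -map_psi2_sq map_poly_eq0.
Qed.

Lemma pi_gen g : g \in gs -> pi g = 0.
Proof.
move=> gg; rewrite -(rmorph0 pi); apply/qpiE; rewrite subr0 -(nth_index 0 gg).
by apply: ideal_gen_mem; rewrite index_mem.
Qed.

(** A nonzero polynomial in x alone that dies in A bounds the powers of x, which [quot_basis] needs.
    For n = 2 the generator involves y, and its square is [psi2_sq] modulo w_E. *)
Lemma annihilator : exists2 q : {poly K}, q != 0 & pi (polyX_in q) = 0.
Proof.
have pw : pi (w_poly W) = 0 by apply: pi_gen; rewrite !inE eqxx orbT.
have pp : pi (primdivpoly W n) = 0 by apply: pi_gen; rewrite !inE eqxx.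
case: (eqVneq n 2%N) => [e2|n2]; last first.
  exists (primdivX W n); first exact: primdivX_neq0.
  by move: pp; rewrite /primdivpoly (negbTE n2).
exists (psi2_sq W); first exact: psi2_sq_neq0_base.
have -> : polyX_in (psi2_sq W) = psi2 W ^+ 2 - 4 * w_poly W.
  by rewrite psi2_sqE addrK.
have e : primdivpoly W n = psi2 W by rewrite /primdivpoly e2 eqxx.
by rewrite rmorphB rmorphXn rmorphM /= pw -[X in pi X ^+ _]e pp expr0n mulr0 subr0.
Qed.

Lemma coord_normal_form f : exists a b : {poly K},
  pi f = pi (polyX_in a + polyX_in b * Defs.mY K).
Proof.
have [pD pB pM p1 pC] := polyX_in_morph K.
have pw : pi (w_poly W) = 0 by apply: pi_gen; rewrite !inE eqxx orbT.
elim/mpoly_closed_ind: f => [c|i|f g [a [b eab]] [c [d ecd]]|f g [a [b eab]] [c [d ecd]]].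
- by exists c%:P, 0; rewrite pC polyX_in0 mul0r addr0.
- case: (eqVneq i ord0) => [->|ni].
    by exists 'X, 0; rewrite polyX_inX polyX_in0 mul0r addr0.
  have -> : i = ord_max by case: i ni => -[|[|[]]] // ? ?; apply: val_inj.
  by exists 0, 1; rewrite polyX_in0 p1 mul1r add0r.
- by exists (a + c), (b + d); rewrite rmorphD /= eab ecd -rmorphD !pD; congr (pi _); ring.
pose r := 'X * 'X * 'X + (a2 W)%:P * 'X * 'X + (a4 W)%:P * 'X + (a6 W)%:P.
pose s := (a1 W)%:P * 'X + (a3 W)%:P.
exists (a * c + b * d * r), (a * d + b * c - b * d * s).
rewrite rmorphM /= eab ecd -rmorphM.
set lhs := (_ + _) * (_ + _); set rhs := polyX_in _ + _.
have -> : lhs = rhs + polyX_in (b * d) * w_poly W.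
  rewrite /lhs /rhs /r /s !(pB, pD, pM, pC) polyX_inX /w_poly.
  by ring.
by rewrite rmorphD rmorphM /= pw mulr0 addr0.
Qed.

Lemma quot_basis : exists d (e : 'I_d -> quot_alg gs), is_basis e.
Proof.
have [pD pB pM p1 pC] := polyX_in_morph K.
have [q q0 pq] := annihilator.
pose s := size q; pose e (k : 'I_s * bool) : quot_alg gs :=
  pi (Defs.mX K ^+ k.1 * (if k.2 then Defs.mY K else 1)).
apply: (@basis_of_spanning_fin _ _ _ e) => v.
have red a : pi (polyX_in a) = pi (polyX_in (a %% q)).
  by rewrite {1}(divp_eq a q) pD pM rmorphD rmorphM /= pq mulr0 add0r.
have ex a : polyX_in (a %% q) = \sum_(i < s) (a %% q)`_i *: Defs.mX K ^+ i.
  have sb : (size (a %% q)%R <= s)%N by apply: ltnW; rewrite ltn_modp.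
  rewrite /polyX_in (horner_coef_wide (n := s)); last exact: leq_trans (size_poly _ _) sb.
  by apply: eq_bigr => i _; rewrite coef_map /= mul_mpolyC.
have [a [b eab]] := coord_normal_form (qrepr v).
exists (fun k : 'I_s * bool => if k.2 then (b %% q)`_k.1 else (a %% q)`_k.1).
rewrite -[LHS]qreprK eab.
transitivity (pi (polyX_in (a %% q) + polyX_in (b %% q) * Defs.mY K)).
  by rewrite !rmorphD !rmorphM /= -!red.
rewrite -(pair_bigA _ (fun (i : 'I_s) (j : bool) =>
   (if j then (b %% q)`_i else (a %% q)`_i) *: e (i, j))) /=.
rewrite !ex mulr_suml -big_split rmorph_sum; apply: eq_bigr => i _.
rewrite big_bool /= rmorphD addrC /e /= mulr1.
have sc k x : k *: pi x = pi (k *: x) by rewrite -[RHS]qscaleE.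
by rewrite !sc scalerAl.
Qed.

Lemma root_chi_poly u z : root (map_poly iota (chi_poly W u n)) z <->
  exists Q : curve_pt ell, [/\ Q != 0, exact_order n Q & z = ev (xc Q) (yc Q) u].
Proof.
rewrite /chi_poly; have [d [e [M [be hM ->]]]] := charpolyP (fun v => pi u * v) quot_basis.
rewrite (root_charpoly_zero be iota z hM); split.
  case=> x [y [h ->]]; have [Q [Q0 oQ [ex ey]]] := proj1 (zero_locus x y n0) h.
  by exists Q; rewrite ex ey.
case=> Q [Q0 oQ ->]; exists (xc Q), (yc Q); split=> //.
by apply/(zero_locus _ _ n0); exists Q.
Qed.

End Spanning.
End RootsChi.

(** * Extension of automorphisms *)

Section Extension.
Variables (K : fieldType) (L : closedFieldType) (iota : {rmorphism K -> L}).
Hypothesis alg : forall z : L, algebraicOver iota z.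

(* The graph of a partial ring morphism over K, defined on a subring. *)
Record partial_morph (G : set (L * L)) : Prop := PartialMorph {
  pmI : forall a, G (iota a, iota a);
  pmB : forall a a' b b', G (a, a') -> G (b, b') -> G (a - b, a' - b');
  pmM : forall a a' b b', G (a, a') -> G (b, b') -> G (a * b, a' * b');
  pm0 : forall b, G (0, b) -> b = 0 }.

Section Theory.
Variables (G : set (L * L)) (pG : partial_morph G).

Lemma pm1 : G (1, 1).
Proof. by have := pmI pG 1; rewrite rmorph1. Qed.

Lemma pm00 : G (0, 0).
Proof. by have := pmI pG 0; rewrite rmorph0. Qed.

Lemma pmN a a' : G (a, a') -> G (- a, - a').
Proof. by move=> h; rewrite -sub0r -[- a']sub0r; apply: pmB pm00 h. Qed.

Lemma pmD a a' b b' : G (a, a') -> G (b, b') -> G (a + b, a' + b').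
Proof.
move=> h h2; rewrite -[b]opprK -[b']opprK; apply: (pmB pG) h _; exact: pmN.
Qed.

Lemma pm_fun a b c : G (a, b) -> G (a, c) -> b = c.
Proof.
by move=> h h'; apply/subr0_eq/(pm0 pG); rewrite -(subrr a); apply: (pmB pG).
Qed.

Lemma pm_sum I (r : seq I) (P : pred I) (f g : I -> L) :
  (forall i, P i -> G (f i, g i)) ->
  G (\sum_(i <- r | P i) f i, \sum_(i <- r | P i) g i).
Proof.
move=> h; apply: (big_ind2 (fun x y => G (x, y))) => //; first exact: pm00.
by move=> *; apply: pmD.
Qed.

Lemma pmX a a' n : G (a, a') -> G (a ^+ n, a' ^+ n).
Proof.
move=> h; elim: n => [|n IH]; first by rewrite !expr0; apply: pm1.
by rewrite !exprS; apply: (pmM pG).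
Qed.

Definition pm_poly (p q : {poly L}) := forall i, G (p`_i, q`_i).

Lemma pm_polyB p p' q q' : pm_poly p p' -> pm_poly q q' -> pm_poly (p - q) (p' - q').
Proof. by move=> h h' i; rewrite !coefB; apply: (pmB pG). Qed.

Lemma pm_polyM p p' q q' : pm_poly p p' -> pm_poly q q' -> pm_poly (p * q) (p' * q').
Proof.
by move=> h h' i; rewrite !coefM; apply: pm_sum => j _; apply: (pmM pG).
Qed.

Lemma pm_polyC a a' : G (a, a') -> pm_poly a%:P a'%:P.
Proof. by move=> h i; rewrite !coefC; case: ifP => _ //; apply: pm00. Qed.

Lemma pm_polyXn n : pm_poly 'X^n 'X^n.
Proof. by move=> i; rewrite !coefXn; case: eqP => _; [apply: pm1|apply: pm00]. Qed.

Lemma pm_poly_base p : pm_poly (map_poly iota p) (map_poly iota p).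
Proof. by move=> i; rewrite coef_map; apply: (pmI pG). Qed.

Lemma pm_horner p p' a a' : pm_poly p p' -> G (a, a') -> G (p.[a], p'.[a']).
Proof.
move=> h ga; pose n := maxn (size p) (size p').
rewrite (@horner_coef_wide _ n p) ?leq_maxl // (@horner_coef_wide _ n p') ?leq_maxr //.
by apply: pm_sum => i _; apply: (pmM pG) => //; apply: pmX.
Qed.

(** The inverse of an algebraic element is a polynomial in it, read off a polynomial relation with
    nonzero constant term. Hence a partial morphism respects inverses, and [pm_extend] may adjoin
    polynomials in z only. *)
Lemma alg_inv a : a != 0 -> exists r : {poly K}, a * (map_poly iota r).[a] = 1.
Proof.
move=> a0; have [p p0 rp] := alg a.
have [n] := ubnP (size p); elim: n p p0 rp => // n IH p p0 rp sp.
have [q [c ep]] : exists q c, p = q * 'X + c%:P.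
  by exists (p %/ 'X), (p.[0]); rewrite {1}(divp_eq p 'X) -['X]subr0 modp_XsubC.
case: (eqVneq c 0) => [c0|c0].
  rewrite c0 addr0 in ep; have q0 : q != 0 by apply: contraNneq p0 => z; rewrite ep z mul0r.
  apply: (IH q q0); last by move: sp; rewrite ep size_mulX.
  move: rp; rewrite ep /root rmorphM /= map_polyX hornerM hornerX mulf_eq0.
  by rewrite (negbTE a0) orbF.
exists (- (c^-1) *: q); rewrite map_polyZ hornerZ.
have : iota c != 0 by rewrite fmorph_eq0.
move: rp; rewrite /root ep rmorphD rmorphM /= map_polyX map_polyC hornerD hornerM.
rewrite hornerX hornerC addr_eq0 => /eqP e ic; rewrite mulrCA [a * _]mulrC e.
by rewrite rmorphN fmorphV mulrNN mulVf.
Qed.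

Lemma pmV a a' : G (a, a') -> a != 0 -> a' != 0 /\ G (a^-1, a'^-1).
Proof.
move=> h a0; have [r er] := alg_inv a0.
have hr := pm_horner (pm_poly_base r) h.
have e' : a' * (map_poly iota r).[a'] = 1.
  have := pmM pG h hr; rewrite er => h1; exact: pm_fun h1 pm1.
have a'0 : a' != 0.
  by apply/eqP => z; move/eqP: e'; rewrite z mul0r eq_sym oner_eq0.
split=> //; have -> : a^-1 = (map_poly iota r).[a] by rewrite -[RHS](mulKf a0) er mulr1.
by have -> : a'^-1 = (map_poly iota r).[a'] by rewrite -[RHS](mulKf a'0) e' mulr1.
Qed.

Lemma pm_poly_size p p' : pm_poly p p' -> size p = size p'.
Proof.
move=> h; apply/eqP; rewrite eqn_leq; apply/andP; split; last first.
  by apply/leq_sizeP => j jp; have := h j; rewrite (nth_default 0 jp) => /(pm0 pG).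
apply/leq_sizeP => j jp; apply/eqP; apply: contraT => nz.
by have [] := pmV (h j) nz; rewrite (nth_default 0 jp) eqxx.
Qed.

Variable z : L.

Lemma pm_minimal : exists p p', [/\ pm_poly p p', p != 0, p.[z] = 0 &
  forall q q', pm_poly q q' -> q != 0 -> q.[z] = 0 -> (size p <= size q)%N].
Proof.
have ex : exists n, `[< exists p p', [/\ pm_poly p p', p != 0, p.[z] = 0 & size p = n] >].
  have [p p0 rp] := alg z; exists (size (map_poly iota p)); apply/asboolP.
  exists (map_poly iota p), (map_poly iota p); split=> //.
  - exact: pm_poly_base.
  - by rewrite map_poly_eq0.
  - exact/eqP.
case: (ex_minnP ex) => n /asboolP[p [p' [h p0 pz sp]]] mn.
exists p, p'; split=> // q q' hq q0 qz; rewrite sp; apply: mn; apply/asboolP.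
by exists q, q'.
Qed.

(** z is sent to a root z' of the image p' of a minimal polynomial p of z. That q(z) depends only on
    its value, not on q, is [key]. *)
Lemma pm_extend : exists G', [/\ partial_morph G', (G `<=` G')%classic &
  exists z', G' (z, z')].
Proof.
have [p [p' [h p0 pz mn]]] := pm_minimal.
have /closed_rootP[z' /eqP rz'] : size p' != 1%N.
  rewrite -(pm_poly_size h); apply/negP => /size_poly1P[c c0 e].
  by move: pz; rewrite e hornerC => /eqP; rewrite (negbTE c0).
have lp : lead_coef p != 0 by rewrite lead_coef_eq0.
have glp : G (lead_coef p, lead_coef p').
  by rewrite !lead_coefE -(pm_poly_size h); apply: h.
have [lp' gV] := pmV glp lp.
(* Long division by p: subtracting the multiple [m * p] removes the leading term of q and leaves
   both values unchanged. *)
have key q q' : pm_poly q q' -> q.[z] = 0 -> q'.[z'] = 0.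
  have [n] := ubnP (size q); elim: n q q' => // n IH q q' sq hq qz.
  have [q0|q0] := eqVneq q 0.
    have : size q' = 0%N by rewrite -(pm_poly_size hq) q0 size_poly0.
    by move/eqP; rewrite size_poly_eq0 => /eqP ->; rewrite horner0.
  have spq := mn q q' hq q0 qz.
  pose k := (size q - size p)%N.
  pose m := (lead_coef q / lead_coef p)%:P * 'X^k.
  pose m' := (lead_coef q' / lead_coef p')%:P * 'X^k.
  have glq : G (lead_coef q, lead_coef q').
    by rewrite !lead_coefE -(pm_poly_size hq); apply: hq.
  have hm : pm_poly m m'.
    apply: pm_polyM (pm_polyXn k); apply: pm_polyC; exact: (pmM pG).
  have hr := pm_polyB hq (pm_polyM hm h).
  have ez : (q - m * p).[z] = 0 by rewrite hornerD hornerN hornerM qz pz mulr0 subr0.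
  have e' : (q' - m' * p').[z'] = q'.[z'].
    by rewrite hornerD hornerN hornerM rz' mulr0 subr0.
  rewrite -e'; apply: IH hr ez; rewrite ltnS in sq; apply: leq_trans sq.
  have sp0 : (0 < size p)%N by rewrite size_poly_gt0.
  have sm : size (m * p) = size q.
    rewrite /m -mulrA size_Cmul; last by rewrite mulf_neq0 ?invr_neq0 ?lead_coef_eq0.
    by rewrite mulrC size_mulXn // /k subnK.
  have sq1 : (size q = (size q).-1.+1)%N by rewrite prednK // size_poly_gt0.
  rewrite [X in (_ < X)%N]sq1 ltnS; apply/leq_sizeP => j; rewrite leq_eqVlt coefB.
  case/predU1P => [<-|jq]; last first.
    by rewrite !nth_default ?subr0 // ?sm; move: jq; rewrite -sq1.
  have -> : (m * p)`_(size q).-1 = lead_coef (m * p) by rewrite lead_coefE sm.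
  rewrite /m !lead_coefM lead_coefXn mulr1 lead_coefC divfK //.
  by rewrite -lead_coefE subrr.
pose G' : set (L * L) := fun w => exists q q', pm_poly q q' /\ w = (q.[z], q'.[z']).
have sub a a' : G (a, a') -> G' (a, a').
  by move=> ga; exists a%:P, a'%:P; split; [exact: pm_polyC|rewrite !hornerC].
exists G'; split; last 2 first.
- by move=> [a a']; apply: sub.
- by exists z', 'X, 'X; split; [apply: (pm_polyXn 1)|rewrite !hornerX].
split.
- by move=> a; apply/sub/(pmI pG).
- move=> a a' b b' [q [q' [hq [-> ->]]]] [r [r' [hr [-> ->]]]].
  exists (q - r), (q' - r'); split; first exact: pm_polyB.
  by rewrite !(hornerD, hornerN).
- move=> a a' b b' [q [q' [hq [-> ->]]]] [r [r' [hr [-> ->]]]].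
  exists (q * r), (q' * r'); split; first exact: pm_polyM.
  by rewrite !hornerM.
by move=> b [q [q' [hq [e ->]]]]; apply: key hq _.
Qed.

End Theory.

Lemma pm_total_extension (G0 : set (L * L)) : partial_morph G0 ->
  exists G, [/\ partial_morph G, (G0 `<=` G)%classic & forall z, exists z', G (z, z')].
Proof.
move=> pG0; pose P (G : set (L * L)) := G = set0 \/ (partial_morph G /\ (G0 `<=` G)%classic).
have [F FP tF|A [PA mA]] := @Zorn_bigcup _ P.
  have [[G [FG G0n]]|no] := pselect (exists G, F G /\ G <> set0); last first.
    left; rewrite -subset0 => w [G FG Gw]; apply: no; exists G; split=> // e.
    by rewrite e in Gw.
  have good H : F H -> H <> set0 -> partial_morph H /\ (G0 `<=` H)%classic.
    by move=> FH; case: (FP H FH).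
  have [pG sG] := good G FG G0n.
  have join p q : (\bigcup_(X in F) X)%classic p -> (\bigcup_(X in F) X)%classic q ->
      exists H, [/\ F H, partial_morph H, H p & H q].
    move=> [X FX Xp] [Y FY Yq].
    have nz (H : set (L * L)) w : H w -> H <> set0 by move=> Hw e; rewrite e in Hw.
    case: (tF X Y FX FY) => s.
      by exists Y; split=> //; [case: (good Y FY (nz Y q Yq))|apply: s].
    by exists X; split=> //; [case: (good X FX (nz X p Xp))|apply: s].
  right; split; last by move=> w /sG Gw; exists G.
  split.
  - by move=> a; exists G => //; apply: (pmI pG).
  - move=> a a' b b' ha hb; have [H [FH pH Ha Hb]] := join _ _ ha hb.
    by exists H => //; apply: (pmB pH).
  - move=> a a' b b' ha hb; have [H [FH pH Ha Hb]] := join _ _ ha hb.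
    by exists H => //; apply: (pmM pH).
  by move=> b hb; have [H [FH pH Hb _]] := join _ _ hb hb; apply: (pm0 pH).
have [pA sA] : partial_morph A /\ (G0 `<=` A)%classic.
  case: PA => // e; exfalso; apply: (mA G0); last by right; split=> // ?.
  rewrite e properEneq; split; last by [].
  by apply/eqP => e0; have := pmI pG0 0; rewrite -e0.
exists A; split=> // z; have [G' [pG' sG' [z' hz']]] := pm_extend pA z.
exists z'; suff -> : A = G' by [].
apply: contrapT => ne; apply: (mA G'); first by rewrite properEneq; split=> //; apply/eqP.
by right; split=> //; apply: subset_trans sA sG'.
Qed.

(** t is injective and maps the finite set of roots of a polynomial over K into itself, hence onto
    itself; every element of L is such a root. *)
Lemma alg_inj_surj (t : L -> L) : zmod_morphism t -> monoid_morphism t ->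
  (forall a, t (iota a) = iota a) -> bijective t.
Proof.
move=> tB tM tI.
pose tA := GRing.isZmodMorphism.Build L L t tB.
pose tR := GRing.isMonoidMorphism.Build L L t tM.
pose T : {rmorphism L -> L} := HB.pack t tA tR.
have tinj : injective t by exact: (fmorph_inj T).
have tsurj w : exists z, t z = w.
  have [p p0 rp] := alg w.
  have [r er] := closed_field_poly_normal (map_poly iota p).
  have lp : lead_coef (map_poly iota p) != 0 by rewrite lead_coef_eq0 map_poly_eq0.
  have rootE x : root (map_poly iota p) x = (x \in undup r).
    by rewrite er rootZ // root_prod_XsubC mem_undup.
  have sub x : x \in map t (undup r) -> x \in undup r.
    case/mapP => y; rewrite -!rootE => ry ->.
    have -> : map_poly iota p = map_poly T (map_poly iota p).
      by rewrite -map_poly_comp; apply: eq_map_poly => a /=; rewrite tI.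
    by rewrite -[t y]/(T y) fmorph_root.
  have ul : uniq (map t (undup r)) by rewrite map_inj_uniq ?undup_uniq.
  have sl : (size (undup r) <= size (map t (undup r)))%N by rewrite size_map.
  have : w \in map t (undup r) by rewrite (uniq_min_size ul sub sl).2 -rootE.
  by case/mapP => z _ ->; exists z.
have [g gP] := boolp.choice tsurj.
by exists g => [x|x]; [apply: tinj|]; rewrite gP.
Qed.

Lemma gal_extend (S : set L) (s : adjoined iota S -> adjoined iota S) :
  gal_over (adjoined_in iota S) s ->
  exists t, gal_over iota t /\ forall a : adjoined iota S, t (val a) = val (s a).
Proof.
move=> /gal_overP[sB [s1 sM] sbij sK].
pose G0 : set (L * L) := fun w => exists a, w = (val a, val (s a)).
have s0 : s 0 = 0 by have := sB 0 0; rewrite !subrr.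
have pG0 : partial_morph G0.
  split.
  - by move=> a; exists (adjoined_in iota S a); rewrite sK.
  - move=> a a' b b' [c [-> ->]] [d [-> ->]]; exists (c - d).
    by rewrite sB !rmorphB.
  - move=> a a' b b' [c [-> ->]] [d [-> ->]]; exists (c * d).
    by rewrite sM !rmorphM.
  move=> b [a [e ->]]; have -> : a = 0 by apply: val_inj; rewrite rmorph0 /= -e.
  by rewrite s0; apply: (rmorph0 (val : adjoined iota S -> L)).
have [G [pG sG tot]] := pm_total_extension pG0.
have [t tP] := boolp.choice tot.
have tE a a' : G (a, a') -> t a = a' by move=> h; apply: pm_fun (tP a) h.
have tB : zmod_morphism t by move=> a b; apply: tE; apply: (pmB pG).
have tM : monoid_morphism t.
  split=> [|a b]; apply: tE; [exact: pm1|exact: (pmM pG)].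
have tI a : t (iota a) = iota a by apply: tE; apply: (pmI pG).
exists t; split; last by move=> a; apply/tE/sG; exists a.
by split=> //; apply: alg_inj_surj.
Qed.

End Extension.

(** * Generated subfields and the Galois action *)

Section AdjoinTheory.
Variables (K L : fieldType) (iota : {rmorphism K -> L}).

Lemma adjoin_sub (S S' : set L) : (forall x, S x -> x \in adjoin iota S') ->
  forall z, z \in adjoin iota S -> z \in adjoin iota S'.
Proof.
move=> h z /adjoinP; apply=> //; first exact: adjoin_divring.
by move=> a; apply: adjoin_base.
Qed.

Lemma ext_isom_adjoin (S S' : set L) : adjoin iota S =i adjoin iota S' ->
  ext_isom (adjoined_in iota S) (adjoined_in iota S').
Proof.
move=> e; have sub (a : adjoined iota S) : val a \in adjoin iota S'.
  by rewrite -e; apply: valP.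
have sub' (a : adjoined iota S') : val a \in adjoin iota S.
  by rewrite e; apply: valP.
pose f a : adjoined iota S' := Adjoined (sub a).
have fB : zmod_morphism f by move=> a b; apply: val_inj.
have fM : monoid_morphism f by split=> [|a b]; apply: val_inj.
pose fA := GRing.isZmodMorphism.Build _ _ f fB.
pose fR := GRing.isMonoidMorphism.Build _ _ f fM.
pose T : {rmorphism adjoined iota S -> adjoined iota S'} := HB.pack f fA fR.
exists T; split; last by move=> a; apply: val_inj.
by exists (fun a => Adjoined (sub' a)) => a; apply: val_inj.
Qed.

Lemma gal_inv (s : L -> L) : gal_over iota s ->
  exists2 r, gal_over iota r & cancel s r /\ cancel r s.
Proof.
move=> /gal_overP[sB [s1 sM] [r sr rs] sK]; exists r => //; split.
- by move=> a b; apply: (can_inj sr); rewrite sB !rs.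
- by split=> [|a b]; apply: (can_inj sr); rewrite ?sM !rs ?s1.
- by exists s.
by move=> a; rewrite -{1}(sK a) sr.
Qed.

Lemma gal_agree (S : set L) (s t : L -> L) : gal_over iota s -> gal_over iota t ->
  (forall x, S x -> s x = t x) -> forall z, z \in adjoin iota S -> s z = t z.
Proof.
move=> /gal_overP[sB sM _ sK] /gal_overP[tB tM _ tK] h z.
pose sA := GRing.isZmodMorphism.Build L L s sB.
pose sR := GRing.isMonoidMorphism.Build L L s sM.
pose s' : {rmorphism L -> L} := HB.pack s sA sR.
pose tA := GRing.isZmodMorphism.Build L L t tB.
pose tR := GRing.isMonoidMorphism.Build L L t tM.
pose t' : {rmorphism L -> L} := HB.pack t tA tR.
move=> /adjoinP /(_ [pred x | s x == t x]) H; apply/eqP; apply: H.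
- split=> [|x y /eqP ex /eqP ey|x y /eqP ex /eqP ey]; apply/eqP.
  + by rewrite -[s 1]/(s' 1) -[t 1]/(t' 1) !rmorph1.
  + by rewrite sB tB ex ey.
  by rewrite -[s _]/(s' _) -[t _]/(t' _) !fmorph_div /= ex ey.
- by move=> a; apply/eqP; rewrite sK tK.
by move=> x Sx; apply/eqP/h.
Qed.

Lemma gal_stable (S : set L) (s : L -> L) : gal_over iota s ->
  (forall x, S x -> S (s x)) ->
  forall z, z \in adjoin iota S -> s z \in adjoin iota S.
Proof.
move=> /gal_overP[sB sM _ sK] h z.
pose sA := GRing.isZmodMorphism.Build L L s sB.
pose sR := GRing.isMonoidMorphism.Build L L s sM.
pose s' : {rmorphism L -> L} := HB.pack s sA sR.
move=> /adjoinP /(_ [pred x | s x \in adjoin iota S]) H; apply: H.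
- split=> [|x y ex ey|x y ex ey].
  + suff: s 1 \in adjoin iota S by [].
    by rewrite -[s 1]/(s' 1) rmorph1 rpred1.
  + suff: s (x - y) \in adjoin iota S by [].
    by rewrite sB rpredB.
  suff: s (x / y) \in adjoin iota S by [].
  by rewrite -[s _]/(s' _) fmorph_div rpred_div.
- by move=> a; suff: s (iota a) \in adjoin iota S; [|rewrite sK adjoin_base].
by move=> x Sx; apply/adjoin_gen/h.
Qed.

Lemma gal_roots (p : {poly K}) (s : L -> L) : gal_over iota s ->
  forall z, roots_of iota p z -> roots_of iota p (s z).
Proof.
move=> /gal_overP[sB sM _ sK] z; rewrite /roots_of /= => rz.
pose sA := GRing.isZmodMorphism.Build L L s sB.
pose sR := GRing.isMonoidMorphism.Build L L s sM.
pose s' : {rmorphism L -> L} := HB.pack s sA sR.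
have -> : map_poly iota p = map_poly s' (map_poly iota p).
  by rewrite -map_poly_comp; apply: eq_map_poly => a /=; rewrite sK.
by rewrite -[s z]/(s' z) fmorph_root.
Qed.

Section Coordinates.
Variables (W : weierstrass L) (S : set L).
Hypothesis WS : [/\ a1 W \in adjoin iota S, a2 W \in adjoin iota S,
  a3 W \in adjoin iota S & a4 W \in adjoin iota S].
Local Notation A := (adjoin iota S).

Definition coords_in (P : option (L * L)) : bool :=
  if P is Some (x, y) then (x \in A) && (y \in A) else true.

Lemma coords_in_neg P : coords_in P -> coords_in (pt_neg W P).
Proof.
case: WS => h1 h2 h3 h4; case: P => [[x y]|] //= /andP[hx hy].
by rewrite hx !(rpredB, rpredN, rpredM).
Qed.

Lemma coords_in_add P Q : coords_in P -> coords_in Q -> coords_in (pt_add W P Q).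
Proof.
case: WS => h1 h2 h3 h4.
case: P Q => [[x y]|] [[x' y']|] // /andP[hx hy] /andP[hx' hy'].
rewrite /pt_add; case: ifP => // _; set l := (if _ then _ else _).
have hl : l \in A.
  rewrite /l; case: ifP => _; rewrite rpred_div //;
  by do ![assumption|apply: rpred_nat|apply: rpredB|apply: rpredD|apply: rpredX|apply: rpredM].
have h3' : l ^+ 2 + a1 W * l - a2 W - x - x' \in A.
  by rewrite !rpredB // rpredD // ?rpredX // rpredM.
by apply: coords_in_neg; rewrite /= h3' rpredD // rpredM // rpredB.
Qed.

End Coordinates.
End AdjoinTheory.

(** * Coordinates of a point from the values of u at it and its opposite *)

Section Peval.
Variables (K : fieldType) (L : closedFieldType) (iota : {rmorphism K -> L}).

Lemma peval_in (S : set L) x y f : x \in adjoin iota S -> y \in adjoin iota S ->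
  peval iota x y f \in adjoin iota S.
Proof.
move=> hx hy; elim/mpoly_closed_ind: f => [c|i|f g hf hg|f g hf hg].
- by rewrite pevalC adjoin_base.
- by rewrite pevalXU; case: ifP.
- by rewrite pevalD rpredD.
by rewrite pevalM rpredM.
Qed.

Lemma peval_comp x y (a b f : {mpoly K[2]}) :
  peval iota x y (f \mPo [tuple a; b])
  = peval iota (peval iota x y a) (peval iota x y b) f.
Proof.
elim/mpoly_closed_ind: f => [c|i|f g hf hg|f g hf hg].
- by rewrite comp_mpolyC !pevalC.
- rewrite comp_mpolyXU pevalXU; case: i => -[|[|[]]] // ?.
- by rewrite comp_mpolyD !pevalD hf hg.
by rewrite rmorphM !pevalM hf hg.
Qed.

Variables (W : weierstrass K) (ellW : elliptic W).
Local Notation WL := (map_weierstrass iota W).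
Local Notation pt := (curve_pt (elliptic_map iota ellW)).

Lemma peval_inv_pullback u (Q : pt) : Q != 0 ->
  peval iota (xc Q) (yc Q) (inv_pullback W u) = peval iota (xc (- Q)) (yc (- Q)) u.
Proof.
move=> Q0; rewrite /inv_pullback peval_comp xcN ycN //.
congr (peval _ _ _ _); first by rewrite pevalX.
by rewrite !(pevalB, pevalN, pevalM, pevalC, pevalX, pevalY).
Qed.

Lemma exact_orderN n (Q : pt) : exact_order n Q -> exact_order n (- Q).
Proof.
move=> /exact_orderP[n0 qn h]; apply/exact_orderP; split=> //.
  by rewrite mulNrn qn oppr0.
by move=> j jn; rewrite mulNrn oppr_eq0 h.
Qed.

Lemma coords_generated u (S : set L) (Q : pt) : generates_coord_ring W u -> Q != 0 ->
  S (peval iota (xc Q) (yc Q) u) -> S (peval iota (xc (- Q)) (yc (- Q)) u) ->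
  xc Q \in adjoin iota S /\ yc Q \in adjoin iota S.
Proof.
move=> ug Q0 s1 s2.
have key f : peval iota (xc Q) (yc Q) f \in adjoin iota S.
  have [P /qpiE e] := ug (qpi [:: w_poly W] f).
  have : peval iota (xc Q) (yc Q) (f - (P \mPo [tuple u; inv_pullback W u])) = 0.
    apply: (peval_ideal _ e) => g; rewrite inE => /eqP ->.
    by apply/eqP; rewrite peval_w -valE // pt_on.
  rewrite pevalB => /eqP; rewrite subr_eq0 => /eqP ->.
  rewrite peval_comp peval_inv_pullback //.
  by apply: peval_in; apply: adjoin_gen.
have := key (Defs.mX K); have := key (Defs.mY K).
by rewrite pevalX pevalY.
Qed.

End Peval.

(** * The isomorphisms of fields and of Galois groups *)

Section Corollary.
Variables (K : fieldType) (L : closedFieldType) (iota : {rmorphism K -> L}).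
Hypothesis alg : forall z : L, algebraicOver iota z.
Hypothesis char0 : forall n, n.+1%:R != 0 :> L.
Variables (W : weierstrass K) (ellW : elliptic W).
Variables (u : {mpoly K[2]}) (ug : generates_coord_ring W u).
Variables (n : nat) (n0 : (0 < n)%N).
Local Notation WL := (map_weierstrass iota W).
Local Notation ell := (elliptic_map iota ellW).
Local Notation S1 := (roots_of iota (chi_poly W u n)).
Local Notation S2 := (torsion_coords WL n).

Lemma torsion_coords_pt (Q : curve_pt ell) : Q != 0 -> Q *+ n = 0 ->
  S2 (xc Q) /\ S2 (yc Q).
Proof.
move=> Q0 qn; have h : Some (xc Q, yc Q) \in torsion WL n.
  by rewrite -valE // torsionP qn.
by split; exists (xc Q), (yc Q); split=> //; [left|right].
Qed.

Lemma roots_in_torsion z : S1 z -> z \in adjoin iota S2.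
Proof.
move=> /(root_chi_poly iota ellW char0 n0 u _)[Q [Q0 /exact_orderP[_ qn _] ->]].
by have [hx hy] := torsion_coords_pt Q0 qn; apply: peval_in; apply: adjoin_gen.
Qed.

Lemma torsion_in_roots z : S2 z -> z \in adjoin iota S1.
Proof.
move=> [x [y [Rt zxy]]].
have WS : [/\ a1 WL \in adjoin iota S1, a2 WL \in adjoin iota S1,
  a3 WL \in adjoin iota S1 & a4 WL \in adjoin iota S1].
  by split; apply: adjoin_base.
have cn Q := @coords_in_neg _ _ _ _ _ WS Q.
have ca P Q := @coords_in_add _ _ _ _ _ WS P Q.
have ex (Q : curve_pt ell) : exact_order n Q -> coords_in iota S1 (val Q).
  move=> oQ; have [->//|Q0] := eqVneq Q 0.
  have [hx hy] : xc Q \in adjoin iota S1 /\ yc Q \in adjoin iota S1.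
    apply: (coords_generated ug Q0); apply/(root_chi_poly iota ellW char0 n0 u _).
      by exists Q.
    by exists (- Q); rewrite oppr_eq0 exact_orderN.
  by rewrite valE //= hx hy.
have onR : on_curve WL (Some (x, y)) by case/andP: Rt.
pose R := CurvePt ell onR; have Rn : R *+ n = 0 by apply/eqP; rewrite -torsionP.
have [P oP] := exists_exact_order ell char0 n0.
have [k oQ] := exact_order_translate oP Rn.
have cP : coords_in iota S1 (val (P *+ k)).
  elim: k {oQ} => // k IH; rewrite mulrS val_cpD; apply: ca => //; exact: ex.
have : coords_in iota S1 (val R).
  rewrite -(addrK (P *+ k) R) val_cpD val_cpN; apply: ca; first exact: ex.
  exact: cn.
by case/andP=> hx hy; case: zxy => ->.
Qed.

Lemma adjoin_roots_torsion : adjoin iota S1 =i adjoin iota S2.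
Proof.
move=> z; apply/idP/idP; apply: adjoin_sub.
  exact: roots_in_torsion.
exact: torsion_in_roots.
Qed.

Lemma rho_eq s t : gal_over iota s -> gal_over iota t ->
  rho iota W n s = rho iota W n t <-> (forall x, S2 x -> s x = t x).
Proof.
move=> sG tG; split=> [e x [a [b [h xab]]]|h].
  pose Q : torsion_pt WL n := exist (fun P => P \in torsion WL n) _ h.
  have /(congr1 val) := congr1 (fun f => f Q) e.
  by rewrite !rhoE //= => -[ea eb]; case: xab => ->.
apply/funext => -[[[a b]|] hP]; apply: val_inj; rewrite !rhoE //=.
by congr (Some (_, _)); apply: h; exists a, b; split=> //; [left|right].
Qed.

Lemma gal_restrict t : gal_over iota t ->
  exists2 s, gal_over (adjoined_in iota S1) s &
    forall a : adjoined iota S1, t (val a) = val (s a).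
Proof.
move=> tG; have [r rG [tr rt]] := gal_inv tG.
have st s (sG : gal_over iota s) (a : adjoined iota S1) : s (val a) \in adjoin iota S1.
  by apply: (gal_stable sG (gal_roots sG)); apply: valP.
case/gal_overP: (tG) => tB [t1 tM] _ tK.
exists (fun a => Adjoined (st t tG a)) => //; split.
- by move=> a b; apply: val_inj; apply: (tB (val a) (val b)).
- by split=> [|a b]; apply: val_inj; [apply: t1|apply: (tM (val a) (val b))].
- by exists (fun a => Adjoined (st r rG a)) => a; apply: val_inj; rewrite /= ?tr ?rt.
by move=> a; apply: val_inj; apply: tK.
Qed.

(** The implication under the quantifier makes the chosen lift a total function of s, as the map in
    [perm_group_isom] must be. *)
Lemma gal_lift_exists (s : adjoined iota S1 -> adjoined iota S1) :
  exists t, gal_over (adjoined_in iota S1) s ->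
  gal_over iota t /\ forall a : adjoined iota S1, t (val a) = val (s a).
Proof.
have [sG|nG] := pselect (gal_over (adjoined_in iota S1) s); last by exists id.
by have [t tP] := gal_extend alg sG; exists t.
Qed.

Definition gal_lift s : L -> L := projT1 (cid (gal_lift_exists s)).

Lemma gal_liftP s : gal_over (adjoined_in iota S1) s ->
  gal_over iota (gal_lift s) /\
  forall a : adjoined iota S1, gal_lift s (val a) = val (s a).
Proof. exact: projT2 (cid (gal_lift_exists s)). Qed.

(** Chosen lifts need not compose to chosen lifts. On torsion coordinates, however, a lift is
    determined by s, which is all that [rho_eq] asks. *)
Lemma gal_lift_torsion s t : gal_over (adjoined_in iota S1) s ->
  (forall a : adjoined iota S1, t (val a) = val (s a)) ->
  forall x, S2 x -> gal_lift s x = t x.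
Proof.
move=> sG ts x Sx; have [_ h] := gal_liftP sG.
have hx : x \in adjoin iota S1 by rewrite adjoin_roots_torsion; apply: adjoin_gen.
by have := h (Adjoined hx); rewrite -ts.
Qed.

Lemma perm_group_isom_rho :
  perm_group_isom (gal_over (adjoined_in iota S1)) (rho_image iota W n).
Proof.
exists (fun s => rho iota W n (gal_lift s)); split; last first.
  move=> f g fG gG; have [fl fE] := gal_liftP fG; have [gl gE] := gal_liftP gG.
  rewrite -rho_comp //.
  have [fB [f1 fM] fb fK] := gal_overP fG; have [gB [g1 gM] gb gK] := gal_overP gG.
  have fgG : gal_over (adjoined_in iota S1) (f \o g).
    split; first by move=> a b /=; rewrite gB fB.
    - by split=> [|a b] /=; rewrite ?g1 ?f1 ?gM ?fM.
    - exact: bij_comp.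
    - by move=> a /=; rewrite gK fK.
  have [fgl _] := gal_liftP fgG.
  have cG : gal_over iota (gal_lift f \o gal_lift g).
    have [B [o M] b k] := gal_overP fl; have [B' [o' M'] b' k'] := gal_overP gl.
    split; first by move=> x y /=; rewrite B' B.
    - by split=> [|x y] /=; rewrite ?o' ?o ?M' ?M.
    - exact: bij_comp.
    - by move=> a /=; rewrite k' k.
  apply/rho_eq => //; apply: gal_lift_torsion => // a /=.
  by rewrite gE fE.
split.
- by move=> s sG; exists (gal_lift s) => //; case: (gal_liftP sG).
- move=> f g /set_mem fG /set_mem gG e.
  have [fl fE] := gal_liftP fG; have [gl gE] := gal_liftP gG.
  have {}e := proj1 (rho_eq fl gl) e.
  apply/funext => a; apply: val_inj; rewrite -fE -gE.
  apply: (gal_agree fl gl e); rewrite -adjoin_roots_torsion; exact: valP.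
move=> _ [t tG <-]; have [s sG ts] := gal_restrict tG.
exists s => //; have [sl _] := gal_liftP sG.
by apply/rho_eq => //; apply: gal_lift_torsion.
Qed.

End Corollary.

Theorem corollary1p17 (K : fieldExtType rat) (Kbar : closedFieldType)
    (iota : {rmorphism K -> Kbar})
    (Kbar_alg : forall z : Kbar, algebraicOver iota z)
    (E : weierstrass K) (E_ell : elliptic E)
    (u : {mpoly K[2]}) (u_deg1 : msize u = 2%N)
    (u_gen : generates_coord_ring E u)
    (n : nat) (n_gt0 : (0 < n)%N) :
  ext_isom
    (adjoined_in iota (roots_of iota (chi_poly E u n)))
    (adjoined_in iota (torsion_coords (map_weierstrass iota E) n)) /\
  perm_group_isom
    (gal_over (adjoined_in iota (roots_of iota (chi_poly E u n))))
    (rho_image iota E n).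
Proof.
have char0 m : m.+1%:R != 0 :> Kbar.
  rewrite -(rmorph_nat iota) fmorph_eq0 -(rmorph_nat (in_alg K)) fmorph_eq0.
  by rewrite Num.Theory.pnatr_eq0.
split; last exact: perm_group_isom_rho.
by apply: ext_isom_adjoin; apply: adjoin_roots_torsion.
Qed.
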